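(* Let $W$ be an irreducible finite complex $2$-reflection group, and $B$ the associated braid group. The inflation morphism $H^2(W,\mathbb{C}^\times)\to H^2(B,\mathbb{C}^\times)$ is injective.
   Context: A complex reflection group is a finite subgroup $W\subset GL_r(\mathbb{C})$ generated by (pseudo-)reflections (finite-order elements whose fixed space is a hyperplane); it is a $2$-reflection group if all its reflections have order $2$. With $\mathcal{A}$ the set of reflecting hyperplanes and $X=\mathbb{C}^r\setminus\bigcup\mathcal{A}$, the braid group is $B=\pi_1(X/W)$; it is an extension $1\to P\to B\to W\to1$ with $P=\pi_1(X)$. Inflation is along the surjection $B\to W$. Both groups act trivially on $\mathbb{C}^\times$. *)

(* Defs.v *)
From HB Require Import structures.
From mathcomp Require Import all_boot all_order all_algebra all_fingroup.
From mathcomp Require Import all_character.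
From mathcomp Require Import all_classical all_reals all_analysis.
From mathcomp Require Import generic_quotient homotopy complex ring lra.

Set Implicit Arguments.
Unset Strict Implicit.
Unset Printing Implicit Defensive.

Import Order.TTheory GRing.Theory Num.Theory.
Import numFieldTopology.Exports numFieldNormedType.Exports.

Local Open Scope classical_set_scope.
Local Open Scope ring_scope.
Local Open Scope quotient_scope.

HB.instance Definition _ (R : realType) := NormedModule.copy R[i] R[i]^o.

Definition unit_interval (R : realType) : Type := set_type `[(0 : R), 1].

Section UnitInterval.
Variable R : realType.
Local Notation I := (unit_interval R).

HB.instance Definition _ :=
  Topological.copy I (set_type `[(0 : R), 1]).

Fact clamp_subproof (t : R) : Num.max 0 (Num.min 1 t) \in `[(0 : R), 1]%classic.
Proof.
apply/mem_set; rewrite /= in_itv /= le_max lexx /=.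
by rewrite ge_max ler01 /= ge_min lexx.
Qed.

Definition clamp (t : R) : I :=
  exist (fun x => x \in `[(0 : R), 1]%classic) _ (clamp_subproof t).

Definition ival (t : I) : R := set_val t.

Lemma ival_ge0 (t : I) : 0 <= ival t.
Proof. by have := set_valP t; rewrite /= in_itv /= => /andP[]. Qed.

Lemma ival_le1 (t : I) : ival t <= 1.
Proof. by have := set_valP t; rewrite /= in_itv /= => /andP[]. Qed.

Lemma ival_inj : injective ival.
Proof. exact: val_inj. Qed.

Lemma ival_clamp (t : R) : ival (clamp t) = Num.max 0 (Num.min 1 t).
Proof. by rewrite /ival /clamp set_valE. Qed.

Lemma clampK (t : R) : 0 <= t <= 1 -> ival (clamp t) = t.
Proof. by case/andP=> t0 t1; rewrite ival_clamp (min_idPr t1) (max_idPr t0). Qed.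

Lemma ivalK (t : I) : clamp (ival t) = t.
Proof. by apply: ival_inj; rewrite clampK // ival_ge0 ival_le1. Qed.

Lemma ival_continuous : continuous ival.
Proof. exact: initial_continuous. Qed.

Lemma clamp_continuous : continuous clamp.
Proof.
apply: continuous_comp_initial => t.
have cmin : {for t, continuous (fun t : R => Num.min 1 t)}.
  by apply: (@continuous_min R R^o (fun=> 1) id); [exact: cst_continuous|].
by apply: (@continuous_max R R^o (fun=> 0) (fun t => Num.min 1 t));
  [exact: cst_continuous|].
Qed.

Fact unit_interval01 : clamp 0 != clamp 1.
Proof.
apply/eqP => /(congr1 ival); rewrite !clampK ?lexx ?ler01 //.
by move/eqP; rewrite eq_sym oner_eq0.
Qed.

HB.instance Definition _ := isBiPointed.Build I unit_interval01.

Lemma ival0 : ival zero = 0.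
Proof. by rewrite clampK // lexx ler01. Qed.

Lemma ival1 : ival one = 1.
Proof. by rewrite clampK // lexx ler01. Qed.

Lemma paste_continuous (Y T : topologicalType) (phi : Y -> R) (f g : Y -> T)
    (c : R) :
  continuous phi -> continuous f -> continuous g ->
  (forall y, phi y = c -> f y = g y) ->
  continuous (fun y => if phi y <= c then f y else g y).
Proof.
move=> cphi cf cg fg; set h := (fun y => _).
pose A := phi @^-1` [set x | x <= c]; pose B := phi @^-1` [set x | c <= x].
have clA : closed A.
  by apply: closed_comp; [move=> y _; exact: cphi|exact: closed_le].
have clB : closed B.
  by apply: closed_comp; [move=> y _; exact: cphi|exact: closed_ge].
have AB : A `|` B = setT.
  by apply/seteqP; split=> // y _; case: (leP (phi y) c) => [|/ltW]; [left|right].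
have hA : {within A, continuous h}.
  apply: (@subspace_eq_continuous _ _ _ f); last exact: continuous_subspaceT.
  by move=> y /set_mem Ay; rewrite /from_subspace /h ifT.
have hB : {within B, continuous h}.
  apply: (@subspace_eq_continuous _ _ _ g); last exact: continuous_subspaceT.
  move=> y /set_mem By; rewrite /from_subspace /h; case: ifP => // le_c.
  by rewrite fg //; apply/le_anti/andP.
have hAB : {within A `|` B, continuous h} by exact: withinU_continuous.
by apply/continuous_subspace_setT; rewrite -AB.
Qed.

End UnitInterval.

Section Homotopy.
Variables (R : realType) (T : topologicalType).
Local Notation I := (unit_interval R).
Implicit Types x y z : T.

Definition homotopic x y (f g : {path I from x to y}) : Prop :=
  exists H : I * I -> T,
    [/\ continuous H,
        forall t, H (t, zero) = f t,
        forall t, H (t, one) = g t,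
        forall s, H (zero, s) = x &
        forall s, H (one, s) = y].

Lemma paths_continuous x y (f : {path I from x to y}) : continuous f.
Proof. exact: cts_fun. Qed.

Lemma clampD_continuous (Y : topologicalType) (phi : Y -> R) :
  continuous phi -> continuous (fun u => clamp (phi u)).
Proof.
move=> c u; apply: (@continuous_comp _ _ _ phi (@clamp R)); first exact: c.
exact: clamp_continuous.
Qed.

Lemma clamp_ival_continuous (phi : R -> R) :
  continuous phi -> continuous (fun t : I => clamp (phi (ival t))).
Proof.
move=> c; apply: (@clampD_continuous I (phi \o @ival R)) => t.
by apply: continuous_comp; [exact: ival_continuous | exact: c].
Qed.

Lemma homotopic_reparam x y (f : I -> T) (g h : {path I from x to y})
    (phi psi : I -> I) :
  continuous f -> continuous phi -> continuous psi ->
  phi zero = psi zero -> phi one = psi one ->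
  (forall t, g t = f (phi t)) -> (forall t, h t = f (psi t)) ->
  homotopic g h.
Proof.
move=> cf cphi cpsi e0 e1 gE hE.
pose u (ts : I * I) : R :=
  (1 - ival ts.2) * ival (phi ts.1) + ival ts.2 * ival (psi ts.1).
have cival (F : I -> I) (G : I * I -> I) : continuous F -> continuous G ->
    continuous (fun ts => ival (F (G ts))).
  move=> cF cG ts; apply: (@continuous_comp _ _ _ (F \o G)).
    by apply: continuous_comp; [exact: cG | exact: cF].
  exact: ival_continuous.
have c1 : continuous (fst : I * I -> I) by move=> ?; exact: cvg_fst.
have c2 : continuous (snd : I * I -> I) by move=> ?; exact: cvg_snd.
have cid0 : continuous (@id I) by move=> ?; exact: cvg_id.
have cu : continuous u.
  move=> ts; apply: cvgD; apply: cvgM.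
  - apply: cvgB; first exact: cvg_cst.
    exact: (cival id snd cid0 c2).
  - exact: (cival phi fst cphi c1).
  - exact: (cival id snd cid0 c2).
  - exact: (cival psi fst cpsi c1).
exists (fun ts => f (clamp (u ts))); split.
- move=> ts; apply: (@continuous_comp _ _ _ (fun ts => clamp (u ts)) f).
    exact: clampD_continuous.
  exact: cf.
- by move=> t; rewrite gE /u /= ival0 subr0 mul1r mul0r addr0 ivalK.
- by move=> t; rewrite hE /u /= ival1 subrr mul1r mul0r add0r ivalK.
- move=> s; rewrite /u /= -e0 -mulrDl subrK mul1r ivalK -gE.
  exact: path_zero.
- move=> s; rewrite /u /= -e1 -mulrDl subrK mul1r ivalK -gE.
  exact: path_one.
Qed.

Lemma homotopic_refl x y (f : {path I from x to y}) : homotopic f f.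
Proof.
apply: (@homotopic_reparam _ _ f f f id id) => //;
  by [exact: paths_continuous | move=> ?; exact: cvg_id].
Qed.

Definition flip (t : I) : I := clamp (1 - ival t).

Lemma flip_continuous : continuous flip.
Proof.
apply: (@clamp_ival_continuous (fun u => 1 - u)) => u.
by apply: cvgB; [exact: cvg_cst | exact: cvg_id].
Qed.

Lemma ival_flip t : ival (flip t) = 1 - ival t.
Proof. by rewrite clampK // subr_ge0 ival_le1 gerBl ival_ge0. Qed.

Lemma flip0 : flip zero = one. Proof. by rewrite /flip ival0 subr0. Qed.

Lemma flip1 : flip one = zero. Proof. by rewrite /flip ival1 subrr. Qed.

Lemma hcomp_continuous (F : I * I -> T) (k : I -> I) :
  continuous F -> continuous k -> continuous (fun ts => F (ts.1, k ts.2)).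
Proof.
move=> cF ck ts.
have c1 : {for ts, continuous (fst : I * I -> I)} by exact: cvg_fst.
have c2 : {for ts, continuous (snd : I * I -> I)} by exact: cvg_snd.
apply: (@continuous_comp _ _ _ (fun ts => (ts.1, k ts.2)) F); last exact: cF.
exact: (cvg_pair c1 (continuous_comp c2 (ck _))).
Qed.

Lemma homotopic_sym x y (f g : {path I from x to y}) :
  homotopic f g -> homotopic g f.
Proof.
case=> H [cH H0 H1 Hx Hy]; exists (fun ts => H (ts.1, flip ts.2)).
split=> //= [|t|t]; last 2 first.
- by rewrite flip0.
- by rewrite flip1.
exact: hcomp_continuous cH flip_continuous.
Qed.

Definition half1 (t : I) : I := clamp (2 * ival t).
Definition half2 (t : I) : I := clamp (2 * ival t - 1).

Lemma half1_continuous : continuous half1.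
Proof.
apply: (@clamp_ival_continuous (fun u => 2 * u)) => u.
by apply: cvgM; [exact: cvg_cst | exact: cvg_id].
Qed.

Lemma half2_continuous : continuous half2.
Proof.
apply: (@clamp_ival_continuous (fun u => 2 * u - 1)) => u.
apply: cvgB; last exact: cvg_cst.
by apply: cvgM; [exact: cvg_cst | exact: cvg_id].
Qed.

Lemma half1_2 t : ival t = 2^-1 -> half1 t = one.
Proof. by move=> tE; rewrite /half1 tE divff. Qed.

Lemma half2_2 t : ival t = 2^-1 -> half2 t = zero.
Proof. by move=> tE; rewrite /half2 tE divff // subrr. Qed.

Lemma half1_0 : half1 zero = zero. Proof. by rewrite /half1 ival0 mulr0. Qed.

Lemma half2_1 : half2 one = one.
Proof. by rewrite /half2 ival1; congr clamp; lra. Qed.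

Lemma homotopic_trans x y (f g h : {path I from x to y}) :
  homotopic f g -> homotopic g h -> homotopic f h.
Proof.
case=> H [cH H0 H1 Hx Hy] [K [cK K0 K1 Kx Ky]].
exists (fun ts => if ival ts.2 <= 2^-1 then H (ts.1, half1 ts.2)
                  else K (ts.1, half2 ts.2)).
split=> /= [|t|t|s|s].
- apply: paste_continuous.
  + move=> ts; apply: continuous_comp; first exact: cvg_snd.
    exact: ival_continuous.
  + exact: (hcomp_continuous cH half1_continuous).
  + exact: (hcomp_continuous cK half2_continuous).
  + by move=> [t s] /= sE; rewrite half1_2 // half2_2 // H1 K0.
- by rewrite ival0 invr_ge0 ler0n half1_0 H0.
- by rewrite ival1 ifF ?half2_1 ?K1 //; apply/negbTE; rewrite -ltNge; lra.
- by case: ifP.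
- by case: ifP.
Qed.

Section Concat.
Variables (x y z : T) (f : {path I from x to y}) (g : {path I from y to z}).

(** [f] followed by [g] *)
Definition path_concat (t : I) : T :=
  if ival t <= 2^-1 then f (half1 t) else g (half2 t).

Fact path_concat_continuous : continuous path_concat.
Proof.
apply: paste_continuous.
- exact: ival_continuous.
- move=> t; apply: continuous_comp; first exact: half1_continuous.
  exact: paths_continuous.
- move=> t; apply: continuous_comp; first exact: half2_continuous.
  exact: paths_continuous.
- by move=> t tE; rewrite half1_2 // half2_2 // path_one path_zero.
Qed.

Fact path_concat0 : path_concat zero = x.
Proof.
by rewrite /path_concat ival0 invr_ge0 ler0n half1_0 path_zero.
Qed.

Fact path_concat1 : path_concat one = z.
Proof.
rewrite /path_concat ival1 ifF ?half2_1 ?path_one //.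
by apply/negbTE; rewrite -ltNge; lra.
Qed.

HB.instance Definition _ :=
  @isContinuous.Build I T path_concat path_concat_continuous.
HB.instance Definition _ :=
  @isPath.Build I T x z path_concat path_concat0 path_concat1.

End Concat.

Section Inverse.
Variables (x y : T) (f : {path I from x to y}).

Definition path_rev (t : I) : T := f (flip t).

Fact path_rev_continuous : continuous path_rev.
Proof.
move=> t; apply: continuous_comp; first exact: flip_continuous.
exact: paths_continuous.
Qed.

Fact path_rev0 : path_rev zero = y.
Proof. by rewrite /path_rev flip0 path_one. Qed.

Fact path_rev1 : path_rev one = x.
Proof. by rewrite /path_rev flip1 path_zero. Qed.

HB.instance Definition _ :=
  @isContinuous.Build I T path_rev path_rev_continuous.
HB.instance Definition _ := @isPath.Build I T y x path_rev path_rev0 path_rev1.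

End Inverse.

Lemma path_concatE x y z (f : {path I from x to y}) (g : {path I from y to z})
    t :
  path_concat f g t = if ival t <= 2^-1 then f (half1 t) else g (half2 t).
Proof. by []. Qed.

Lemma path_revE x y (f : {path I from x to y}) t :
  path_rev f t = f (flip t).
Proof. by []. Qed.

Lemma path_revK x y (f : {path I from x to y}) : path_rev (path_rev f) = f :> (I -> T).
Proof.
apply/funext => t; rewrite /path_rev; congr (f _); apply: ival_inj.
by rewrite !ival_flip subKr.
Qed.

Lemma homotopic_concat x y z (f f' : {path I from x to y})
    (g g' : {path I from y to z}) :
  homotopic f f' -> homotopic g g' ->
  homotopic (path_concat f g) (path_concat f' g').
Proof.
case=> H [cH H0 H1 Hx Hy] [K [cK K0 K1 Kx Ky]].
exists (fun ts => if ival ts.1 <= 2^-1 then H (half1 ts.1, ts.2)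
                  else K (half2 ts.1, ts.2)).
have cc (F : I * I -> T) (k : I -> I) : continuous F -> continuous k ->
    continuous (fun ts => F (k ts.1, ts.2)).
  move=> cF ck ts.
  have c1 : {for ts, continuous (fst : I * I -> I)} by exact: cvg_fst.
  have c2 : {for ts, continuous (snd : I * I -> I)} by exact: cvg_snd.
  apply: (@continuous_comp _ _ _ (fun ts => (k ts.1, ts.2)) F); last exact: cF.
  exact: (cvg_pair (continuous_comp c1 (ck _)) c2).
split=> /= [|t|t|s|s].
- apply: paste_continuous.
  + move=> ts; apply: continuous_comp; first exact: cvg_fst.
    exact: ival_continuous.
  + exact: cc cH half1_continuous.
  + exact: cc cK half2_continuous.
  + by move=> [t s] /= tE; rewrite half1_2 // half2_2 // Hy Kx.
- by rewrite /= !path_concatE; case: ifP.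
- by rewrite /= !path_concatE; case: ifP.
- by rewrite ival0 invr_ge0 ler0n half1_0.
- by rewrite ival1 ifF ?half2_1 //; apply/negbTE; rewrite -ltNge; lra.
Qed.

Lemma homotopic_rev x y (f g : {path I from x to y}) :
  homotopic f g -> homotopic (path_rev f) (path_rev g).
Proof.
case=> H [cH H0 H1 Hx Hy]; exists (fun ts => H (flip ts.1, ts.2)).
split=> /= [ts|t|t|s|s].
- have c1 : {for ts, continuous (fst : I * I -> I)} by exact: cvg_fst.
  have c2 : {for ts, continuous (snd : I * I -> I)} by exact: cvg_snd.
  apply: (@continuous_comp _ _ _ (fun ts => (flip ts.1, ts.2)) H);
    last exact: cH.
  exact: (cvg_pair (continuous_comp c1 (@flip_continuous _)) c2).
- by rewrite H0.
- by rewrite H1.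
- by rewrite flip0.
- by rewrite flip1.
Qed.

Lemma ival_half1 (t : I) : ival t <= 2^-1 -> ival (half1 t) = 2 * ival t.
Proof. by move=> t2; rewrite clampK //; have := ival_ge0 t; lra. Qed.

Lemma ival_half2 (t : I) : 2^-1 <= ival t -> ival (half2 t) = 2 * ival t - 1.
Proof. by move=> t2; rewrite clampK //; have := ival_le1 t; lra. Qed.

Lemma half1_ge (t : I) : 2^-1 <= ival t -> half1 t = one.
Proof.
move=> t2; apply: ival_inj; rewrite ival1 ival_clamp (min_idPl _) ?max_r //.
lra.
Qed.

Lemma half2_le (t : I) : ival t <= 2^-1 -> half2 t = zero.
Proof.
move=> t2; apply: ival_inj; rewrite ival0 ival_clamp (max_idPl _) //.
by rewrite ge_min; apply/orP; right; lra.
Qed.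

Let cid : continuous (@id I).
Proof. by move=> ?; exact: cvg_id. Qed.

Lemma homotopic_mul1 x y (f : {path I from x to y}) :
  homotopic (path_concat (cst x : {path I from x to x}) f) f.
Proof.
apply: (@homotopic_reparam _ _ f _ f half2 id) => //.
- exact: paths_continuous.
- exact: half2_continuous.
- by rewrite half2_le // ival0 invr_ge0.
- by rewrite half2_1.
- move=> t; rewrite /= path_concatE; case: leP => t2 //.
  by rewrite half2_le // path_zero.
Qed.

Lemma homotopic_mulr1 x y (f : {path I from x to y}) :
  homotopic (path_concat f (cst y : {path I from y to y})) f.
Proof.
apply: (@homotopic_reparam _ _ f _ f half1 id) => //.
- exact: paths_continuous.
- exact: half1_continuous.
- by rewrite half1_0.
- by rewrite half1_ge // ival1; lra.
- move=> t; rewrite /= path_concatE; case: leP => // /ltW t2.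
  by rewrite half1_ge // path_one.
Qed.

Let min_continuous (u v : R -> R) : continuous u -> continuous v ->
  continuous (fun t => Num.min (u t) (v t)).
Proof. by move=> cu cv t; apply: (@continuous_min R R u v t); [exact: cu | exact: cv]. Qed.

Lemma homotopic_mulV x y (f : {path I from x to y}) :
  homotopic (path_concat f (path_rev f)) (cst x : {path I from x to x}).
Proof.
pose u (t : R) := Num.min (2 * t) (2 - 2 * t).
have c2 : continuous (fun t : R => 2 * t).
  by move=> t; apply: cvgM; [exact: cvg_cst | exact: cvg_id].
have cu : continuous u.
  apply: min_continuous => // t; apply: cvgB; first exact: cvg_cst.
  exact: c2.
apply: (@homotopic_reparam _ _ f _ (cst x)
  (fun t => clamp (u (ival t))) (fun=> zero)) => //.
- exact: paths_continuous.
- exact: clamp_ival_continuous cu.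
- exact: cst_continuous.
- by rewrite ival0 /u mulr0 subr0 min_l.
- by rewrite ival1 /u mulr1 subrr min_r.
- move=> t; have t0 := ival_ge0 t; have t1 := ival_le1 t.
  rewrite /= path_concatE /= path_revE; case: leP => [t2|/ltW t2].
    by rewrite /u min_l //; lra.
  congr (f _); apply: ival_inj; rewrite ival_flip ival_half2 //.
  by rewrite clampK /u min_r; lra.
- by move=> t /=; rewrite path_zero.
Qed.

Lemma homotopic_mulA x y z w (f : {path I from x to y})
    (g : {path I from y to z}) (h : {path I from z to w}) :
  homotopic (path_concat f (path_concat g h)) (path_concat (path_concat f g) h).
Proof.
apply: homotopic_sym.
pose u (t : R) := Num.min (2 * t) (Num.min (t + 4^-1) (2^-1 * (t + 1))).
have cu : continuous u.
  apply: min_continuous => [t|].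
    by apply: cvgM; [exact: cvg_cst | exact: cvg_id].
  apply: min_continuous => t.
    by apply: cvgD; [exact: cvg_id | exact: cvg_cst].
  apply: cvgM; first exact: cvg_cst.
  by apply: cvgD; [exact: cvg_id | exact: cvg_cst].
have u1 t : t <= 4^-1 -> u t = 2 * t.
  by move=> *; rewrite /u; case: (leP (t + _)) => ?; case: leP => ?; lra.
have u2 t : 4^-1 <= t -> t <= 2^-1 -> u t = t + 4^-1.
  by move=> *; rewrite /u; case: (leP (t + _)) => ?; case: leP => ?; lra.
have u3 t : 2^-1 <= t -> u t = 2^-1 * (t + 1).
  by move=> *; rewrite /u; case: (leP (t + _)) => ?; case: leP => ?; lra.
apply: (@homotopic_reparam _ _ (path_concat f (path_concat g h)) _
  (path_concat f (path_concat g h)) (fun t => clamp (u (ival t))) id) => //.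
- exact: path_concat_continuous.
- exact: clamp_ival_continuous cu.
- by rewrite ival0 u1 ?mulr0 // invr_ge0.
- by rewrite ival1 u3; [congr clamp; lra | lra].
- move=> t; have t0 := ival_ge0 t; have t1 := ival_le1 t.
  rewrite /= !path_concatE /= !path_concatE.
  have [t4|t4] := leP (ival t) (4^-1).
    have vE : ival (clamp (u (ival t))) = 2 * ival t by rewrite u1 // clampK; lra.
    have t2 : ival t <= 2^-1 by lra.
    rewrite vE t2 ival_half1 // ifT; last by lra.
    rewrite ifT; last by lra.
    by congr (f _); apply: ival_inj; rewrite !ival_half1 ?vE ?ival_half1 //; lra.
  have [t2|t2] := leP (ival t) (2^-1).
    have vE : ival (clamp (u (ival t))) = ival t + 4^-1.
      by rewrite u2 ?clampK //; lra.
    set v := clamp _ in vE *.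
    have v2 : 2^-1 <= ival v by lra.
    have t2' : 2^-1 <= ival (half1 t) by rewrite ival_half1 //; lra.
    have hv : ival (half2 v) <= 2^-1 by rewrite ival_half2 // vE; lra.
    rewrite hv ival_half1 // ifF; last by lra.
    rewrite ifF; last by lra.
    congr (g _); apply: ival_inj.
    by rewrite ival_half2 // !ival_half1 // ival_half2 // vE; lra.
  have vE : ival (clamp (u (ival t))) = 2^-1 * (ival t + 1).
    by rewrite u3 ?clampK //; lra.
  set v := clamp _ in vE *.
  have v2 : 2^-1 <= ival v by lra.
  have hv : ival (half2 v) = ival t by rewrite ival_half2 // vE; lra.
  rewrite hv vE ifF; last by lra.
  rewrite ifF; last by lra.
  congr (h _); apply: ival_inj.
  by rewrite !ival_half2 ?hv //; lra.
Qed.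

End Homotopy.

Section FundamentalGroup.
Variables (R : realType) (T : topologicalType) (x0 : T).
Local Notation I := (unit_interval R).
Local Notation loop := {path I from x0 to x0}.

Definition homotopicb (f g : loop) : bool := `[< homotopic f g >].

Fact homotopicb_equiv : equiv_class_of homotopicb.
Proof.
split=> [f|f g|g f h].
- exact/asboolP/homotopic_refl.
- by apply/asboolP/asboolP; exact: homotopic_sym.
- by move=> /asboolP fg /asboolP gh; exact/asboolP/homotopic_trans/gh.
Qed.

Canonical homotopicb_equivRel := EquivRelPack homotopicb_equiv.

Definition fundamental_group : Type := {eq_quot homotopicb}.

HB.instance Definition _ := Choice.on fundamental_group.
HB.instance Definition _ := EqQuotient.on fundamental_group.

Local Notation pi1 := fundamental_group.

Definition loop_class (f : loop) : pi1 := \pi_pi1 f.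

Lemma loop_classP (f g : loop) :
  loop_class f = loop_class g <-> homotopic f g.
Proof.
by split=> [/eqmodP/asboolP|fg] //; apply/eqmodP/asboolP.
Qed.

Lemma loop_classK (a : pi1) : loop_class (repr a) = a.
Proof. exact: reprK. Qed.

Definition pi1_one : pi1 := loop_class (cst x0).
Definition pi1_mul (a b : pi1) : pi1 :=
  loop_class (path_concat (repr a) (repr b)).
Definition pi1_inv (a : pi1) : pi1 := loop_class (path_rev (repr a)).

Lemma repr_homotopic (f : loop) : homotopic (repr (loop_class f)) f.
Proof. by apply/loop_classP; rewrite loop_classK. Qed.

Fact pi1_mulE (f g : loop) :
  pi1_mul (loop_class f) (loop_class g) = loop_class (path_concat f g).
Proof. by apply/loop_classP/homotopic_concat; exact: repr_homotopic. Qed.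

Fact pi1_invE (f : loop) : pi1_inv (loop_class f) = loop_class (path_rev f).
Proof. by apply/loop_classP/homotopic_rev; exact: repr_homotopic. Qed.

Fact pi1_mulA : associative pi1_mul.
Proof.
move=> a b c; rewrite -(loop_classK a) -(loop_classK b) -(loop_classK c).
by rewrite !pi1_mulE; apply/loop_classP/homotopic_mulA.
Qed.

Fact pi1_mul1 : left_id pi1_one pi1_mul.
Proof.
move=> a; rewrite -(loop_classK a) pi1_mulE.
exact/loop_classP/homotopic_mul1.
Qed.

Fact pi1_mulr1 : right_id pi1_one pi1_mul.
Proof.
move=> a; rewrite -(loop_classK a) pi1_mulE.
exact/loop_classP/homotopic_mulr1.
Qed.

Fact pi1_mulrV : right_inverse pi1_one pi1_inv pi1_mul.
Proof.
move=> a; rewrite -(loop_classK a) pi1_invE pi1_mulE.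
exact/loop_classP/homotopic_mulV.
Qed.

Fact pi1_invK : involutive pi1_inv.
Proof.
move=> a; rewrite -(loop_classK a) !pi1_invE; congr loop_class.
by apply/path_eqP => t; exact: (congr1 (@^~ t) (path_revK _)).
Qed.

Fact pi1_mulV : left_inverse pi1_one pi1_inv pi1_mul.
Proof. by move=> a; rewrite -{2}(pi1_invK a) pi1_mulrV. Qed.

HB.instance Definition _ := isGroup.Build pi1
  pi1_mulA pi1_mul1 pi1_mulr1 pi1_mulV pi1_mulrV.

End FundamentalGroup.

Section Cohomology.
Variables (G : groupType) (A : zmodType).

Definition cochain2 : Type := G * G -> A.
HB.instance Definition _ := GRing.Zmodule.on cochain2.

(** Inhomogeneous cochains; [G] acts trivially on [A]. *)
Definition coboundary1 (c : G -> A) : cochain2 :=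
  fun g => c g.2 - c (g.1 * g.2)%g + c g.1.

Definition is_cocycle2 (f : cochain2) : Prop := forall x y z : G,
  f (y, z) - f ((x * y)%g, z) + f (x, (y * z)%g) - f (x, y) = 0.

Definition cocycle2_pred (f : cochain2) : bool := `[< is_cocycle2 f >].

Fact cocycle2_closed : zmod_closed cocycle2_pred.
Proof.
split=> [|f g /asboolP cf /asboolP cg]; apply/asboolP => x y z.
  by rewrite -[0 : cochain2]/(fun=> 0) /= !subr0 addr0.
rewrite -[RHS](subrr 0) -{1}(cf x y z) -(cg x y z).
rewrite -[f - g]/(fun u => f u - g u) !opprD /=.
rewrite [RHS]addrACA; congr (_ + _); rewrite [RHS]addrACA; congr (_ + _).
by rewrite [RHS]addrACA.
Qed.
HB.instance Definition _ := GRing.isZmodClosed.Build cochain2 cocycle2_pred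
  cocycle2_closed.

Record cocycle2 : Type := Cocycle2 {
  cocycle2_val : cochain2; _ : cocycle2_pred cocycle2_val }.
HB.instance Definition _ := [isSub for cocycle2_val].
HB.instance Definition _ := [Choice of cocycle2 by <:].
HB.instance Definition _ := [SubChoice_isSubZmodule of cocycle2 by <:].

Lemma cocycle2P (f : cocycle2) : is_cocycle2 (val f).
Proof. exact/asboolP/(valP f). Qed.

Definition is_coboundary2 : {pred cocycle2} := fun f =>
  `[< exists c : G -> A, val f = coboundary1 c >].

Fact coboundary2_closed : zmod_closed is_coboundary2.
Proof.
split=> [|f g /asboolP[c fE] /asboolP[d gE]]; apply/asboolP.
  exists (fun=> 0); rewrite raddf0; apply/funext => u.
  by rewrite /coboundary1 subrr addr0.
exists (fun x => c x - d x); rewrite raddfB /= fE gE; apply/funext => u.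
rewrite -[LHS]/(coboundary1 c u - coboundary1 d u) /coboundary1 !opprD.
by rewrite addrACA; congr (_ + _); rewrite addrACA.
Qed.
HB.instance Definition _ := GRing.isZmodClosed.Build cocycle2 is_coboundary2
  coboundary2_closed.

Definition H2 : Type := Quotient.quot (is_coboundary2 : zmodClosed cocycle2).
HB.instance Definition _ := GRing.Zmodule.on H2.

Definition cohomology_class (f : cocycle2) : H2 := \pi_H2 f.

End Cohomology.

HB.instance Definition _ (G : groupType) (A : zmodType) :=
  EqQuotient.on (H2 G A).

Section CohomologyTheory.
Variables (G : groupType) (A : zmodType).
Implicit Types f g : cocycle2 G A.

Lemma cohomology_classP f g :
  cohomology_class f = cohomology_class g <->
  exists c : G -> A, val (f - g) = coboundary1 c.
Proof.
split=> [/eqmodP/asboolP[c e]|[c e]]; first by exists c; rewrite -e.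
by apply/eqmodP/asboolP; exists c; rewrite -e.
Qed.

Fact cohomology_class_additive : zmod_morphism (@cohomology_class G A).
Proof. by move=> f g; rewrite /cohomology_class !piE. Qed.
HB.instance Definition _ := GRing.isZmodMorphism.Build (cocycle2 G A) (H2 G A)
  (@cohomology_class G A) cohomology_class_additive.

Lemma cohomology_classK (a : H2 G A) : cohomology_class (repr a) = a.
Proof. exact: reprK. Qed.

End CohomologyTheory.

Section Inflation.
Variables (G Q : groupType) (A : zmodType) (p : {multiplicative G -> Q}).

Fact inflate_cocycle_subproof (f : cocycle2 Q A) :
  cocycle2_pred (fun g : G * G => val f (p g.1, p g.2)).
Proof. by apply/asboolP => x y z /=; rewrite !gmulfM; exact: cocycle2P. Qed.

Definition inflate_cocycle (f : cocycle2 Q A) : cocycle2 G A :=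
  Cocycle2 (inflate_cocycle_subproof f).

Definition inflation (a : H2 Q A) : H2 G A :=
  cohomology_class (inflate_cocycle (repr a)).

Lemma inflationE (f : cocycle2 Q A) :
  inflation (cohomology_class f) = cohomology_class (inflate_cocycle f).
Proof.
have /cohomology_classP[c cE] :=
  cohomology_classK (cohomology_class f).
apply/cohomology_classP; exists (c \o p); apply/funext => -[x y].
have := congr1 (@^~ (p x, p y)) cE.
by rewrite /coboundary1 /= gmulfM.
Qed.

Fact inflation_additive : zmod_morphism inflation.
Proof.
move=> a b; rewrite -(cohomology_classK a) -(cohomology_classK b) -raddfB.
rewrite !inflationE -raddfB; congr cohomology_class.
exact/val_inj/funext.
Qed.
HB.instance Definition _ := GRing.isZmodMorphism.Build (H2 Q A) (H2 G A)
  inflation inflation_additive.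

End Inflation.

(** The multiplicative group of a field as an abelian group: the sum of this
    [zmodType] is the product of the field. *)
Record mult_group (K : fieldType) : Type := MultGroup {
  mult_val :> K; mult_val_neq0 : mult_val != 0 }.

Section MultGroup.
Variable K : fieldType.
Local Notation M := (mult_group K).

HB.instance Definition _ := [isSub for @mult_val K].
HB.instance Definition _ := [Choice of M by <:].

Definition mult_one : M := MultGroup (oner_neq0 K).
Definition mult_mul (x y : M) : M :=
  MultGroup (mulf_neq0 (mult_val_neq0 x) (mult_val_neq0 y)).
Definition mult_inv (x : M) : M := MultGroup (invr_neq0 (mult_val_neq0 x)).

Fact mult_mulA : associative mult_mul.
Proof. by move=> x y z; apply: val_inj; rewrite /= mulrA. Qed.
Fact mult_mulC : commutative mult_mul.
Proof. by move=> x y; apply: val_inj; rewrite /= mulrC. Qed.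
Fact mult_mul1 : left_id mult_one mult_mul.
Proof. by move=> x; apply: val_inj; rewrite /= mul1r. Qed.
Fact mult_mulV : left_inverse mult_one mult_inv mult_mul.
Proof. by move=> x; apply: val_inj; rewrite /= mulVf ?mult_val_neq0. Qed.

HB.instance Definition _ := GRing.isZmodule.Build M
  mult_mulA mult_mulC mult_mul1 mult_mulV.

End MultGroup.

(** A finite subgroup of [GL_r(C)] is given by a finite group [gT] with a
    faithful representation [rG]; as usual in [mxrepresentation] the vectors are
    row vectors [x], with right action [x *m rG w]. *)
Section Reflection.
Variables (R : realType) (gT : finGroupType) (r : nat).
Variable rG : mx_representation R[i] [set: gT]%G r.
Local Notation V := 'rV[R[i]]_r.

Definition is_reflection (s : gT) : bool :=
  (\rank (rfix_mx rG [set s]%SET)).+1 == r.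

Definition complex_reflection_group : Prop :=
  mx_faithful rG /\ <<[set s | is_reflection s]%SET>>%g = [set: gT]%SET.

Definition two_reflection_group : Prop :=
  complex_reflection_group /\ forall s, is_reflection s -> #[s]%g = 2%N.

Definition fixed_hyperplane (s : gT) : set V :=
  [set x : V | x *m rG s = x].

Definition arrangement : set (set V) :=
  [set fixed_hyperplane s | s in [set s | is_reflection s]].

Definition complement : set V := ~` \bigcup_(H in arrangement) H.

Lemma complementP (x : V) :
  complement x <-> forall s, is_reflection s -> x *m rG s != x.
Proof.
split=> [cx s rs|cx [_ [s rs <-] xs]].
  by apply/eqP => xs; apply: cx; exists (fixed_hyperplane s) => //; exists s.
by have /eqP[] := cx s rs.
Qed.

Lemma is_reflectionJ s w : is_reflection (s ^ w)%g = is_reflection s.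
Proof.
rewrite /is_reflection -conjg_set1 rfix_mx_conjsg ?inE ?finset.subsetT //.
by rewrite mxrankMfree // row_free_unit repr_mx_unit ?inE.
Qed.

(** The inverse makes this a left action, so that with loops composed from left
    to right the projection from the braid group is a morphism and not an
    antimorphism. *)
Definition lact (w : gT) (x : V) : V := x *m rG w^-1%g.

Fact complement_lact w x : complement x -> complement (lact w x).
Proof.
move=> /complementP cx; apply/complementP => s rs; apply/eqP => e.
have /eqP[] := cx (s ^ w)%g (eq_trans (is_reflectionJ s w) rs).
rewrite conjgE !repr_mxM ?inE // !mulmxA.
rewrite -[x *m _]/(lact w x) e /lact -mulmxA -repr_mxM ?inE //.
by rewrite mulVg repr_mx1 mulmx1.
Qed.

Definition reg_space : Type := set_type complement.
HB.instance Definition _ := Topological.on reg_space.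

Definition reg_act (w : gT) (x : reg_space) : reg_space :=
  exist (fun y => y \in complement) (lact w (val x))
    (mem_set (@complement_lact w _ (set_valP x))).

Definition same_orbit (x y : reg_space) : bool :=
  [exists w : gT, y == reg_act w x].

Lemma reg_act1 x : reg_act 1%g x = x.
Proof. by apply: val_inj; rewrite /= /lact invg1 repr_mx1 mulmx1. Qed.

Lemma reg_actM v w x : reg_act (v * w)%g x = reg_act v (reg_act w x).
Proof.
by apply: val_inj; rewrite /= /lact invMg repr_mxM ?inE // mulmxA.
Qed.

Fact same_orbit_equiv : equiv_class_of same_orbit.
Proof.
have sym x y : same_orbit x y -> same_orbit y x.
  case/existsP=> w /eqP->; apply/existsP; exists w^-1%g.
  by rewrite -reg_actM mulVg reg_act1.
split=> [x|x y|y x z].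
- by apply/existsP; exists 1%g; rewrite reg_act1.
- by apply/idP/idP; exact: sym.
- case/existsP=> v /eqP-> /existsP[w /eqP->].
  by apply/existsP; exists (w * v)%g; rewrite reg_actM.
Qed.

Canonical same_orbit_equivRel := EquivRelPack same_orbit_equiv.

Definition orbit_space : Type := quotient_topology {eq_quot same_orbit}.
HB.instance Definition _ := Topological.on orbit_space.
HB.instance Definition _ := Quotient.on orbit_space.

Definition orbit_class (x : reg_space) : orbit_space := \pi_orbit_space x.

Variable x0 : reg_space.

Definition braid_group : Type := fundamental_group R (orbit_class x0).
HB.instance Definition _ := Group.on braid_group.

(** The right-hand side is functional in [b]: [W] acts freely on the complement
    (Steinberg) and paths lift along [orbit_class], so there is exactly one such
    function [p]. *)
Definition is_braid_projection (p : braid_group -> gT) : Prop :=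
  forall (b : braid_group) (w : gT),
    p b = w <->
    exists (g : {path (unit_interval R) from x0 to (reg_act w x0)})
           (l : {path (unit_interval R)
                 from (orbit_class x0) to (orbit_class x0)}),
      (forall t, l t = orbit_class (g t)) /\ loop_class l = b.

End Reflection.

(* Main.v *)
(** Write [M] for [C^*], additively. If the inflation of a normalised cocycle [F]
    of [W] is the coboundary of [c] on [B], then [c] restricts to a morphism
    [P -> M] invariant under conjugation by [B]. Extended to the paths of [X], it
    is a locally exact cochain on the complement of the arrangement, determined
    up to a coboundary by its monodromies [mu_H] around the hyperplanes, and
    [mu_H] only depends on the orbit of [H]. As [M] is divisible,
    [mu_H = |W| nu_H] for some [nu_H]. Averaged over [W], the cochains that count
    with weight [nu_H] the crossings of a cut along [H] give a cochain with the
    same monodromies that is strictly invariant under [W]. So [c] on [P] extends to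
    a function [S] of the paths of [X] that is additive, invariant under homotopy
    and invariant under [W]. If the path [g] lifts [b] in [B], then [c b - S g]
    only depends on the image of [b] in [W], and it splits [F].

    The projection from [B] to [W] exists because [W] acts freely on [X]
    (Steinberg). Let [e_j] be homogeneous polynomials forming a basis modulo the
    ideal generated by the invariants of positive degree. The zeros of
    [det (e_j (x w))] lie in the non-free locus, which outside the reflecting
    hyperplanes has codimension at least 2, so that there are none in [X]; and
    a determinant with two equal columns vanishes. *)

Require Import Defs.
From HB Require Import structures.
From mathcomp Require Import all_boot all_order all_algebra all_fingroup.
From mathcomp Require Import all_character.
From mathcomp Require Import all_classical all_reals all_analysis.
From mathcomp Require Import generic_quotient homotopy complex.
From mathcomp Require Import ring lra zify.

Set Implicit Arguments.
Unset Strict Implicit.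
Unset Printing Implicit Defensive.
Import Order.TTheory GRing.Theory Num.Theory.
Import numFieldTopology.Exports numFieldNormedType.Exports.

Local Open Scope ring_scope.
Local Open Scope quotient_scope.

(** * Invariants of reflection groups and Steinberg's theorem *)

(** By the Hochschild-Serre sequence the kernel of inflation is the image of the transgression of
    the characters of [P] invariant under [W], so injectivity means that each such character extends
    to [B]. Here the extension sends [b] to [S g], where [g] lifts [b]. The obstacle is that a
    character of [P] extends to the paths of [X] only after a choice of base paths, which the action
    of [W] does not respect: translating a path changes its value by a function of the end points.
    These functions must be written as [G (w x) - G x], up to constants. No generators of [P] and no
    homology of [X] are computed. A class is handled through its local primitives, and its monodromy
    by comparison with an explicit cut. Strata of codimension at least 2 are never examined, since
    segments from a fixed point can be chosen to avoid them. The division by [|W|] makes up for the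
    averaging: for every [w] exactly one of the translated cuts lies along a given hyperplane, so
    each weight is counted [|W|] times. *)

Section HomogeneousFunctions.
Variables (F : numFieldType) (r : nat).
Local Notation V := 'rV[F]_r.
Implicit Types (f g h : V -> F) (x y : V).

(** Homogeneous polynomials are represented by functions: [F] is infinite. *)
Fixpoint hpol (d : nat) f : Prop :=
  if d is e.+1 then
    exists g : 'I_r -> V -> F,
      (forall i, hpol e (g i)) /\ forall x, f x = \sum_i x 0 i * g i x
  else exists c, forall x, f x = c.

Lemma hpol_ext d f g : f =1 g -> hpol d f -> hpol d g.
Proof.
case: d => [|d] fg [c cE]; exists c; first by move=> x; rewrite -fg.
by case: cE => cd cE; split=> // x; rewrite -fg.
Qed.

Lemma hpol0 d : hpol d (fun=> 0).
Proof.
elim: d => [|d IH]; first by exists 0.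
by exists (fun=> fun=> 0); split=> // x; rewrite big1 // => i _; rewrite mulr0.
Qed.

Lemma hpolD d f g : hpol d f -> hpol d g -> hpol d (fun x => f x + g x).
Proof.
elim: d f g => [|d IH] f g /= [c cE] [e eE].
  by exists (c + e) => x; rewrite cE eE.
case: cE eE => cd cE [ed eE].
exists (fun i x => c i x + e i x); split=> [i|x]; first exact: IH.
by rewrite cE eE -big_split; apply: eq_bigr => i _; rewrite mulrDr.
Qed.

Lemma hpolM d e f g : hpol d f -> hpol e g -> hpol (d + e) (fun x => f x * g x).
Proof.
elim: d f => [|d IH] f /= [c cE] ge; last first.
  case: cE => cd cE; exists (fun i x => c i x * g x); split=> [i|x].
    exact: IH.
  by rewrite cE mulr_suml; apply: eq_bigr => i _; rewrite mulrA.
apply: (@hpol_ext _ (fun x => c * g x)) => [x|]; first by rewrite cE.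
elim: e g ge => [|e IH] g /= [h hE]; first by exists (c * h) => x; rewrite hE.
case: hE => hd hE; exists (fun i x => c * h i x); split=> [i|x]; first exact: IH.
by rewrite hE mulr_sumr; apply: eq_bigr => i _; rewrite mulrCA.
Qed.

Lemma hpolC c : hpol 0 (fun=> c). Proof. by exists c. Qed.

Lemma hpolZ d c f : hpol d f -> hpol d (fun x => c * f x).
Proof. exact: (hpolM (hpolC c)). Qed.

Lemma hpolN d f : hpol d f -> hpol d (fun x => - f x).
Proof.
by move/(hpolZ (-1)); apply: hpol_ext => x; rewrite mulN1r.
Qed.

Lemma hpol_sum I (s : seq I) (P : pred I) d (f : I -> V -> F) :
  (forall i, P i -> hpol d (f i)) -> hpol d (fun x => \sum_(i <- s | P i) f i x).
Proof.
move=> fd; elim: s => [|i s IH].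
  by apply: (hpol_ext _ (hpol0 d)) => x; rewrite big_nil.
case Pi: (P i); last by apply: (hpol_ext _ IH) => x; rewrite big_cons Pi.
by apply: (hpol_ext _ (hpolD (fd i Pi) IH)) => x; rewrite big_cons Pi.
Qed.

Lemma hpol_prod I (s : seq I) (d : I -> nat) (f : I -> V -> F) :
  (forall i, hpol (d i) (f i)) ->
  hpol (\sum_(i <- s) d i)%N (fun x => \prod_(i <- s) f i x).
Proof.
move=> fd; elim: s => [|i s IH].
  by rewrite big_nil; apply: (hpol_ext _ (hpolC 1)) => x; rewrite big_nil.
rewrite big_cons; apply: (hpol_ext _ (hpolM (fd i) IH)) => x.
by rewrite big_cons.
Qed.

Lemma hpol_form (a : 'cV[F]_r) : hpol 1 (fun x => (x *m a) 0 0).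
Proof. by exists (fun i => fun=> a i 0); split=> [i|x]; [exists (a i 0)|rewrite mxE]. Qed.

Lemma hpol_comp d f (A : 'M[F]_r) : hpol d f -> hpol d (fun x => f (x *m A)).
Proof.
elim: d f => [|d IH] f /= [c cE]; first by exists c.
case: cE => cd cE.
exists (fun k x => \sum_i A k i * c i (x *m A)); split=> [k|x].
  by apply: hpol_sum => i _; apply/hpolZ/IH.
rewrite cE (eq_bigr (fun i => \sum_k x 0 k * A k i * c i (x *m A))) => [|i _].
  by rewrite exchange_big; apply: eq_bigr => k _; rewrite mulr_sumr;
    apply: eq_bigr => i _; rewrite mulrA.
by rewrite mxE mulr_suml.
Qed.

(** The coefficient of degree [d] depends only on the direction [y] of the line. So [f y != 0] fixes
    the degree and the leading coefficient of [P] for every base point [x], which is what the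
    perturbation of roots needs. *)
Lemma hpol_line d f x y : hpol d f ->
  exists P : {poly F},
    [/\ (size P <= d.+1)%N, P`_d = f y & forall t, P.[t] = f (x + t *: y)].
Proof.
elim: d f => [|d IH] f /= [c cE].
  by exists c%:P; split=> [||t]; rewrite ?size_polyC ?coefC ?hornerC ?cE //; case: (c == 0).
case: cE => cd cE.
have {}IH i : exists P : {poly F},
    [/\ (size P <= d.+1)%N, P`_d = c i y & forall t, P.[t] = c i (x + t *: y)].
  exact: IH.
have [P PE] := choice IH.
exists (\sum_i ((x 0 i)%:P + (y 0 i)%:P * 'X) * P i); split.
- apply: (leq_trans (size_sum _ _ _)); apply/bigmax_leqP => i _.
  apply: (leq_trans (size_polyMleq _ _)); case: (PE i) => sP _ _.
  have: (size ((x 0 i)%:P + (y 0 i)%:P * 'X : {poly F})%R <= 2)%N.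
    apply: (leq_trans (size_polyD _ _)); rewrite geq_max.
    rewrite (leq_trans (size_polyC_leq1 _)) //.
    by rewrite (leq_trans (size_polyMleq _ _)) // size_polyX addn2 /= ltnS size_polyC_leq1.
  by move=> s2; have := leq_add s2 sP; lia.
- rewrite coef_sum cE; apply: eq_bigr => i _; case: (PE i) => sP <- _.
  rewrite mulrDl coefD coefCM nth_default // mulr0 add0r -mulrA coefCM.
  by rewrite coefXM.
- move=> t; rewrite horner_sum cE; apply: eq_bigr => i _; case: (PE i) => _ _ PEt.
  by rewrite hornerM PEt !mxE !hornerE [y 0 i * t]mulrC.
Qed.

Lemma poly_nonroot (P : {poly F}) : P != 0 -> exists t, P.[t] != 0.
Proof.
move=> P0; apply: contrapT => nt.
have rP t : root P t by apply/rootP/eqP/negbNE/negP => Pt; apply: nt; exists t.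
have := @max_poly_roots _ P [seq k%:R | k <- iota 0 (size P)] P0.
rewrite size_map size_iota ltnn => H; suff: false by []; apply: H.
  by apply/allP => t _; exact: rP.
by rewrite map_inj_in_uniq ?iota_uniq // => i j _ _ /eqP; rewrite eqr_nat => /eqP.
Qed.

(** Both functions restrict to nonzero polynomials on the line through [x] and [y], and polynomials
    form a domain. This is what allows a form to be cancelled in an identity between functions. *)
Lemma hpol_dom d e f g x y : hpol d f -> hpol e g -> f x != 0 -> g y != 0 ->
  exists z, f z != 0 /\ g z != 0.
Proof.
move=> /hpol_line-/(_ x (y - x))[P [_ _ PE]] /hpol_line-/(_ x (y - x))[Q [_ _ QE]] fx gy.
have PQ : P * Q != 0.
  rewrite mulf_neq0 //; apply/eqP => e0.
    by have := PE 0; rewrite scale0r addr0 e0 horner0 => /esym/eqP; apply/negP.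
  by have := QE 1; rewrite scale1r subrKC e0 horner0 => /esym/eqP; apply/negP.
have [t] := poly_nonroot PQ; rewrite hornerM mulf_eq0 PE QE => /norP[ft gt].
by exists (x + t *: (y - x)).
Qed.

Lemma hpol_avoid (I : eqType) (s : seq I) (d : I -> nat) (f : I -> V -> F) :
  (forall i, i \in s -> hpol (d i) (f i) /\ exists x, f i x != 0) ->
  exists z, forall i, i \in s -> f i z != 0.
Proof.
move=> fd; pose g x := \prod_(i <- s) f i x.
suff [z gz] : (exists z, g z != 0).
  by exists z => i si; move: gz; rewrite /g (big_rem i) //= mulf_eq0 => /norP[].
have [e [_ //]] : exists e, hpol e g /\ exists z, g z != 0.
rewrite /g; elim: s fd {g} => [|i s IH] fd.
  exists 0%N; split; first by exists 1 => x; rewrite big_nil.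
  by exists 0; rewrite big_nil oner_eq0.
have [|e [he [z gz]]] := IH; first by move=> j js; apply: fd; rewrite inE js orbT.
have [fi [x fx]] := fd i (mem_head _ _).
exists (d i + e)%N; split.
  by apply: (hpol_ext _ (hpolM fi he)) => y; rewrite big_cons.
have [y [fy gy]] := hpol_dom fi he fx gz.
by exists y; rewrite big_cons mulf_neq0.
Qed.

Lemma form_neq0 (a : 'cV[F]_r) : a != 0 -> exists x, (x *m a) 0 0 != 0 :> F.
Proof.
move=> a0; have [i ai] : exists i, a i 0 != 0.
  apply: contrapT => n; case/eqP: a0; apply/colP => i; rewrite [RHS]mxE.
  by apply/eqP/negbNE/negP => ai; apply: n; exists i.
by exists (delta_mx 0 i); rewrite -rowE mxE.
Qed.

Lemma forms_avoid (I : eqType) (s : seq I) (a : I -> 'cV[F]_r) :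
  (forall i, i \in s -> a i != 0) ->
  exists z : V, forall i, i \in s -> (z *m a i) 0 0 != 0.
Proof.
move=> a0; apply: (@hpol_avoid _ s (fun=> 1%N) (fun i z => (z *m a i) 0 0)) => i si.
by split; [exact: hpol_form | exact/form_neq0/a0].
Qed.

(** The divided difference of a homogeneous function along [x |-> x + (x a) v]. *)
Lemma hpol_diff d f (a : 'cV[F]_r) (v : 'rV[F]_r) : hpol d.+1 f ->
  exists2 h, hpol d h &
    forall x, f x - f (x *m (1%:M + a *m v)) = (x *m a) 0 0 * h x.
Proof.
set A := 1%:M + a *m v.
have xA x : x *m A = x + (x *m a) 0 0 *: v.
  by rewrite mulmxDr mulmx1 mulmxA {1}[x *m a]mx11_scalar mul_scalar_mx.
elim: d f => [|d IH] f [g [gd fE]].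
  exists (fun x => - \sum_i v 0 i * g i x).
    by apply/hpolN/hpol_sum => i _; apply: hpolZ.
  move=> x; rewrite !fE -sumrB -sumrN mulr_sumr; apply: eq_bigr => i _.
  by have [c cE] := gd i; rewrite !cE xA !mxE; ring.
have /choice[h hE] : forall i, exists h, hpol d h /\
    forall x, g i x - g i (x *m A) = (x *m a) 0 0 * h x.
  by move=> i; case: (IH _ (gd i)) => h; exists h.
exists (fun x => \sum_i x 0 i * h i x - \sum_i v 0 i * g i (x *m A)).
  apply: hpolD.
    by exists h; split=> // i; case: (hE i).
  by apply/hpolN/hpol_sum => i _; apply/hpolZ/hpol_comp.
move=> x; rewrite mulrBr !fE !mulr_sumr -!sumrB; apply: eq_bigr => i _.
have [_ /(_ x) E] := hE i; move: E; rewrite -/A => /eqP; rewrite subr_eq => /eqP ->.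
by rewrite xA !mxE; ring.
Qed.
End HomogeneousFunctions.

Lemma rank1_mul (F : fieldType) (m n : nat) (A : 'M[F]_(m, n)) : \rank A = 1%N ->
  exists (a : 'cV_m) (v : 'rV_n), A = a *m v /\ a != 0.
Proof.
move=> rA; have := mulmx_base A; move: (col_base A) (row_base A).
rewrite rA => a v avA; exists a, v; split=> //; apply/eqP => a0.
by move: rA; rewrite -avA a0 mul0mx mxrank0.
Qed.

(** * The ideal of the invariants of positive degree, and Chevalley's lemma *)

Section Invariants.
Variables (F : numFieldType) (r : nat) (gT : finGroupType).
Variable rG : mx_representation F [set: gT]%G r.
Local Notation V := 'rV[F]_r.
Implicit Types (f g h : V -> F) (x y : V) (w : gT).

Definition invariant f : Prop := forall w x, f (x *m rG w) = f x.

Definition average f : V -> F :=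
  fun x => #|gT|%:R^-1 * \sum_(w : gT) f (x *m rG w).

Lemma mulmx_rG x v w : x *m rG v *m rG w = x *m rG (v * w)%g.
Proof. by rewrite -mulmxA -repr_mxM ?inE. Qed.

Lemma card_neq0 : #|gT|%:R != 0 :> F.
Proof. by rewrite pnatr_eq0 -lt0n; apply/card_gt0P; exists 1%g. Qed.

Lemma average_invariant f : invariant (average f).
Proof.
move=> v x; rewrite /average; congr (_ * _).
rewrite [RHS](reindex_inj (mulgI v)).
by apply: eq_bigr => w _; rewrite mulmx_rG.
Qed.

Lemma hpol_average d f : hpol d f -> hpol d (average f).
Proof. by move=> fd; apply/hpolZ/hpol_sum => w _; apply: hpol_comp. Qed.

(** The degree [d] part of the ideal generated by the invariants of positive
    degree. *)
Inductive hilb : nat -> (V -> F) -> Prop :=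
| Hilb0 d f : f =1 (fun=> 0) -> hilb d f
| HilbD d i j f a h g : (i + j.+1 = d)%N -> hpol i a -> hpol j.+1 h ->
    invariant h -> hilb d f -> g =1 (fun x => f x + a x * h x) -> hilb d g.

Lemma hilb_ext d f g : f =1 g -> hilb d f -> hilb d g.
Proof.
move=> fg fd; case: fd fg => [e k k0|e i j k a h l ei ai hj ih ke lE] fg.
  by apply: Hilb0 => x; rewrite -fg.
by apply: HilbD ei ai hj ih ke _ => x; rewrite -fg.
Qed.

Lemma hilbD d f g : hilb d f -> hilb d g -> hilb d (fun x => f x + g x).
Proof.
elim=> {d f} [d f f0|d i j f a h k di ai hj ih fd IH kE] gd.
  by apply: (hilb_ext _ gd) => x; rewrite f0 add0r.
by apply: HilbD di ai hj ih (IH gd) _ => x; rewrite kE addrAC.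
Qed.

Lemma hilbM d e a f : hpol d a -> hilb e f -> hilb (d + e) (fun x => a x * f x).
Proof.
move=> ad fe; elim: fe ad => {e f} [e f f0|e i j f b h k ei bi hj ih fe IH kE] ad.
  by apply: Hilb0 => x; rewrite f0 mulr0.
apply: (@HilbD _ (d + i)%N j _ (fun x => a x * b x) h _ _ _ hj ih (IH ad)).
- by rewrite -addnA ei.
- exact: hpolM.
- by move=> x; rewrite kE mulrDr mulrA.
Qed.

Lemma hilbZ d c f : hilb d f -> hilb d (fun x => c * f x).
Proof. exact: (hilbM (hpolC r c)). Qed.

Lemma hilb_sum I (s : seq I) (P : pred I) d (f : I -> V -> F) :
  (forall i, P i -> hilb d (f i)) -> hilb d (fun x => \sum_(i <- s | P i) f i x).
Proof.
move=> fd; elim: s => [|i s IH].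
  by apply: Hilb0 => x; rewrite big_nil.
case Pi: (P i); last by apply: (hilb_ext _ IH) => x; rewrite big_cons Pi.
by apply: (hilb_ext _ (hilbD (fd i Pi) IH)) => x; rewrite big_cons Pi.
Qed.

Lemma hilb_comp d f w : hilb d f -> hilb d (fun x => f (x *m rG w)).
Proof.
elim=> {d f} [d f f0|d i j f a h k di ai hj ih fd IH kE].
  by apply: Hilb0 => x; rewrite f0.
by apply: HilbD di (hpol_comp _ ai) hj (ih) IH _ => x /=; rewrite kE ih.
Qed.

Lemma hilb_invariant d h : hpol d.+1 h -> invariant h -> hilb d.+1 h.
Proof.
move=> hd ih; apply: (@HilbD _ 0 d (fun=> 0) (fun=> 1) h) => //.
- exact: hpolC.
- exact: Hilb0.
- by move=> x; rewrite add0r mul1r.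
Qed.

(** A zero function has every degree, hence the alternatives. *)
Definition in_ideal n (f : 'I_n.+1 -> V -> F) (b : 'I_n.+1 -> nat) : Prop :=
  exists (g : 'I_n -> V -> F) (c : 'I_n -> nat),
    [/\ forall i, invariant (g i) /\ hpol (c i) (g i),
        forall i, [\/ f (lift ord0 i) =1 (fun=> 0), g i =1 (fun=> 0) |
                      (c i + b (lift ord0 i) = b ord0)%N] &
        forall x, f ord0 x = \sum_i g i x * f (lift ord0 i) x].

Hypothesis gen : <<[set s | \rank (rG s - 1%:M) == 1%N]%SET>>%g = [set: gT]%SET.

(** The ideal is stable under translation and [f - f (uv)] is [f - f u] plus the translate by [u] of
    [f - f v], so the [w] with the property form a group. *)
Lemma hilb_generation d f :
  (forall s, \rank (rG s - 1%:M) = 1%N -> hilb d (fun x => f x - f (x *m rG s))) ->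
  forall w, hilb d (fun x => f x - f (x *m rG w)).
Proof.
move=> fs w; pose H := [set w | `[< hilb d (fun x => f x - f (x *m rG w)) >]]%SET.
suff: w \in H by rewrite finset.in_set => /asboolP.
have gH : group_set H.
  apply/andP; split.
    rewrite finset.in_set; apply/asboolP/Hilb0 => x.
    by rewrite repr_mx1 mulmx1 subrr.
  apply/fintype.subsetP => _ /mulsgP[u v uH vH ->]; move: uH vH; rewrite !finset.in_set.
  move=> /asboolP uH /asboolP vH; apply/asboolP.
  apply: (hilb_ext _ (hilbD uH (hilb_comp u vH))) => x /=.
  by rewrite mulmx_rG addrA subrK.
have: w \in [set: gT]%SET by rewrite inE.
rewrite -gen; apply: fintype.subsetP; rewrite -[H]/(Group gH : {set _}) gen_subG.
by apply/fintype.subsetP => s; rewrite !finset.in_set => /eqP/fs sH; apply/asboolP.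
Qed.

(** Chevalley's lemma: the induction on the degree of [p_0] uses that the form of
    a reflection [w] divides [p_0 - p_0 w]. *)
Lemma hilb_relation n (f : 'I_n.+1 -> V -> F) (b : 'I_n.+1 -> nat)
    (p : 'I_n.+1 -> V -> F) (e : 'I_n.+1 -> nat) D :
  (forall i, hpol (b i) (f i)) -> (forall i, invariant (f i)) ->
  (forall i, hpol (e i) (p i)) ->
  (forall i, [\/ f i =1 (fun=> 0), p i =1 (fun=> 0) | (e i + b i = D)%N]) ->
  (forall x, \sum_i p i x * f i x = 0) ->
  hilb (e ord0) (p ord0) \/ in_ideal f b.
Proof.
move=> fb fi; have [|nI] := pselect (in_ideal f b); first by right.
move=> pe ed rel; left; move ek: (e ord0) => k.
elim: k p e D ek pe ed rel => [|k IH] p e D ek pe ed rel.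
  (* In degree 0, [p ord0] is a constant. If it is nonzero, averaging the relation over [W] and
     dividing by it puts [f ord0] in the ideal of the others. *)
  have [c pc] : exists c, forall x, p ord0 x = c by have := pe ord0; rewrite ek.
  have [c0|c0] := eqVneq c 0; first by apply: Hilb0 => x; rewrite pc c0.
  case: nI; case: (ed ord0) => [f0|p0|eD].
  - exists (fun=> fun=> 0), (fun=> 0%N); split=> [i|i|x].
    + by split=> //; apply: hpol0.
    + by apply: Or32.
    + by rewrite f0 big1 // => i _; rewrite mul0r.
  - by move: c0; rewrite -(pc 0) p0 eqxx.
  exists (fun i => average (fun x => - c^-1 * p (lift ord0 i) x)),
    (fun i => e (lift ord0 i)); split=> [i|i|x].
  - by split; [exact: average_invariant | apply/hpol_average/hpolZ].
  - case: (ed (lift ord0 i)) => [||]; [exact: Or31|move=> pi0; apply: Or32|].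
      by move=> x; rewrite /average big1 ?mulr0 // => w _; rewrite pi0 mulr0.
    by move=> ei; apply: Or33; rewrite ei -eD ek add0n.
  have: \sum_(w : gT) \sum_i p i (x *m rG w) * f i x = 0.
    rewrite big1 // => w _; apply: etrans (rel (x *m rG w)).
    by apply: eq_bigr => i _; rewrite (fi i).
  rewrite exchange_big big_ord_recl /= -mulr_suml.
  have -> : \sum_(w : gT) p ord0 (x *m rG w) = #|gT|%:R * c.
    by rewrite (eq_bigr (fun=> c)) ?sumr_const ?mulr_natl // => w _; rewrite pc.
  move=> /eqP; rewrite addrC addr_eq0 => /eqP E.
  apply: (@mulfI _ (#|gT|%:R * c)); first by rewrite mulf_neq0 ?card_neq0.
  rewrite -[LHS]opprK -E mulr_sumr -sumrN; apply: eq_bigr => i _.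
  rewrite /average -mulr_suml -mulr_sumr; set S := \sum_i _.
  by field; rewrite c0 card_neq0.
have hs : forall s, \rank (rG s - 1%:M) = 1%N ->
    hilb k.+1 (fun x => p ord0 x - p ord0 (x *m rG s)).
  move=> s /rank1_mul[a [v [av a0]]].
  have sE : rG s = 1%:M + a *m v by rewrite -av addrC subrK.
  (* The divided differences satisfy the same relation one degree lower. In degree 0 they vanish, so
     the truncated predecessor does no harm. *)
  have /choice[h hE] : forall i, exists h, [/\ hpol (e i).-1 h,
      e i = 0%N -> h =1 (fun=> 0) &
      forall x, p i x - p i (x *m rG s) = (x *m a) 0 0 * h x].
    move=> i; have := pe i; case: (e i) => [[c pc]|d /hpol_diff-/(_ a v)[h hd hE]].
      exists (fun=> 0); split=> //; first exact: hpol0.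
      by move=> x; rewrite !pc subrr mulr0.
    by exists h; split=> // x; rewrite sE.
  (* The relation holds after multiplication by the form [a], which [hpol_dom] cancels. *)
  have rel' x : \sum_i h i x * f i x = 0.
    have [x0 ax0] := form_neq0 a0.
    apply/eqP/negbNE/negP => sx.
    have hd : hpol D.-1 (fun x => \sum_i h i x * f i x).
      apply: hpol_sum => i _; case: (hE i) => hi h0 hx; case: (ed i) => [f0|p0|eD].
      - by apply: (hpol_ext _ (hpol0 _ _ _)) => y; rewrite f0 mulr0.
      - apply: (hpol_ext _ (hpol0 _ _ _)) => y; have [->|hy] := eqVneq (h i y) 0.
          by rewrite mul0r.
        have [z [/= az hz]] := hpol_dom (hpol_form a) hi ax0 hy.
        have := hx z; rewrite !p0 subrr => /esym/eqP.
        by rewrite mulf_eq0 (negPf az) (negPf hz).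
      - case: (e i) hi h0 eD => [_ h0 _|d hi _ <-].
          by apply: (hpol_ext _ (hpol0 _ _ _)) => y; rewrite h0 // mul0r.
        exact: hpolM hi (fb i).
    have [z [/= az /negP]] := hpol_dom (hpol_form a) hd ax0 sx; apply.
    rewrite -(inj_eq (mulfI az)) mulr0 mulr_sumr; apply/eqP.
    apply: (@etrans _ _ (\sum_i p i z * f i z -
                         \sum_i p i (z *m rG s) * f i (z *m rG s))).
      rewrite -sumrB; apply: eq_bigr => i _.
      by case: (hE i) => _ _ hz; rewrite mulrA -hz fi mulrBl.
    by rewrite !rel subrr.
  have hk : hilb k (h ord0).
    apply: (IH h (fun i => (e i).-1) D.-1) => //.
    - by rewrite ek.
    - by move=> i; case: (hE i).
    move=> i; case: (hE i) => hi h0 hx.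
    have [e0|ei] := eqVneq (e i) 0%N; first by apply/Or32/h0.
    case: (ed i) => [f0|p0|eD]; [exact: Or31| |by apply: Or33; lia].
    apply: Or32 => y; apply/eqP/negbNE/negP => hy.
    have [x0 ax0] := form_neq0 a0.
    have [z [/= az hz]] := hpol_dom (hpol_form a) hi ax0 hy.
    have := hx z; rewrite !p0 subrr => /esym/eqP.
    by rewrite mulf_eq0 (negPf az) (negPf hz).
  have := hilbM (hpol_form a) hk; rewrite add1n; apply: hilb_ext => x.
  by case: (hE ord0) => _ _ ->.
have hw := hilb_generation hs.
have pk : hpol k.+1 (p ord0) by rewrite -ek.
(* [p ord0] is its average, an invariant of positive degree, plus the mean of the differences
   [p ord0 - p ord0 w]. *)
have := hilbD (hilb_invariant (hpol_average pk) (@average_invariant _))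
  (hilbZ #|gT|%:R^-1 (hilb_sum (index_enum gT) (P := predT) (fun w _ => hw w))).
apply: hilb_ext => x /=; rewrite /average -mulrDr -big_split /=.
rewrite (eq_bigr (fun=> p ord0 x)) => [|w _]; last by rewrite subrKC.
by rewrite sumr_const -[X in _ * X]mulr_natl mulKf // card_neq0.
Qed.

End Invariants.

(** * Generators over the invariants, and the matrix of an orbit *)

Section Independence.
Variables (F : numFieldType) (r : nat) (gT : finGroupType).
Variable rG : mx_representation F [set: gT]%G r.
Local Notation V := 'rV[F]_r.
Implicit Types (f g h : V -> F) (x y : V) (w : gT).
Hypothesis gen : <<[set s | \rank (rG s - 1%:M) == 1%N]%SET>>%g = [set: gT]%SET.
Hypothesis faith : mx_faithful rG.
Local Notation hilb := (hilb rG).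
Local Notation invariant := (invariant rG).
Local Notation average := (average rG).

(** Linear independence modulo the ideal. As [hilb] is graded, it is tested on combinations of a
    single degree [k]. *)
Definition hilb_free n (e : 'I_n -> V -> F) (d : 'I_n -> nat) : Prop :=
  forall k (c : 'I_n -> F), (forall i, d i <> k -> c i = 0) ->
    hilb k (fun x => \sum_i c i * e i x) -> forall i, c i = 0.

(** Chevalley's lemma applies with the [e i] as coefficients: [e ord0] is not in the ideal, so
    [q ord0] is a combination of the other [q i] with invariant coefficients [g i]. Substituting it
    leaves a shorter relation between the [e i + g i e ord0], which are again independent modulo the
    ideal. *)
Lemma hilb_free_independent n (e : 'I_n -> V -> F) (d : 'I_n -> nat)
    (q : 'I_n -> V -> F) (b : 'I_n -> nat) D :
  (forall i, hpol (d i) (e i)) -> hilb_free e d ->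
  (forall i, invariant (q i) /\ hpol (b i) (q i)) ->
  (forall i, q i =1 (fun=> 0) \/ (d i + b i = D)%N) ->
  (forall x, \sum_i e i x * q i x = 0) ->
  forall i, q i =1 (fun=> 0).
Proof.
elim: n e d q b => [|n IH] e d q b ed free iq qb rel i; first by case: i.
have [e0|[g [c [gc cb qg]]]] :
    hilb (d ord0) (e ord0) \/ in_ideal rG q b.
- apply: (@hilb_relation _ _ _ _ gen _ q b e d D) => // j; try by case: (iq j).
  by case: (qb j); [exact: Or31 | exact: Or33].
- suff /eqP : ((ord0 == ord0 :> 'I_n.+1)%:R : F) = 0 by rewrite oner_eq0.
  apply: (free (d ord0) (fun i => (i == ord0)%:R)) => [j|].
    by case: eqP => // ->.
  apply: (hilb_ext _ e0) => x; rewrite (bigD1 ord0) //= mul1r big1 ?addr0 //.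
  by move=> j /negPf ->; rewrite mul0r.
have {g c gc cb qg} [g [c [gc cb qg]]] : exists (g : 'I_n -> V -> F) (c : 'I_n -> nat),
    [/\ forall i, invariant (g i) /\ hpol (c i) (g i),
        forall i, g i =1 (fun=> 0) \/ (c i + d ord0 = d (lift ord0 i))%N &
        forall x, q ord0 x = \sum_i g i x * q (lift ord0 i) x].
  have [q0|q0] := pselect (q ord0 =1 (fun=> 0)).
    exists (fun=> fun=> 0), (fun=> 0%N); split=> [j|j|x]; last 1 first.
    - by rewrite q0 big1 // => j _; rewrite mul0r.
    - by split=> //; apply: hpol0.
    - by left.
  (* Where the degrees do not match, the product of [g i] with [q (lift ord0 i)] is zero, so [g i]
     may be replaced by 0. *)
  have [k [kg kq]] : exists k : 'I_n -> V -> F,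
      (forall i, k i = g i /\ (c i + d ord0 = d (lift ord0 i))%N \/ k i = (fun=> 0)) /\
      forall i x, k i x * q (lift ord0 i) x = g i x * q (lift ord0 i) x.
    exists (fun i => if (c i + d ord0 == d (lift ord0 i))%N then g i else fun=> 0).
    split=> [j|j x]; first by case: eqP; [left | right].
    case: eqP => // neq; case: (cb j) => [->|->|E]; rewrite ?mulr0 ?mul0r //.
    case: (qb (lift ord0 j)) => [->|E']; rewrite ?mulr0 ?mul0r //.
    by case: (qb ord0) => // E''; case: neq; lia.
  exists k, c; split=> [j|j|x].
  - by case: (kg j) => [[-> _]|->] //; split=> //; exact: hpol0.
  - by case: (kg j) => [[_ ->]|->]; [right|left].
  - by rewrite qg; apply: eq_bigr => j _; rewrite kq.
(* Modulo the ideal the term [g i * e ord0] is [u i * e ord0], where [u i] is the value of [g i] in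
   degree 0, and 0 in positive degree. *)
have /choice[u uE] : forall i, exists u, (u != 0 -> d ord0 = d (lift ord0 i)) /\
    hilb (d (lift ord0 i)) (fun x => (g i x - u) * e ord0 x).
  move=> j; case: (gc j) => ig; case: (cb j) => [g0 _|<-].
    by exists 0; rewrite eqxx; split=> //; apply: Hilb0 => x; rewrite g0 subrr mul0r.
  case: (c j) => [[u gu]|k gk].
    by exists u; split=> //; apply: Hilb0 => x; rewrite gu subrr mul0r.
  exists 0; rewrite eqxx; split=> //; rewrite addnC.
  apply: hilb_ext (hilbM (ed ord0) (hilb_invariant gk ig)) => x.
  by rewrite subr0 mulrC.
pose e' j x := e (lift ord0 j) x + g j x * e ord0 x.
have q0 : forall j, q (lift ord0 j) =1 (fun=> 0).
  apply: (IH e' (fun j => d (lift ord0 j)) _ (fun j => b (lift ord0 j))) => //.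
  - move=> j; apply: hpolD => //; case: (gc j) => _ gj; case: (cb j) => [g0|<-].
      by apply: (hpol_ext _ (hpol0 _ _ _)) => x; rewrite g0 mul0r.
    exact: hpolM.
  - move=> k l lk lh.
    (* The coefficients, on the original family and modulo the ideal, of the combination of the
       [e' j]. *)
    pose l' i := if unlift ord0 i is Some j then l j else \sum_j l j * u j.
    suff l'0 : forall i, l' i = 0.
      by move=> j; have := l'0 (lift ord0 j); rewrite /l' liftK.
    apply: (free k) => [j|].
      rewrite /l'; case: unliftP => [j' -> /lk //|-> dk].
      rewrite big1 // => j' _; have [-> |u0] := eqVneq (u j') 0; first by rewrite mulr0.
      by case: (uE j') => /(_ u0) dE _; rewrite lk ?mul0r // -dE.
    have uh : hilb k (fun x => \sum_j l j * ((g j x - u j) * e ord0 x)).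
      apply: hilb_sum => j _; have [dk|/eqP dk] := eqVneq (d (lift ord0 j)) k.
        by apply: hilbZ; case: (uE j); rewrite dk.
      by apply: Hilb0 => x; rewrite lk // mul0r.
    apply: (hilb_ext _ (hilbD lh (hilbZ (-1) uh))) => x.
    rewrite big_ord_recl /l' unlift_none mulr_suml mulN1r -sumrN -!big_split /=.
    by apply: eq_bigr => j _; rewrite liftK /e'; ring.
  - move=> x; rewrite -[RHS](rel x) big_ord_recl qg mulr_sumr -big_split.
    by apply: eq_bigr => j _; rewrite /e' /=; ring.
have [j ->|->] := unliftP ord0 i => x; first exact: q0.
by rewrite qg big1 // => j _; rewrite q0 mulr0.
Qed.

Definition free_orbit y : Prop := forall w, w != 1%g -> y *m rG w != y.

(** By faithfulness [rG w - 1] has a nonzero column for [w != 1], and this column is a form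
    vanishing on the fixed points of [w]. So the points with a stabiliser lie on finitely many
    hyperplanes. *)
Lemma free_orbit_avoid d f y : hpol d f -> f y != 0 ->
  exists2 z, f z != 0 & free_orbit z.
Proof.
move=> fd fy.
have /choice[a aE] : forall w, exists a : 'cV[F]_r, w != 1%g ->
    a != 0 /\ forall x, (x *m a) 0 0 != 0 -> x *m rG w != x.
  move=> w; have [w1|w1] := eqVneq w 1%g; first by exists 0.
  have [j aj] : exists j, col j (rG w - 1%:M) != 0.
    apply: contrapT => n; suff: w \in rker rG.
      by move/(fintype.subsetP faith); rewrite inE (negPf w1).
    apply/rkerP; rewrite inE; split=> //; apply/eqP; rewrite -subr_eq0.
    apply/eqP/matrixP => i j; have /negP/negbNE/eqP/colP/(_ i) : ~ col j (rG w - 1%:M) != 0.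
      by move=> c; apply: n; exists j.
    by rewrite !mxE.
  exists (col j (rG w - 1%:M)) => _; split=> // x; apply: contraNneq => xw.
  by rewrite colE mulmxA mulmxBr mulmx1 xw subrr mul0mx mxE.
pose I := option gT.
pose s : seq I := None :: [seq Some w | w <- enum gT & w != 1%g].
have [|z zE] := @hpol_avoid F r I s (fun i => if i is Some _ then 1%N else d)
  (fun i x => if i is Some w then (x *m a w) 0 0 else f x).
  case=> [w|_]; last by split=> //; exists y.
  rewrite inE /= mem_map => [|u v [] //]; rewrite mem_filter => /andP[w1 _].
  by split; [exact: hpol_form | apply: form_neq0; case: (aE w w1)].
exists z; first exact: (zE None (mem_head _ _)).
move=> w w1; case: (aE w w1) => _; apply; apply: (zE (Some w)).
by rewrite in_cons map_f // mem_filter w1 mem_enum.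
Qed.

Inductive pol : (V -> F) -> Prop :=
| PolH d f : hpol d f -> pol f
| PolD f g h : pol f -> pol g -> h =1 (fun x => f x + g x) -> pol h.

Lemma pol_ext f g : f =1 g -> pol f -> pol g.
Proof.
move=> fg pf; apply: (PolD pf (PolH (hpol0 F r 0))) => x.
by rewrite -fg addr0.
Qed.

Lemma polM f g : pol f -> pol g -> pol (fun x => f x * g x).
Proof.
elim=> {f} [d f fd|f1 f2 f _ IH1 _ IH2 fE] pg; last first.
  by apply: (PolD (IH1 pg) (IH2 pg)) => x; rewrite fE mulrDl.
elim: pg => {g} [e g ge|g1 g2 g _ IH1 _ IH2 gE].
  exact: (PolH (hpolM fd ge)).
by apply: (PolD IH1 IH2) => x; rewrite gE mulrDr.
Qed.

Lemma pol_prod (I : Type) (s : seq I) (P : pred I) (f : I -> V -> F) :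
  (forall i, P i -> pol (f i)) -> pol (fun x => \prod_(i <- s | P i) f i x).
Proof.
move=> fp; elim: s => [|i s IH].
  by apply: (pol_ext _ (PolH (hpolC r 1))) => x; rewrite big_nil.
case Pi: (P i); last by apply: (pol_ext _ IH) => x; rewrite big_cons Pi.
by apply: (pol_ext _ (polM (fp i Pi) IH)) => x; rewrite big_cons Pi.
Qed.

(** A product over [v != 1] of affine functions equal to 1 at [y] and to 0 at [y v]. *)
Lemma pol_interpolate y : free_orbit y ->
  exists2 f, pol f & forall w, f (y *m rG w) = (w == 1%g)%:R.
Proof.
move=> fy; have /choice[f fE] : forall v, exists f, v != 1%g ->
    [/\ pol f, f y = 1 & f (y *m rG v) = 0].
  move=> v; have [v1|v1] := eqVneq v 1%g; first by exists (fun=> 0).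
  have [a ay] : exists a : 'cV[F]_r, (y *m a) 0 0 != (y *m rG v *m a) 0 0 :> F.
    apply: contrapT => n; have /eqP[] := fy v v1; apply/rowP => j.
    apply/eqP/negbNE/negP => c; apply: n; exists (delta_mx j 0).
    by move: c; rewrite eq_sym -!colE !mxE.
  set c := (y *m rG v *m a) 0 0.
  have c0 : (y *m a) 0 0 - c != 0 by rewrite subr_eq0.
  exists (fun x => ((x *m a) 0 0 - c) * ((y *m a) 0 0 - c)^-1) => _; split.
  - apply: polM; last exact: (PolH (hpolC r _)).
    exact: (PolD (PolH (hpol_form a)) (PolH (hpolC r (- c))) (frefl _)).
  - by rewrite divff.
  - by rewrite subrr mul0r.
exists (fun x => \prod_(v | v != 1%g) f v x).
  by apply: pol_prod => v v1; case: (fE v v1).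
move=> w; have [->|w1] := eqVneq w 1%g.
  by rewrite repr_mx1 mulmx1 big1 // => v v1; case: (fE v v1).
by rewrite (bigD1 w) //=; case: (fE w w1) => _ _ ->; rewrite mul0r.
Qed.

Definition minor m (e : 'I_m -> V -> F) k (u : 'I_k -> gT) (s : 'I_k -> 'I_m) x :=
  \det (\matrix_(i, j) e (s j) (x *m rG (u i))).

Lemma hpol_minor m (e : 'I_m -> V -> F) (d : 'I_m -> nat) k u s :
  (forall i, hpol (d i) (e i)) ->
  hpol (\sum_(j < k) d (s j))%N (minor e u s).
Proof.
move=> ed; apply: hpol_sum => t _; apply: hpolZ.
have : hpol (\sum_(i < k) d (s (t i)))%N
    (fun x => \prod_i e (s (t i)) (x *m rG (u i))).
  by apply: hpol_prod => i; apply: hpol_comp.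
rewrite -(reindex_inj (@perm_inj _ t) (P := predT) (F := fun j => d (s j))) /=.
by apply: hpol_ext => x; apply: eq_bigr => i _; rewrite mxE.
Qed.

Lemma minor_inj m (e : 'I_m -> V -> F) k (u : 'I_k -> gT) (s : 'I_k -> 'I_m) x :
  minor e u s x != 0 -> injective u /\ injective s.
Proof.
move=> D0; split=> i j ij; apply/eqP/negbNE/negP => nij; case/eqP: D0.
  by apply: (determinant_alternate nij) => l; rewrite !mxE ij.
rewrite /minor -det_tr; apply: (determinant_alternate nij) => l.
by rewrite !mxE ij.
Qed.

Definition extend k T (s : 'I_k -> T) (t : T) (i : 'I_k.+1) : T :=
  if unlift ord_max i is Some j then s j else t.

Lemma extend_lift k T (s : 'I_k -> T) t i : extend s t (lift ord_max i) = s i.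
Proof. by rewrite /extend liftK. Qed.

Lemma extend_max k T (s : 'I_k -> T) t : extend s t ord_max = t.
Proof. by rewrite /extend unlift_none. Qed.

(** More than [#|gT|] homogeneous functions are dependent over the invariants:
    the cofactors of a maximal minor of [(e_j (x w))] give a relation whose
    coefficients are then made invariant by averaging. *)
Lemma invariant_dependent m (e : 'I_m -> V -> F) (d : 'I_m -> nat) :
  (#|gT| < m)%N -> (forall i, hpol (d i) (e i)) ->
  exists (q : 'I_m -> V -> F) (b : 'I_m -> nat) (D : nat),
    [/\ forall i, invariant (q i) /\ hpol (b i) (q i),
        forall i, q i =1 (fun=> 0) \/ (d i + b i = D)%N,
        forall x, \sum_i e i x * q i x = 0 & exists i x, q i x != 0].
Proof.
move=> gm ed.
(* The largest such [k] is the generic rank of the matrix of all [e_j (x w)]. A nonzero minor has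
   distinct rows, whence the bound by [#|gT|]. *)
pose Q k := `[< exists (u : 'I_k -> gT) s x, minor e u s x != 0 >].
have Qbd k : Q k -> (k <= #|gT|)%N.
  by move=> /asboolP[u [s [x /minor_inj[/leq_card + _]]]]; rewrite card_ord.
have Q0 : exists k, Q k.
  exists 0%N; apply/asboolP; exists (fun=> 1%g).
  have m0 : (0 < m)%N by apply: leq_trans gm.
  by exists (fun=> Ordinal m0), 0; rewrite /minor det_mx00 oner_eq0.
case: (ex_maxnP Q0 Qbd) => k /[dup] /Qbd kg /asboolP[u [s [y uy]]] kmax.
have [_ sinj] := minor_inj uy.
have [j0 j0s] : exists j0, j0 \notin codom s.
  apply: contrapT => n; have: (m <= k)%N; last by move: (leq_ltn_trans kg gm); lia.
  rewrite -[m]card_ord -[k]card_ord -(card_codom sinj) subset_leq_card //.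
  by apply/fintype.subsetP => j _; apply/negbNE/negP => js; apply: n; exists j.
pose s' := extend s j0.
have s'inj : injective s'.
  move=> i j; rewrite /s' /extend.
  have [i' ->|->] := unliftP ord_max i; have [j' ->|->] := unliftP ord_max j => //.
  - by move/sinj ->.
  - by move=> E; case/negP: j0s; rewrite -E codom_f.
  - by move=> E; case/negP: j0s; rewrite E codom_f.
(* Cofactors along the last row of a minor of size [k + 1]. They do not involve that row, which can
   thus be taken at any [w]. *)
pose K (j : 'I_k.+1) x : F := (-1) ^+ (k + j) * minor e u (s' \o lift j) x.
pose D := (\sum_j d (s' j))%N.
have dK j : (d (s' j) + \sum_(i < k) d (s' (lift j i)) = D)%N.
  by rewrite /D (bigD1_ord j).
have Kd j : hpol (D - d (s' j))%N (K j).
  by rewrite -(dK j) addKn; apply/hpolZ/hpol_minor.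
have Krel x w : \sum_j e (s' j) (x *m rG w) * K j x = 0.
  have: minor e (extend u w) s' x = 0.
    apply/eqP/negbNE/negP => nz; suff /kmax : Q k.+1 by rewrite ltnn.
    by apply/asboolP; exists (extend u w), s', x.
  rewrite /minor (expand_det_row _ ord_max) => E; rewrite -[RHS]E.
  apply: eq_bigr => j _; rewrite mxE extend_max /K /cofactor /minor.
  congr (_ * (_ * \det _)); apply/matrixP => a b.
  by rewrite !mxE /= extend_lift.
have Ky : K ord_max y != 0.
  rewrite /K mulf_neq0 ?signr_eq0 //; move: uy; rewrite /minor.
  by congr (\det _ != 0); apply/matrixP => a b; rewrite !mxE /= /s' extend_lift.
have [z Kz fz] := free_orbit_avoid (Kd ord_max) Ky.
(* Averaging could kill the cofactor, so it is first multiplied by some [h]. A polynomial equal to 1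
   at [z] and to 0 on the rest of its orbit would do, hence so does one of its homogeneous
   components. *)
have [c [h [hc hz]]] : exists c h, hpol c h /\
    average (fun x => h x * K ord_max x) z != 0.
  apply: contrapT => n.
  have {}n f : pol f -> \sum_(w : gT) f (z *m rG w) * K ord_max (z *m rG w) = 0.
    elim=> {f} [c f fc|f1 f2 f _ IH1 _ IH2 fE].
      apply/eqP/negbNE/negP => nz; apply: n; exists c, f; split=> //.
      by rewrite /average mulf_neq0 // invr_neq0 ?card_neq0.
    under eq_bigr do rewrite fE mulrDl.
    by rewrite big_split /= IH1 IH2 addr0.
  have [f /n fs fE] := pol_interpolate fz; move: fs.
  rewrite (bigD1 1%g) //= big1 => [|w w1]; last by rewrite fE (negPf w1) mul0r.
  by rewrite fE eqxx repr_mx1 mulmx1 addr0 mul1r => /eqP; rewrite (negPf Kz).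
pose q i := average (fun x => h x * \sum_(j | s' j == i) K j x).
exists q, (fun i => c + (D - d i))%N, (c + D)%N.
have qs' j x : q (s' j) x = average (fun x => h x * K j x) x.
  rewrite /q /average; congr (_ * _); apply: eq_bigr => w _; congr (_ * _).
  by rewrite (big_pred1 j) // => i; rewrite (inj_eq s'inj).
have qn i : i \notin codom s' -> q i =1 (fun=> 0).
  move=> ni x; rewrite /q /average big1 ?mulr0 // => w _.
  by rewrite big1 ?mulr0 // => j /eqP ji; case/negP: ni; rewrite -ji codom_f.
split=> [i|i|x|].
- split; first exact: average_invariant.
  have [/codomP[j ->]|ni] := boolP (i \in codom s').
    by apply: hpol_average; apply: hpolM => //; apply: hpol_sum => l /eqP <-.
  by apply: (hpol_ext _ (hpol0 _ _ _)) => x; rewrite qn.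
- have [/codomP[j ->]|ni] := boolP (i \in codom s'); last by left; exact: qn.
  by right; rewrite -(dK j); lia.
- have -> : \sum_i e i x * q i x = \sum_j e (s' j) x * q (s' j) x.
    rewrite [RHS](eq_bigr (fun j => \sum_(i | s' j == i) e i x * q i x)).
      rewrite (exchange_big_dep predT) //=; apply: eq_bigr => i _.
      have [/codomP[j ->]|ni] := boolP (i \in codom s').
        by rewrite (big_pred1 j) // => l; rewrite (inj_eq s'inj).
      by rewrite qn // mulr0 big1 // => j _; rewrite mulr0.
    by move=> j _; rewrite (big_pred1 (s' j)) // => i; rewrite eq_sym.
  under eq_bigr do rewrite qs' /average mulrCA mulr_sumr.
  rewrite -mulr_sumr exchange_big big1 ?mulr0 // => w _.
  under eq_bigr do rewrite mulrCA; rewrite -mulr_sumr.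
  (* With the last row at [w^-1], the relation at [x w] has the [e_j] at [x] and only the cofactors
     at [x w], so it survives the average over [w]. *)
  have := Krel (x *m rG w) w^-1%g; rewrite mulmx_rG mulgV repr_mx1 mulmx1 => ->.
  by rewrite mulr0.
- by exists (s' ord_max), z; rewrite qs'.
Qed.

(** A graded Nakayama argument. Families independent modulo the ideal are independent over the
    invariants, so they have at most [#|gT|] members, and a maximal one spans modulo the ideal. *)
Lemma invariant_generators :
  exists n (e : 'I_n -> V -> F) (d : 'I_n -> nat),
    [/\ (n <= #|gT|)%N, forall i, hpol (d i) (e i) &
        forall f, pol f -> exists q : 'I_n -> V -> F,
          (forall i, invariant (q i)) /\ forall x, f x = \sum_i q i x * e i x].
Proof.
pose Q n := `[< exists (e : 'I_n -> V -> F) (d : 'I_n -> nat),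
  (forall i, hpol (d i) (e i)) /\ hilb_free e d >].
have Qbd n : Q n -> (n <= #|gT|)%N.
  move=> /asboolP[e [d [ed fe]]]; rewrite leqNgt; apply/negP => gn.
  have [q [b [D [qb bD rel [i [x qx]]]]]] := invariant_dependent gn ed.
  by have := hilb_free_independent ed fe qb bD rel i x; apply/eqP.
have Q0 : exists n, Q n.
  exists 0%N; apply/asboolP; exists (fun=> fun=> 0), (fun=> 0%N).
  by split=> [i|k c _ _ i]; case: i.
case: (ex_maxnP Q0 Qbd) => n /[dup] /Qbd ng /asboolP[e [d [ed fe]]] nmax.
exists n, e, d; split=> //.
have span k f : hpol k f ->
    exists c : 'I_n -> F, hilb k (fun x => f x - \sum_i c i * e i x).
  move=> fk; have nf : ~ hilb_free (extend e f) (extend d k).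
    move=> fe'; suff /nmax : Q n.+1 by rewrite ltnn.
    apply/asboolP; exists (extend e f), (extend d k); split=> // i.
    by rewrite /extend; case: unliftP.
  have [l [c [cl [lh [i ci]]]]] : exists l (c : 'I_n.+1 -> F),
      (forall i, extend d k i <> l -> c i = 0) /\
      hilb l (fun x => \sum_i c i * extend e f i x) /\ exists i, c i <> 0.
    apply: contrapT => N; apply: nf => l c cl ch i; apply: contrapT => ci.
    by apply: N; exists l, c; split=> //; split=> //; exists i.
  have {}lh : hilb l (fun x => \sum_i c (lift ord_max i) * e i x + c ord_max * f x).
    apply: (hilb_ext _ lh) => x; rewrite big_ord_recr /= extend_max.
    by congr (_ + _); apply: eq_bigr => j _; rewrite -(extend_lift e f);
      congr (c _ * extend e f _ x); apply/val_inj; rewrite /= /bump leqNgt ltn_ord.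
  have cm : c ord_max != 0.
    apply/negP => /eqP c0; apply: ci.
    have cn : forall j, c (lift ord_max j) = 0.
      apply: (fe l) => [j dj|]; first by apply: cl; rewrite extend_lift.
      by apply: (hilb_ext _ lh) => x; rewrite c0 mul0r addr0.
    by have [j ->|->] := unliftP ord_max i.
  have kl : k = l.
    by apply: contrapT => kl; case/eqP: cm; apply: cl; rewrite extend_max.
  exists (fun i => - (c ord_max)^-1 * c (lift ord_max i)); rewrite kl.
  apply: (hilb_ext _ (hilbZ (c ord_max)^-1 lh)) => x.
  rewrite mulrDr mulKf // addrC; congr (_ + _); rewrite -sumrN mulr_sumr.
  by apply: eq_bigr => j _; ring.
pose gens f := exists q : 'I_n -> V -> F,
  (forall i, invariant (q i)) /\ forall x, f x = \sum_i q i x * e i x.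
have gensD f g : gens f -> gens g -> gens (fun x => f x + g x).
  move=> [p [ip pE]] [q [iq qE]]; exists (fun i x => p i x + q i x).
  split=> [i w x|x]; first by rewrite ip iq.
  by rewrite pE qE -big_split; apply: eq_bigr => i _; rewrite mulrDl.
have gens_ext f g : f =1 g -> gens f -> gens g.
  by move=> fg [q [iq qE]]; exists q; split=> // x; rewrite -fg.
move=> f; elim=> {f} [k f|f1 f2 f _ IH1 _ IH2 fE]; last first.
  by apply: (gens_ext _ _ _ (gensD _ _ IH1 IH2)) => x; rewrite fE.
elim/ltn_ind: k f => k IH f fk.
(* In each term [a * h] of the element of the ideal, [h] has positive degree, so the induction on
   the degree applies to [a]. *)
have [c fc] := span k f fk.
have ch g : hilb k g -> gens g.
  move=> gh; move: IH; elim: gh => {f fk fc g k} [k g g0 _|k i j g a h g' ki ai hj ih _ IHg gE IH].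
    exists (fun=> fun=> 0); split=> // x; rewrite g0 big1 // => i _.
    by rewrite mul0r.
  apply: (gens_ext _ _ _ (gensD _ _ (IHg IH) _)) => [x|]; first by rewrite gE.
  have [|q [iq qE]] := IH i _ a ai; first by lia.
  exists (fun i x => q i x * h x); split=> [l w x|x]; first by rewrite iq ih.
  by rewrite qE mulr_suml; apply: eq_bigr => l _; rewrite mulrAC.
apply: (gens_ext _ _ _ (gensD _ _ (ch _ fc) _)) => [x|]; first exact: subrK.
by exists (fun i => fun=> c i).
Qed.

(** On a free orbit the interpolating functions, written on the generators with invariant
    coefficients, give a right inverse of the matrix [e_j (y w)]. This forces exactly [#|gT|]
    generators and makes the square matrix invertible. *)
Lemma orbit_matrix :
  exists (e : 'I_#|gT| -> V -> F) (d : 'I_#|gT| -> nat),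
    (forall i, hpol (d i) (e i)) /\
    forall y, free_orbit y -> minor e (@enum_val _ predT) id y != 0.
Proof.
have [n [e [d [ng ed eg]]]] := invariant_generators.
have key y : free_orbit y -> exists A : 'M[F]_(n, #|gT|),
    (\matrix_(i, j) e j (y *m rG (enum_val i))) *m A = 1%:M.
  move=> fy; have [f pf fE] := pol_interpolate fy.
  have /choice[q qE] : forall v, exists q : 'I_n -> V -> F,
     (forall i, invariant (q i)) /\
     forall x, f (x *m rG v^-1%g) = \sum_i q i x * e i x.
    move=> v; apply: eg; elim: pf {fE} => [k g gk|f1 f2 g _ p1 _ p2 gE].
      exact: (PolH (hpol_comp _ gk)).
    by apply: (PolD p1 p2) => x; rewrite gE.
  exists (\matrix_(j, i) q (enum_val i) j y); apply/matrixP => i k.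
  rewrite !mxE; case: (qE (enum_val k)) => iq /(_ (y *m rG (enum_val i))).
  rewrite mulmx_rG fE => E.
  transitivity ((enum_val i * (enum_val k)^-1 == 1)%g%:R : F); last first.
    by rewrite -eq_mulgV1 (inj_eq enum_val_inj).
  by rewrite E; apply: eq_bigr => j _; rewrite !mxE iq mulrC.
have [z _ fz] := free_orbit_avoid (y := 0) (hpolC r 1) (oner_neq0 F).
have nE : n = #|gT|.
  apply/eqP; rewrite eqn_leq ng /=; have [A /(congr1 mxrank)] := key z fz.
  by rewrite mxrank1 => <-; exact: leq_trans (mxrankM_maxr _ _) (rank_leq_row _).
subst n; exists e, d; split=> // y /key[A /mulmx1_unit[]].
by rewrite unitmxE unitfE.
Qed.
End Independence.

(** * Perturbation of roots and Steinberg's theorem *)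

Lemma poly_nonroot_small (F : numFieldType) (P : {poly F}) (t0 : F) :
  P != 0 -> 0 < t0 -> exists2 t, `|t| < t0 & P.[t] != 0.
Proof.
move=> P0 t0_gt0; apply: contrapT => nt.
pose s := [seq t0 / k.+2%:R | k <- iota 0 (size P)].
have sP : all (root P) s.
  apply/allP => _ /mapP[k _ ->]; apply/rootP/eqP/negbNE/negP => Pt; apply: nt.
  exists (t0 / k.+2%:R) => //; rewrite ger0_norm ?divr_ge0 ?ltW //.
  by rewrite ltr_pdivrMr ?ltr0Sn // ltr_pMr // ltr1n.
have := max_poly_roots P0 sP; rewrite size_map size_iota ltnn => H.
suff: false by []; apply: H; rewrite map_inj_in_uniq ?iota_uniq // => i j _ _.
by move/(mulfI (lt0r_neq0 t0_gt0))/invr_inj/eqP; rewrite eqr_nat => /eqP[].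
Qed.

Lemma poly_small (F : numFieldType) (P : {poly F}) (c : F) : P.[0] = 0 -> 0 < c ->
  exists2 t0, 0 < t0 <= 1 & forall t, `|t| < t0 -> `|P.[t]| < c.
Proof.
move=> /rootP/factor_theorem[Q ->] c0; rewrite subr0.
pose m := \sum_(i < size Q) `|Q`_i|.
have m0 : 0 <= m by apply: sumr_ge0.
have mc : 0 < 1 + m / c by rewrite ltr_pwDl // divr_ge0 // ltW.
exists (1 + m / c)^-1.
  by rewrite invr_gt0 mc invf_le1 // lerDl divr_ge0 // ltW.
move=> t tt; have t1 : `|t| <= 1.
  by apply: (le_trans (ltW tt)); rewrite invf_le1 // lerDl divr_ge0 // ltW.
rewrite hornerM hornerX normrM.
have Qm : `|Q.[t]| <= m.
  rewrite horner_coef; apply: (le_trans (ler_norm_sum _ _ _)).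
  by apply: ler_sum => i _; rewrite normrM normrX ler_piMr // exprn_ile1.
apply: (le_lt_trans (ler_pM _ _ Qm (ltW tt))) => //.
rewrite ltr_pdivrMr // mulrDr mulr1 mulrCA divff ?gt_eqF // mulr1.
by rewrite ltrDr.
Qed.

Lemma small_multiples (F : numFieldType) (I : finType) (m c : I -> F) :
  (forall i, 0 <= m i) -> (forall i, 0 < c i) ->
  exists2 t0, 0 < t0 & forall i, t0 * m i < c i.
Proof.
move=> m0 c0; pose S := \sum_i m i / c i.
have S0 : 0 <= S by apply: sumr_ge0 => i _; rewrite divr_ge0 // ltW.
exists (1 + S)^-1; first by rewrite invr_gt0 ltr_pwDl.
move=> i; rewrite mulrC ltr_pdivrMr ?ltr_pwDl // -ltr_pdivrMl // mulrC.
rewrite ltr_pwDl // /S (bigD1 i) //= lerDl.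
by apply: sumr_ge0 => j _; rewrite divr_ge0 // ltW.
Qed.

Section Steinberg.
Variables (F : numClosedFieldType) (r : nat) (gT : finGroupType).
Variable rG : mx_representation F [set: gT]%G r.
Local Notation V := 'rV[F]_r.
Implicit Types (f g h : V -> F) (x y : V) (w : gT).
Hypothesis gen : <<[set s | \rank (rG s - 1%:M) == 1%N]%SET>>%g = [set: gT]%SET.
Hypothesis faith : mx_faithful rG.

(** Up to sign [P.[0]] is [c] times the product of the [n] roots: if all had modulus at least [t0],
    it would be too large. *)
Lemma small_root (P : {poly F}) n (c t0 : F) : (size P <= n.+1)%N -> P`_n = c ->
  c != 0 -> 0 < t0 -> `|P.[0]| < `|c| * t0 ^+ n -> exists2 z : F, (`|z| < t0) & root P z.
Proof.
move=> sP Pn c0 t00 P0.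
have sPE : size P = n.+1.
  apply/eqP; rewrite eqn_leq sP ltnNge; apply/negP => /leq_sizeP/(_ n (leqnn _)).
  by rewrite Pn => /eqP; rewrite (negPf c0).
have [s PE] := closed_field_poly_normal P.
have cE : lead_coef P = c by rewrite lead_coefE sPE.
have sn : size s = n.
  apply/eqP; rewrite -eqSS -sPE PE size_scale ?cE // size_prod_XsubC.
  by [].
apply: contrapT => nz; have sz z : z \in s -> t0 <= `|z|.
  move=> zs; rewrite real_leNgt ?normr_real ?gtr0_real //; apply/negP => zt.
  by apply: nz; exists z => //; rewrite PE rootZ ?cE // root_prod_XsubC.
suff: `|c| * t0 ^+ n <= `|P.[0]| by move=> /(lt_le_trans P0); rewrite ltxx.
rewrite PE cE hornerZ normrM ler_wpM2l // horner_prod normr_prod -sn.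
elim: s sz {PE sn} => [|z s IH] sz; first by rewrite expr0 big_nil.
rewrite big_cons exprS ler_pM ?exprn_ge0 ?(ltW t00) //.
  by rewrite hornerXsubC sub0r normrN sz ?mem_head.
by apply: IH => y ys; apply: sz; rewrite inE ys orbT.
Qed.

(** If [D = det (e_j (x w))] vanishes at [x0], then a line close to [x0] that
    misses the fixed spaces of codimension at least 2 carries a zero of [D] close
    to [x0], at which the orbit is free: a contradiction. *)
Lemma steinberg (x0 : V) :
  (forall s, \rank (rG s - 1%:M) = 1%N -> x0 *m rG s != x0) ->
  free_orbit rG x0.
Proof.
move=> x0s w0 w01; apply/negP => /eqP x0w0.
have [e [d [ed minorP]]] := orbit_matrix gen faith.
pose D x : F := minor rG e (@enum_val _ predT) id x.
pose n := (\sum_j d j)%N.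
have Dn : hpol n D by exact: hpol_minor.
have D0 : D x0 = 0.
  apply: (determinant_alternate (i1 := enum_rank w0) (i2 := enum_rank 1%g)).
    by rewrite (inj_eq enum_rank_inj).
  by move=> j; rewrite !mxE !enum_rankK x0w0 repr_mx1 mulmx1.
have [v _ /minorP Dv] := free_orbit_avoid faith (y := 0) (hpolC r 1) (oner_neq0 F).
rewrite -/(D v) in Dv.
pose A w := rG w - 1%:M.
have fixA x w : (x *m rG w == x) = (x *m A w == 0).
  by rewrite /A mulmxBr mulmx1 subr_eq0.
have A0 w : w != 1%g -> A w != 0.
  move=> w1; apply: contraNneq w1 => A0; suff: w \in rker rG.
    by move/(fintype.subsetP faith); rewrite inE.
  by apply/rkerP; rewrite inE; split=> //; apply/eqP; rewrite -subr_eq0 -/(A w) A0.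
pose bad := [pred w | (w != 1%g) && (\rank (A w) != 1%N)].
(* Here [A w] has rank at least 2, while [v *m A w] spans at most a line. Hence some nonzero form
   [A w *m b] vanishes on the fixed points of [w] and is constant in the direction [v]. *)
have /choice[b bE] : forall w, exists b : 'cV[F]_r, bad w ->
    v *m A w *m b = 0 /\ A w *m b != 0.
  move=> w; have [/andP[w1 rw]|_] := boolP (bad w); last by exists 0.
  have AC : A w *m cokermx (v *m A w) != 0.
    apply: contra rw; rewrite -submxE => /mxrankS rA.
    by rewrite eqn_leq lt0n mxrank_eq0 A0 // andbT (leq_trans rA) ?rank_leq_row.
  have [j jE] : exists j, col j (A w *m cokermx (v *m A w)) != 0.
    apply: contrapT => N; case/eqP: AC; apply/matrixP => i j.
    have : col j (A w *m cokermx (v *m A w)) = 0.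
      by apply/eqP/negbNE/negP => c; apply: N; exists j.
    by move/colP/(_ i); rewrite !mxE.
  exists (col j (cokermx (v *m A w))) => _; split.
    by rewrite colE mulmxA mulmx_coker mul0mx.
  by rewrite [col j (cokermx _)]colE (mulmxA (A w)) -colE.
(* None of these forms is constant in the direction [u]. So for all but finitely many [t] the line
   [x0 + t u + z v] misses the fixed points of every bad [w]. *)
have [|u uE] := @forms_avoid F r gT (enum bad) (fun w => A w *m b w).
  by move=> w; rewrite mem_enum => /bE[].
have /choice[a aE] : forall s, exists a : 'cV[F]_r, \rank (A s) = 1%N ->
    (x0 *m a) 0 0 != 0 /\ forall x, (x *m a) 0 0 != 0 -> x *m rG s != x.
  move=> s; have [rs|/eqP nrs] := eqVneq (\rank (A s)) 1%N; last by exists 0 => /nrs.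
  have [a [c [AE a0]]] := rank1_mul rs; exists a => _.
  have c0 : c != 0.
    by apply/eqP => c0; move: rs; rewrite AE c0 mulmx0 mxrank0.
  suff H x : ((x *m a) 0 0 != 0) = (x *m rG s != x).
    by rewrite H; split=> [|x]; [exact: x0s | rewrite H].
  rewrite fixA AE mulmxA [X in _ = (X *m c != 0)]mx11_scalar mul_scalar_mx.
  by rewrite scaler_eq0 (negPf c0) orbF.
(* Displacements along [u] and [v] with coefficients below [t0] reach no reflecting hyperplane. *)
have [||t0 t00 tE] := @small_multiples F gT
  (fun s => `|(u *m a s) 0 0| + `|(v *m a s) 0 0|)
  (fun s => if \rank (A s) == 1%N then `|(x0 *m a s) 0 0| else 1).
- by move=> s; rewrite addr_ge0.
- by move=> s /=; case: ifP => [/eqP/aE[]|_]; rewrite ?normr_gt0 ?ltr01.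
have [P [_ _ PE]] := hpol_line x0 u Dn.
have P0 : P.[0] = 0 by rewrite PE scale0r addr0 D0.
have c0 : 0 < `|D v| * t0 ^+ n by rewrite mulr_gt0 ?normr_gt0 ?exprn_gt0.
have [t1 /andP[t10 _] t1E] := poly_small P0 c0.
pose B := \prod_(w <- enum bad) (((x0 *m (A w *m b w)) 0 0)%:P +
                                 ((u *m (A w *m b w)) 0 0) *: 'X).
have B0 : B != 0.
  rewrite prodf_seq_neq0; apply/allP => w wb /=; apply/eqP => /(congr1 (coefp 1)).
  rewrite /= coefD coefC coefZ coefX coef0 add0r mulr1 => /eqP.
  by rewrite (negPf (uE w wb)).
(* A positive bound below both [t0] and [t1]. *)
have t010 : 0 < t0 * t1 / (t0 + t1) by rewrite divr_gt0 ?mulr_gt0 ?addr_gt0.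
have [t tt Bt] := poly_nonroot_small B0 t010.
have tt0 : `|t| < t0.
  apply: (lt_trans tt); rewrite ltr_pdivrMr ?addr_gt0 // ltr_pM2l //.
  by rewrite ltrDr.
have tt1 : `|t| < t1.
  apply: (lt_trans tt); rewrite ltr_pdivrMr ?addr_gt0 // mulrC ltr_pM2l //.
  by rewrite ltrDl.
have [Q [sQ Qn QE]] := hpol_line (x0 + t *: u) v Dn.
have [z zt /rootP] : exists2 z, `|z| < t0 & root Q z.
  apply: (small_root sQ Qn Dv t00); rewrite QE scale0r addr0 -PE.
  exact: t1E.
rewrite QE; apply/eqP/minorP => w w1.
have frmE (m : nat) (M : 'M[F]_(r, m)) : (x0 + t *: u + z *: v) *m M =
    x0 *m M + t *: (u *m M) + z *: (v *m M).
  by rewrite !mulmxDl -!scalemxAl.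
have frm00 (c : 'cV[F]_r) : ((x0 + t *: u + z *: v) *m c) 0 0 =
    (x0 *m c) 0 0 + t * (u *m c) 0 0 + z * (v *m c) 0 0.
  by rewrite frmE [LHS]mxE [X in X + _]mxE [X in _ + X + _]mxE [X in _ + _ + X]mxE.
have [rw|rw] := eqVneq (\rank (A w)) 1%N.
  case: (aE w rw) => _; apply; rewrite frm00 -addrA.
  apply/eqP => /eqP; rewrite addr_eq0 => /eqP E.
  have := tE w; rewrite rw eqxx => /lt_le_trans H; suff: false by [].
  rewrite -(ltxx (t0 * (`|(u *m a w) 0 0| + `|(v *m a w) 0 0|))).
  apply: H; rewrite E normrN (le_trans (ler_normD _ _)) // mulrDr !normrM.
  by rewrite lerD // ler_wpM2r // ltW.
have wb : w \in enum bad by rewrite mem_enum inE /= w1 rw.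
have [vb _] := bE w (introT andP (conj w1 rw)).
rewrite fixA; apply/eqP => /(congr1 (mulmx^~ (b w))).
rewrite mul0mx -mulmxA => /(congr1 (fun M : 'M[F]_1 => M 0 0)).
rewrite frm00 mulmxA mulmxA (mulmxA v) vb [RHS]mxE [X in z * X]mxE mulr0 addr0 => E.
move: Bt; rewrite horner_prod (big_rem w) //= mulf_eq0 => /norP[+ _].
by rewrite hornerD hornerC hornerZ hornerX mulrC !mulmxA E eqxx.
Qed.
End Steinberg.

(** Compactness of the interval as an induction principle: the supremum of the [t] with [P 0 t] can
    be passed unless it is 1. It yields connectedness, the gluing of primitives along a segment and
    the lifting of squares. *)
Lemma interval_ind (R : realType) (P : R -> R -> Prop) :
  (forall a b c, a <= b -> b <= c -> P a b -> P b c -> P a c) ->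
  (forall x, 0 <= x <= 1 -> exists2 d, 0 < d &
     forall a b, 0 <= a -> a <= b -> b <= 1 -> x - d < a -> b < x + d -> P a b) ->
  P 0 1.
Proof.
move=> Ptrans Ploc.
pose S : set R := fun t => 0 <= t <= 1 /\ P 0 t.
have S0 : S 0.
  split; first by rewrite lexx ler01.
  have [|d d0 Pd] := Ploc 0; first by rewrite lexx ler01.
  by apply: Pd => //; rewrite ?ler01 //; lra.
have supS : has_sup S.
  by split; [exists 0 | exists 1 => t [/andP[]]].
have s1 : sup S <= 1 by apply: ge_sup; [exists 0 | move=> t [/andP[]]].
have s0 : 0 <= sup S by apply: ub_le_sup S0; case: supS.
have [|d d0 Pd] := Ploc (sup S); first by rewrite s0.
have [t St tS] := sup_adherent d0 supS.
have ts : t <= sup S by apply: ub_le_sup St; case: supS.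
case: St => /andP[t0 t1] Pt.
pose b := Num.min 1 (sup S + d / 2).
have bd : b < sup S + d by rewrite /b gt_min; apply/orP; right; lra.
have b1 : b <= 1 by rewrite ge_min lexx.
have tb : t <= b by rewrite le_min t1; lra.
have Pb : P 0 b by apply: (Ptrans _ t) => //; apply: Pd.
have : b <= sup S.
  by apply: ub_le_sup; [case: supS | split=> //; rewrite b1 (le_trans t0)].
move: Pb; rewrite /b; have [h1|h1] := leP 1 (sup S + d / 2); first by [].
by move=> _; lra.
Qed.

Lemma nearR (R : realType) (x : R) (P : R -> Prop) : (\forall y \near x, P y) ->
  exists2 d, 0 < d & forall y, x - d < y -> y < x + d -> P y.
Proof.
move=> /nbhs_ballP[d /= d0 dP]; exists d => // y xy yx; apply: dP.
by rewrite /ball /= ltr_norml; lra.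
Qed.

Lemma locally_constant01 (R : realType) (T : Type) (g : R -> T) :
  (forall s : R, 0 <= s <= 1 -> \forall t \near s, g t = g s) -> g 0 = g 1.
Proof.
move=> gloc; apply: (@interval_ind R (fun a b => g a = g b)).
  by move=> a b c _ _ -> ->.
move=> x /gloc/nearR[d d0 dP]; exists d => // a b _ ab _ xa bx.
by rewrite !dP //; lra.
Qed.

(** * Cochains on the complement of an arrangement *)

Section ComplexPlane.
Variable R : realType.
Local Notation C := R[i].
Implicit Types (z w : C) (s t : R).
Local Open Scope complex_scope.

Lemma complex_gt0 (e : C) : 0 < e -> 0 < complex.Re e /\ e = (complex.Re e)%:C.
Proof. by case: e => a b; rewrite ltcE /= => /andP[/eqP -> ?]. Qed.

Lemma normC_real s : `|s%:C| = `|s|%:C.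
Proof. by rewrite normc_def /= expr0n addr0 sqrtr_sqr. Qed.

Lemma Re_le_norm z : `|complex.Re z|%:C <= `|z|.
Proof. exact: normc_ge_Re. Qed.

Lemma Im_le_norm z : `|complex.Im z|%:C <= `|z|.
Proof.
by rewrite normc_def lecR -sqrtr_sqr; apply: ler_wsqrtr; rewrite lerDr sqr_ge0.
Qed.

Lemma real_complex_continuous : continuous (fun s : R => s%:C : C).
Proof.
move=> s P /nbhs_ballP[e /complex_gt0[e0 ->] eP].
apply/nbhs_ballP; exists (complex.Re e) => // t st; apply: eP.
by rewrite /ball /= -rmorphB normC_real ltcR.
Qed.

Lemma Re_continuous : continuous (fun z : C => complex.Re z : R).
Proof.
move=> z P /nbhs_ballP[e /= e0 eP].
apply/nbhs_ballP; exists e%:C; first by rewrite /= ltcR.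
move=> w zw; apply: eP; rewrite /ball /= -raddfB -ltcR.
exact: le_lt_trans (Re_le_norm _) zw.
Qed.

Lemma Im_continuous : continuous (fun z : C => complex.Im z : R).
Proof.
move=> z P /nbhs_ballP[e /= e0 eP].
apply/nbhs_ballP; exists e%:C; first by rewrite /= ltcR.
move=> w zw; apply: eP; rewrite /ball /= -raddfB -ltcR.
exact: le_lt_trans (Im_le_norm _) zw.
Qed.

(** A detour through [1/2 + e i] for a small [e] avoids finitely many points. *)
Lemma complex_line_constant (J : finType) (A B : J -> C) (K : set C) (T : Type)
    (g : C -> T) :
  (forall z w s, K z -> K w -> 0 <= s <= 1 -> K (z + s%:C * (w - z))) ->
  K 0 -> K 1 -> nbhs (2^-1 : C) K ->
  (forall j, A j != 0) -> (forall j, A j + B j != 0) ->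
  (forall z, K z -> (forall j, A j + z * B j != 0) -> \forall w \near z, g w = g z) ->
  g 0 = g 1.
Proof.
move=> cvK K0 K1 /nbhs_ballP[d /complex_gt0[d0 dE] dK] A0 AB0 gloc.
pose p j := - A j / B j.
(* The values of [e] for which the broken line from 0 to 1 through [1/2 + e i] meets a root [p j],
   on its first or its second half. An index with [B j = 0] only adds the value 0. *)
pose L := [seq complex.Im (p j) / (2 * complex.Re (p j)) | j <- enum J] ++
          [seq complex.Im (p j) / (2 * (1 - complex.Re (p j))) | j <- enum J].
have [e ed eL] := poly_nonroot_small (P := \prod_(l <- L) ('X - l%:P))
  (monic_neq0 (monic_prod_XsubC _ _ _)) d0.
have {}eL : e \notin L by move: eL; rewrite -root_prod_XsubC.
pose w : C := 2^-1 +i* e.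
have w2 : (2^-1 : C) = 2^-1%:C by rewrite -[2 in LHS](rmorph_nat (real_complex R)) fmorphV.
have Kw : K w.
  apply: dK; rewrite dE /ball /= w2 /w.
  have -> : 2^-1%:C - (2^-1 +i* e) = 0 +i* (- e) :> C.
    by apply/eqP; rewrite eq_complex /= subrr sub0r !eqxx.
  by rewrite normc_def /= expr0n add0r sqrrN sqrtr_sqr ltcR.
have root j z : A j + z * B j = 0 -> z = p j.
  move=> E; have B0 : B j != 0.
    by apply/eqP => B0; move: E (A0 j); rewrite B0 mulr0 addr0 => ->; rewrite eqxx.
  by apply: (mulIf B0); rewrite /p mulfVK //; move/eqP: E; rewrite addrC addr_eq0 => /eqP.
have half1 s j : A j + s%:C * w * B j != 0.
  have [->|s0] := eqVneq s 0; first by rewrite !mul0r addr0.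
  apply/eqP => /root E; case/negP: eL; rewrite mem_cat; apply/orP; left.
  apply/mapP; exists j; first by rewrite mem_enum.
  by rewrite -E /w; simpc; rewrite /=; field.
have half2 s j : A j + (1 - s%:C * (1 - w)) * B j != 0.
  have [->|s0] := eqVneq s 0; first by rewrite mul0r subr0 mul1r.
  apply/eqP => /root E; case/negP: eL; rewrite mem_cat; apply/orP; right.
  apply/mapP; exists j; first by rewrite mem_enum.
  rewrite -E /w; simpc; rewrite /=; field.
  by rewrite addrC subrK.
have along (z0 z1 : C) : (forall s, 0 <= s <= 1 -> K (z0 + s%:C * (z1 - z0))) ->
    (forall s j, A j + (z0 + s%:C * (z1 - z0)) * B j != 0) -> g z0 = g z1.
  move=> Kz nz; have := @locally_constant01 R T (fun s => g (z0 + s%:C * (z1 - z0))).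
  rewrite /= mul0r addr0 mul1r subrKC; apply => s s01.
  have : continuous (fun s => z0 + s%:C * (z1 - z0)); last first.
    by move/(_ s _ (gloc _ (Kz s s01) (nz s))).
  move=> t; apply: cvgD; first exact: cvg_cst.
  by apply: cvgM; [exact: real_complex_continuous | exact: cvg_cst].
apply: (@etrans _ _ (g w)).
  by apply: along => [s s01|s j]; [exact: cvK | rewrite add0r subr0].
apply/esym/along => [s s01|s j].
  have -> : 1 + s%:C * (w - 1) = w + (1 - s)%:C * (1 - w).
    by rewrite rmorphB rmorph1; ring.
  by apply: cvK => //; lra.
by rewrite -[w - 1]opprB mulrN.
Qed.
End ComplexPlane.

(** * Convex open sets, hyperplanes and local primitives *)

Section Arrangement.
Variables (R : realType) (r : nat).
Local Notation C := R[i].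
Local Notation V := 'rV[C]_r.
Local Open Scope complex_scope.
Implicit Types (x y v : V) (z : C) (s t : R) (K : set V).

Definition frm (a : 'cV[C]_r) x : C := (x *m a) 0 0.

Lemma frmD a x y : frm a (x + y) = frm a x + frm a y.
Proof. by rewrite /frm mulmxDl mxE. Qed.

Lemma frmZ a z x : frm a (z *: x) = z * frm a x.
Proof. by rewrite /frm -scalemxAl mxE. Qed.

Lemma frmB a x y : frm a (x - y) = frm a x - frm a y.
Proof. by rewrite -scaleN1r frmD frmZ mulN1r. Qed.

Lemma frm_line a x y z : frm a (x + z *: y) = frm a x + z * frm a y.
Proof. by rewrite frmD frmZ. Qed.

Lemma frmZl z a x : frm (z *: a) x = z * frm a x.
Proof. by rewrite /frm -scalemxAr mxE. Qed.

Lemma frmBl a b x : frm (a - b) x = frm a x - frm b x.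
Proof. by rewrite /frm mulmxBr !mxE. Qed.

Lemma frm_continuous a : continuous (frm a).
Proof.
have -> : frm a = fun x => \sum_i x 0 i * a i 0.
  by apply/funext => x; rewrite /frm mxE.
apply: continuous_big => [|i _ x]; first exact: add_continuous.
apply: (@continuousM _ _ (fun x : V => x 0 i) (fun=> a i 0)); last exact: cst_continuous.
exact: (@coord_continuous C 1 r 0 i).
Qed.

Lemma line_continuous x y : continuous (fun z : C => x + z *: y).
Proof.
move=> z; apply: (@continuousD _ _ _ (fun=> x) (fun z : C => z *: y)).
  exact: cst_continuous.
by apply: continuousZr_tmp; exact: cvg_id.
Qed.

Lemma near_real_line x v s (P : V -> Prop) :
  nbhs (x + s%:C *: v) P -> \forall t \near s, P (x + t%:C *: v).
Proof.
have cs : {for s, continuous (fun t : R => x + t%:C *: v)}.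
  apply: (@continuous_comp _ _ _ (fun t : R => t%:C : C) (fun z => x + z *: v)).
    exact: real_complex_continuous.
  exact: line_continuous.
by move=> N; exact: (cs P N).
Qed.

Lemma near_neq0 (T : topologicalType) (f : T -> C) (x : T) :
  {for x, continuous f} -> f x != 0 -> \forall y \near x, f y != 0.
Proof.
move=> cf fx.
have /cf : nbhs (f x) (fun z => z != 0).
  apply/nbhs_ballP; exists `|f x|; first by rewrite /= normr_gt0.
  by move=> z; apply: contraTneq => ->; rewrite /ball /= subr0 ltxx.
by [].
Qed.

Definition reg (I : finType) (a : I -> 'cV[C]_r) : set V :=
  fun x => forall i, frm (a i) x != 0.

Lemma near_reg (I : finType) (a : I -> 'cV[C]_r) x : reg a x ->
  \forall y \near x, reg a y.
Proof.
move=> ax; apply: (@filter_forall _ _ (fun i y => frm (a i) y != 0) (nbhs x)) => i.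
apply: (@near_neq0 V (frm (a i))) => //.
exact: frm_continuous.
Qed.

Definition cvx K : Prop :=
  forall x y s, K x -> K y -> 0 <= s <= 1 -> K (x + s%:C *: (y - x)).
Definition opn K : Prop := forall x, K x -> \forall y \near x, K y.

Lemma cvxI K L : cvx K -> cvx L -> cvx (fun x => K x /\ L x).
Proof. by move=> cK cL x y s [Kx Lx] [Ky Ly] s01; split; [exact: cK | exact: cL]. Qed.

Lemma opnI K L : opn K -> opn L -> opn (fun x => K x /\ L x).
Proof. by move=> oK oL x [/oK Kx /oL Lx]; near do split. Unshelve. all: by end_near. Qed.

Lemma convex_lt s (e p q : R) : 0 <= s <= 1 -> p < e -> q < e ->
  (1 - s) * p + s * q < e.
Proof.
move=> /andP[s0 s1] pe qe; have [->|s1'] := eqVneq s 1; first by lra.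
have : s < 1 by rewrite lt_neqAle s1'.
nra.
Qed.

Lemma convex_norm_lt s (u v : V) (e : C) : 0 <= s <= 1 -> `|u| < e -> `|v| < e ->
  `|(1 - s)%:C *: u + s%:C *: v| < e.
Proof.
move=> s01 ue ve; have /complex_gt0[_ eE] : 0 < e by apply: le_lt_trans ue.
have nE (w : V) : `|w| = (complex.Re `|w|)%:C by rewrite RRe_real ?normr_real.
apply: (le_lt_trans (ler_normD _ _)); rewrite !normrZ !normC_real.
move: ue ve; rewrite nE (nE v) eE !ltcR => ue ve.
case/andP: (s01) => s0 s1; rewrite !ger0_norm ?subr_ge0 //.
by rewrite -!rmorphM -rmorphD ltcR convex_lt.
Qed.

Lemma cvx_ball x (e : C) : cvx (ball x e).
Proof.
move=> y z s; rewrite -ball_normE /ball_ /= => xy xz s01.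
have -> : x - (y + s%:C *: (z - y)) = (1 - s)%:C *: (x - y) + s%:C *: (x - z).
  by rewrite rmorphB rmorph1 scalerBl scale1r !scalerBr; rewrite -!addrA; congr (_ + _);
    apply/rowP => i; rewrite !mxE; ring.
exact: convex_norm_lt.
Qed.

Lemma opn_ball x (e : C) : opn (ball x e).
Proof.
move=> y xy; have [e0|e0] := pselect (0 < e).
  by apply: open_nbhs_nbhs; split=> //; exact: ball_open.
by move: xy; rewrite -ball_normE /ball_ /= => /(le_lt_trans (normr_ge0 _)).
Qed.

(** The complex line through [x] and [y] meets each hyperplane in at most one point. Local constancy
    is asked only along this line, so that the lemma also applies to points moving inside a
    hyperplane. *)
Lemma line_constant (I : finType) (a : I -> 'cV[C]_r) K (T : Type) (G : V -> T) x y :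
  cvx K -> opn K ->
  (forall z, K (x + z *: (y - x)) -> reg a (x + z *: (y - x)) ->
     \forall w \near z, G (x + w *: (y - x)) = G (x + z *: (y - x))) ->
  K x -> K y -> reg a x -> reg a y -> G x = G y.
Proof.
move=> cK oK Gloc Kx Ky ax ay.
pose g z := G (x + z *: (y - x)).
suff : g 0 = g 1 by rewrite /g scale0r addr0 scale1r subrKC.
have cl := @line_continuous x (y - x).
apply: (@complex_line_constant R I (fun i => frm (a i) x)
  (fun i => frm (a i) (y - x)) (fun z => K (x + z *: (y - x)))).
- move=> z w s Kz Kw s01.
  have -> : x + (z + s%:C * (w - z)) *: (y - x) =
      x + z *: (y - x) + s%:C *: (x + w *: (y - x) - (x + z *: (y - x))).
    by apply/rowP => i; rewrite !mxE; ring.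
  exact: cK.
- by rewrite scale0r addr0.
- by rewrite scale1r subrKC.
- apply: (cl 2^-1 K); apply: oK.
  have -> : (2^-1 : C) = (2^-1)%:C by rewrite fmorphV rmorph_nat.
  by apply: cK => //; lra.
- by [].
- by move=> i; rewrite -frmD subrKC.
- by move=> z Kz nz; apply: Gloc => // i; rewrite frm_line.
Qed.

Lemma reg_constant (I : finType) (a : I -> 'cV[C]_r) K (T : Type) (G : V -> T) x y :
  cvx K -> opn K ->
  (forall x, K x -> reg a x -> \forall y \near x, G y = G x) ->
  K x -> K y -> reg a x -> reg a y -> G x = G y.
Proof.
move=> cK oK Gloc; apply: (line_constant cK oK) => z Kz az.
exact: (@line_continuous x (y - x) z _ (Gloc _ Kz az)).
Qed.

Definition is_prim (M : zmodType) (e : V -> V -> M) K (F : V -> M) : Prop :=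
  forall x, K x -> \forall y \near x, e x y = F y - F x.

(** The set [K] may meet the hyperplanes, but the primitive is required only off them: on a ball
    centred on a hyperplane this expresses trivial monodromy. *)
Definition has_prim (M : zmodType) (I : finType) (a : I -> 'cV[C]_r)
    (e : V -> V -> M) K : Prop :=
  exists F, is_prim e (fun x => K x /\ reg a x) F.

Section Primitives.
Variables (M : zmodType) (e : V -> V -> M) (I : finType) (a : I -> 'cV[C]_r).

Lemma prim_sub K L F : (forall x, K x -> L x) -> is_prim e L F -> is_prim e K F.
Proof. by move=> KL pF x /KL; apply: pF. Qed.

Lemma has_prim_sub K L : (forall x, K x -> L x) -> has_prim a e L -> has_prim a e K.
Proof.
by move=> KL [F pF]; exists F; apply: prim_sub pF => x [/KL].
Qed.

Lemma prim_shift K F c : is_prim e K F -> is_prim e K (fun x => F x + c).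
Proof.
move=> pF x /pF; apply: filterS => y ->.
by rewrite opprD addrACA subrr addr0.
Qed.

Lemma prim_diff K F G x y : cvx K -> opn K ->
  is_prim e (fun x => K x /\ reg a x) F -> is_prim e (fun x => K x /\ reg a x) G ->
  K x -> K y -> reg a x -> reg a y -> G x - F x = G y - F y.
Proof.
move=> cK oK pF pG Kx Ky ax ay.
apply: (@reg_constant I a K M (fun v => G v - F v) x y) => // {}x {}Kx {}ax.
near=> w; have wF : e x w = F w - F x by near: w; apply: pF.
have wG : e x w = G w - G x by near: w; apply: pG.
have -> : G w = F w - F x + G x by rewrite -wF wG subrK.
by rewrite addrAC [F w - F x]addrC addrK addrC.
Unshelve. all: by end_near. Qed.

(** After a shift two primitives agree on a convex overlap. *)
Lemma prim_match K F G : cvx K -> opn K ->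
  is_prim e (fun x => K x /\ reg a x) F -> is_prim e (fun x => K x /\ reg a x) G ->
  exists c, forall x, K x -> reg a x -> F x = G x + c.
Proof.
move=> cK oK pF pG.
have [[x [Kx ax]]|nK] := pselect (exists x, K x /\ reg a x); last first.
  by exists 0 => x Kx ax; case: nK; exists x.
exists (F x - G x) => y Ky ay.
by rewrite -(prim_diff cK oK pG pF Ky Kx ay ax) subrKC.
Qed.

Lemma prim_union K L F G : opn K -> opn L ->
  is_prim e (fun x => K x /\ reg a x) F -> is_prim e (fun x => L x /\ reg a x) G ->
  (forall x, K x -> L x -> reg a x -> F x = G x) ->
  is_prim e (fun x => (K x \/ L x) /\ reg a x)
    (fun x => if pselect (K x) then F x else G x).
Proof.
move=> oK oL pF pG FG x [KLx ax]; have aN := near_reg ax.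
case: (pselect (K x)) => [Kx|nKx].
  have KN := oK _ Kx; have pN := pF x (conj Kx ax).
  near=> y; have Ky : K y by near: y.
  have -> : e x y = F y - F x by near: y.
  by case: pselect.
have Lx : L x by case: KLx.
have LN := oL _ Lx; have pN := pG x (conj Lx ax).
near=> y; have Ly : L y by near: y.
have ay : reg a y by near: y.
have -> : e x y = G y - G x by near: y.
suff -> : (if pselect (K y) then F y else G y) = G y by [].
by case: pselect => // Ky; apply: FG.
Unshelve. all: by end_near. Qed.

Lemma has_prim_union K L : cvx K -> cvx L -> opn K -> opn L ->
  has_prim a e K -> has_prim a e L -> has_prim a e (fun x => K x \/ L x).
Proof.
move=> cK cL oK oL [F pF] [G pG].
have [c FG] : exists c, forall x, K x /\ L x -> reg a x -> F x = G x + c.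
  apply: prim_match; [exact: cvxI | exact: opnI | |].
    by apply: prim_sub pF => x [[]].
  by apply: prim_sub pG => x [[]].
eexists; apply: (prim_union oK oL pF (prim_shift c pG)) => x Kx Lx ax.
exact: FG.
Qed.
End Primitives.
End Arrangement.

(** * From local to global primitives *)

Section GlobalPrimitive.
Variables (R : realType) (r : nat) (M : zmodType).
Local Notation C := R[i].
Local Notation V := 'rV[C]_r.
Local Open Scope complex_scope.
Variables (e : V -> V -> M) (I : finType) (a : I -> 'cV[C]_r).
Implicit Types (x y v q : V) (z : C) (s t d : R) (K : set V).

Lemma reg_dense (J : finType) (b : J -> 'cV[C]_r) K x : (forall j, b j != 0) ->
  opn K -> K x -> exists2 y, K y & reg b y.
Proof.
move=> b0 oK Kx; have [|v bv] := @forms_avoid _ _ J (enum J) b.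
  by move=> j _; exact: b0.
have /nbhs_ballP[c /= c0 cK] : nbhs (0 : C) (fun z => K (x + z *: v)).
  by apply: (@line_continuous R r x v 0 K); rewrite scale0r addr0; exact: oK.
pose P := \prod_j ((frm (b j) x)%:P + frm (b j) v *: 'X).
have P0 : P != 0.
  apply/prodf_neq0 => j _; apply/eqP => /(congr1 (coefp 1)) /=.
  rewrite coefD coefC coefZ coefX coef0 add0r mulr1 => /eqP.
  by rewrite (negPf (bv j (mem_enum _ _))).
have [z zc Pz] := poly_nonroot_small P0 c0.
exists (x + z *: v) => [|j]; first by apply: cK; rewrite /ball /= sub0r normrN.
move: Pz; rewrite horner_prod => /prodf_neq0/(_ j isT).
by rewrite hornerD hornerC hornerZ hornerX frm_line mulrC.
Qed.

Definition tube x v d s t : set V :=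
  fun y => exists2 u : R, s <= u <= t & ball (x + u%:C *: (v - x)) d%:C y.

Lemma cvx_tube x v d s t : cvx (tube x v d s t).
Proof.
move=> y z k [u /andP[su ut] yu] [w /andP[sw wt] zw] k01.
exists (u + k * (w - u)); first by case/andP: k01 => k0 k1; apply/andP; split; nra.
move: yu zw; rewrite -ball_normE /ball_ /= => yu zw.
have -> : x + (u + k * (w - u))%:C *: (v - x) - (y + k%:C *: (z - y)) =
    (1 - k)%:C *: (x + u%:C *: (v - x) - y) + k%:C *: (x + w%:C *: (v - x) - z).
  have -> : (u + k * (w - u))%:C = u%:C + k%:C * (w%:C - u%:C) :> C.
    by rewrite rmorphD rmorphM rmorphB.
  have -> : (1 - k)%:C = 1 - k%:C :> C by rewrite rmorphB rmorph1.
  move: (u%:C) (k%:C) (w%:C) => a1 a2 a3.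
  by apply/rowP => i; rewrite !mxE; ring.
exact: convex_norm_lt.
Qed.

Lemma opn_tube x v d s t : opn (tube x v d s t).
Proof.
move=> y [u su /opn_ball yu]; near=> w; exists u => //; near: w; exact: yu.
Unshelve. all: by end_near. Qed.

(** Subdivision of the segment: two consecutive tubes are convex, so their primitives can be matched
    on the overlap. The radius becomes the smaller of the two. *)
Lemma tube_prim x v :
  (forall s, 0 <= s <= 1 -> exists2 d, 0 < d &
     has_prim a e (ball (x + s%:C *: (v - x)) d%:C)) ->
  exists2 d, 0 < d & has_prim a e (tube x v d 0 1).
Proof.
move=> loc; pose P s t := exists2 d, 0 < d & has_prim a e (tube x v d s t).
apply: (@interval_ind R P) => [s t u st tu [d d0 pd] [c c0 pc]|s /loc[d d0 pd]].
  exists (Num.min d c); first by rewrite lt_min d0.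
  apply: (@has_prim_sub _ _ _ _ _ _ _
    (fun y => tube x v d s t y \/ tube x v c t u y)); last first.
    by apply: has_prim_union => //; [exact: cvx_tube|exact: cvx_tube|exact: opn_tube|exact: opn_tube].
  move=> y [w /andP[sw wu] yw]; have [wt|tw] := leP w t; [left|right]; exists w.
  - by rewrite sw.
  - by apply: (le_ball _ yw); rewrite lecR ge_min lexx.
  - by rewrite ltW.
  - by apply: (le_ball _ yw); rewrite lecR ge_min lexx orbT.
have d2 : 0 < (d / 2)%:C :> C by rewrite ltcR; lra.
have N : nbhs (x + s%:C *: (v - x)) (ball (x + s%:C *: (v - x)) (d / 2)%:C).
  exact: nbhsx_ballx.
have /nearR[k k0 kP] := near_real_line N.
exists k => // b c _ bc _ sb bk; exists (d / 2); first lra.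
apply: has_prim_sub pd => y [w /andP[bw wc] yw].
have -> : d%:C = (d / 2)%:C + (d / 2)%:C :> C by rewrite -rmorphD; congr (_%:C); lra.
by apply: ball_triangle yw; apply: kP; lra.
Qed.

Hypothesis a_neq0 : forall i, a i != 0.
Hypothesis a_indep : forall i j c, i != j -> a i != c *: a j.

(** Away from the hyperplanes spanned by [x0] and the intersections of two
    hyperplanes, the segment from [x0] meets the arrangement only at points of
    multiplicity one. *)
Lemma global_prim K : cvx K -> opn K ->
  (forall q, K q -> (forall i j, frm (a i) q = 0 -> frm (a j) q = 0 -> i = j) ->
     exists2 d, 0 < d & has_prim a e (ball q d%:C)) ->
  has_prim a e K.
Proof.
move=> cK oK loc.
have [[x0 [Kx0 ax0]]|nK] := pselect (exists x, K x /\ reg a x); last first.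
  by exists (fun=> 0) => x Kx; case: nK; exists x.
(* The combination of [a i] and [a j] that vanishes at [x0]. On the diagonal it would be zero, so
   [a i] is repeated there. *)
pose b (k : I + I * I) : 'cV[C]_r := match k with
  | inl i => a i
  | inr (i, j) => if i == j then a i else frm (a i) x0 *: a j - frm (a j) x0 *: a i
  end.
have b0 k : b k != 0.
  case: k => [i|[i j]] //=; case: (eqVneq i j) => // ij.
  rewrite subr_eq0; apply/negP => /eqP E.
  have := a_indep ((frm (a i) x0)^-1 * frm (a j) x0) (_ : j != i).
  rewrite eq_sym => /(_ ij)/eqP; apply.
  by rewrite -scalerA -E scalerA mulVf ?scale1r.
have regb x : reg b x -> reg a x by move=> bx i; exact: (bx (inl i)).
have seg v : K v -> reg b v -> exists2 d, 0 < d & has_prim a e (tube x0 v d 0 1).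
  move=> Kv bv; apply: tube_prim => s s01; apply: loc; first exact: cK.
  move=> i j; rewrite !frm_line !frmB => Ei Ej; apply: contrapT => /eqP ij.
  have := bv (inr (i, j)); rewrite /= (negPf ij) frmBl !frmZl.
  move: Ei Ej; set A := frm (a i) x0; set B := frm (a j) x0.
  set A' := frm (a i) v; set B' := frm (a j) v => Ei Ej nz.
  have [s0|s0] := eqVneq s 0.
    by have := ax0 i; rewrite -/A -Ei s0 mul0r addr0 eqxx.
  case/negP: nz; apply/eqP/(@mulfI _ s%:C).
    by rewrite -(rmorph0 (real_complex R)) (inj_eq (@complexI _)).
  have E1 : s%:C * A' = s%:C * A - A by move/eqP: Ei; rewrite addr_eq0 => /eqP {2}->; ring.
  have E2 : s%:C * B' = s%:C * B - B by move/eqP: Ej; rewrite addr_eq0 => /eqP {2}->; ring.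
  rewrite mulr0 mulrBr mulrCA (mulrCA _ B) E1 E2; ring.
have /choice[F FE] : forall v, exists Fd : (V -> M) * R, K v -> reg b v ->
    [/\ 0 < Fd.2, is_prim e (fun y => tube x0 v Fd.2 0 1 y /\ reg a y) Fd.1 &
        Fd.1 x0 = 0].
  move=> v; have [[Kv bv]|n] := pselect (K v /\ reg b v); last first.
    by exists (fun=> 0, 0) => Kv bv; case: n.
  have [d d0 [G pG]] := seg v Kv bv.
  exists (fun y => G y + (- G x0), d) => _ _; split => //; last by rewrite /= subrr.
  exact: prim_shift.
(* Integration along the segment from [x0]: [F v] consists of a primitive on a tube around the
   segment to [v], vanishing at [x0], and of the radius of the tube. *)
pose G v := (F v).1 v.
have pG : is_prim e (fun x => K x /\ reg b x) G.
  move=> v [Kv bv]; have [d0 pv Fv0] := FE v Kv bv.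
  have vt : tube x0 v (F v).2 0 1 v.
    exists 1; first by rewrite lexx ler01.
    by rewrite scale1r subrKC; apply: ballxx; rewrite ltcR.
  have x0t w : 0 < (F w).2 -> tube x0 w (F w).2 0 1 x0.
    exists 0; first by rewrite lexx ler01.
    by rewrite scale0r addr0; apply: ballxx; rewrite ltcR.
  have pN := pv v (conj vt (regb _ bv)); have bN := near_reg bv.
  have KN := oK v Kv; have tN := opn_tube vt.
  near=> w; have -> : e v w = (F v).1 w - (F v).1 v by near: w.
  congr (_ - _); have Kw : K w by near: w.
  have bw : reg b w by near: w.
  have [d0' pw Fw0] := FE w Kw bw.
  have wt : tube x0 w (F w).2 0 1 w.
    exists 1; first by rewrite lexx ler01.
    by rewrite scale1r subrKC; apply: ballxx; rewrite ltcR.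
  have tw : tube x0 v (F v).2 0 1 w by near: w.
  have := @prim_diff R r M e I a _ (F v).1 (F w).1 x0 w
    (cvxI (@cvx_tube x0 v (F v).2 0 1) (@cvx_tube x0 w (F w).2 0 1))
    (opnI (@opn_tube x0 v (F v).2 0 1) (@opn_tube x0 w (F w).2 0 1)).
  rewrite Fv0 Fw0 subrr => H; apply/esym/eqP; rewrite -subr_eq0 /G; apply/eqP/esym.
  apply: H => //; try by split=> //; exact: x0t.
  - by apply: prim_sub pv => y [[]].
  - by apply: prim_sub pw => y [[]].
  - exact: regb.
(* [G] is a primitive only off the auxiliary hyperplanes. The local primitives around points of
   [reg a], shifted to agree with [G], extend it across them. *)
have /choice[D DE] : forall v, exists D : (V -> M) * (R * M), K v -> reg a v ->
    [/\ 0 < D.2.1, is_prim e (fun y => ball v D.2.1%:C y /\ reg a y) D.1 &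
        forall w, ball v D.2.1%:C w -> K w -> reg b w -> G w = D.1 w + D.2.2].
  move=> v; have [[Kv av]|n] := pselect (K v /\ reg a v); last first.
    by exists (fun=> 0, (0, 0)) => Kv bv; case: n.
  have [||d d0 [D pD]] := loc v => // [i|].
    by move=> j iv; move: (av i); rewrite iv eqxx.
  have [c cE] : exists c, forall w, ball v d%:C w /\ K w -> reg b w -> G w = D w + c.
    apply: (@prim_match R r M e _ b).
    - by apply: cvxI => //; exact: cvx_ball.
    - by apply: opnI => //; exact: opn_ball.
    - by apply: prim_sub pG => w [[]].
    - by apply: prim_sub pD => w [[? _] /regb].
  by exists (D, (d, c)) => _ _; split=> //= w vw Kw; apply: cE.
exists (fun v => (D v).1 v + (D v).2.2) => v [Kv av].
have [d0 pv cv] := DE v Kv av.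
have vv : ball v (D v).2.1%:C v by apply: ballxx; rewrite ltcR.
have pN := pv v (conj vv av); have bN := near_reg av.
have KN := oK v Kv; have tN := opn_ball vv.
near=> w; have -> : e v w = (D v).1 w - (D v).1 v by near: w.
have Kw : K w by near: w.
have aw : reg a w by near: w.
have vw : ball v (D v).2.1%:C w by near: w.
have [d0' pw cw] := DE w Kw aw.
have ww : ball w (D w).2.1%:C w by apply: ballxx; rewrite ltcR.
pose L y := (ball v (D v).2.1%:C y /\ ball w (D w).2.1%:C y) /\ K y.
have oL : opn L by do 2?apply: opnI; [exact: opn_ball|exact: opn_ball|].
have cL : cvx L by do 2?apply: cvxI; [exact: cvx_ball|exact: cvx_ball|].
(* The shifts at [v] and [w] are compared at a common point where [G] is available. *)
have [y [[vy wy] Ky] yb] := reg_dense b0 oL (conj (conj vw ww) Kw).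
have H := @prim_diff R r M e I a L (D v).1 (D w).1 y w cL oL.
have -> : (D w).1 w + (D w).2.2 = (D v).1 w + (D v).2.2; last first.
  by rewrite opprD addrACA subrr addr0.
have := cv y vy Ky yb; rewrite (cw y wy Ky yb) => E.
suff : (D w).1 y - (D v).1 y = (D w).1 w - (D v).1 w.
  move=> E'; have : (D v).2.2 = (D w).1 w - (D v).1 w + (D w).2.2.
    by rewrite -E' addrAC E addrAC subrr add0r.
  by move=> ->; rewrite addrA subrKC.
apply: H => //; try exact: regb.
- by apply: prim_sub pv => u [[[]]].
- by apply: prim_sub pw => u [[[]]].
Unshelve. all: by end_near. Qed.
End GlobalPrimitive.

(** * Monodromy around the hyperplanes *)

Section Crossing.
Variables (R : realType) (M : zmodType).
Local Notation C := R[i].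
Implicit Types (z w c : C) (m : M).
Local Open Scope complex_scope.

Definition upper z : bool := 0 <= complex.Im z.

(** A locally exact cochain on [C^*] counting the crossings of the positive real
    axis: its class has monodromy [m] around the origin. *)
Definition cross m z w : M :=
  if 0 < complex.Re z then m *+ upper w - m *+ upper z else 0.

Lemma cross_Re_gt0 m z w : 0 < complex.Re z ->
  cross m z w = m *+ upper w - m *+ upper z.
Proof. by rewrite /cross => ->. Qed.

Lemma cross_Re_le0 m z w : complex.Re z <= 0 -> cross m z w = 0.
Proof. by rewrite /cross ltNge => ->. Qed.

Lemma cross_upper m z w : upper w = upper z -> cross m z w = 0.
Proof. by rewrite /cross => ->; rewrite subrr; case: ifP. Qed.

Lemma crossD m n z w : cross (m + n) z w = cross m z w + cross n z w.
Proof.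
by rewrite /cross; case: ifP => _; rewrite ?addr0 // !mulrnDl opprD addrACA.
Qed.

Lemma crossN m z w : cross (- m) z w = - cross m z w.
Proof.
by rewrite /cross; case: ifP => _; rewrite ?oppr0 // !mulNrn opprB opprK addrC.
Qed.

Lemma cross0 z w : cross 0 z w = 0.
Proof. by rewrite /cross !mul0rn subrr; case: ifP. Qed.

Lemma near_Re_gt0 z : 0 < complex.Re z -> \forall w \near z, 0 < complex.Re w.
Proof.
move=> z0; apply: (@Re_continuous R z (fun s : R => 0 < s)).
exact: lt_nbhsr.
Qed.

Lemma near_upper z : complex.Im z != 0 -> \forall w \near z, upper w = upper z.
Proof.
rewrite neq_lt /upper => /orP[z0|z0].
  have -> : (0 <= complex.Im z) = false by rewrite leNgt z0.
  near=> w; rewrite leNgt.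
  apply/negbTE/negPn; near: w.
  by apply: (@Im_continuous R z (fun s : R => s < 0)); exact: lt_nbhsl.
rewrite (ltW z0); near=> w; apply: ltW; near: w.
by apply: (@Im_continuous R z (fun s : R => 0 < s)); exact: lt_nbhsr.
Unshelve. all: by end_near. Qed.

Lemma near_cross0 m z : complex.Im z != 0 -> \forall w \near z, cross m z w = 0.
Proof. by move/near_upper; apply: filterS => w; exact: cross_upper. Qed.

(** Rotating the cut by [c] changes the cochain by the coboundary of the
    indicator of the sector swept. *)
Lemma cross_rotate m c z : 0 < complex.Im c -> z != 0 ->
  let F w := - (m *+ (~~ upper w && upper (c * w))) in
  \forall w \near z, cross m z w - cross m (c * z) (c * w) = F w - F z.
Proof.
move=> c0 z0 F.
have cc : continuous (fun w => c * w).
  by move=> w; apply: (@continuousM _ _ (fun=> c) id); [exact: cst_continuous | exact: cvg_id].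
have cE : complex.Re (c * z) = complex.Re c * complex.Re z - complex.Im c * complex.Im z /\
          complex.Im (c * z) = complex.Re c * complex.Im z + complex.Im c * complex.Re z.
  by case: (c) => ? ?; case: (z) => ? ?; rewrite /=; split; ring.
have [Iz|Iz] := eqVneq (complex.Im z) 0.
  have Rz : complex.Re z != 0.
    by apply: contraNneq z0 => Rz; move: Iz Rz; case: (z) => ? ? /= -> ->.
  have Icz : complex.Im (c * z) != 0.
    by case: cE => _ ->; rewrite Iz mulr0 add0r mulf_neq0 // gt_eqF.
  have uN := cc z _ (near_upper Icz).
  near=> w; have uw : upper (c * w) = upper (c * z) by near: w.
  have -> : cross m (c * z) (c * w) = 0 by apply: cross_upper.
  rewrite subr0 /F uw.
  have uz : upper z by rewrite /upper Iz.
  have uczE : upper (c * z) = (0 < complex.Re z).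
    case: cE => _ E; rewrite /upper E Iz mulr0 add0r pmulr_rge0 //.
    by rewrite le_eqVlt eq_sym (negPf Rz).
  rewrite uczE uz /= oppr0 subr0 /cross uz; case: ifP => _ //=.
    rewrite andbT; case: (upper w) => /=; first by rewrite subrr oppr0.
    by rewrite sub0r.
  by rewrite andbF oppr0.
have uN := near_upper Iz.
have [Icz|Icz] := eqVneq (complex.Im (c * z)) 0; last first.
  have ucN := cc z _ (near_upper Icz).
  near=> w; have uw : upper w = upper z by near: w.
  have ucw : upper (c * w) = upper (c * z) by near: w.
  by rewrite !cross_upper // /F uw ucw !subrr.
near=> w; have uw : upper w = upper z by near: w.
rewrite cross_upper // sub0r /F uw.
have ucz : upper (c * z) by rewrite /upper Icz.
case: cE; rewrite Icz => RE IE.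
have uzE : upper z = ~~ (0 < complex.Re (c * z)).
  have norm0 : 0 < complex.Re c ^+ 2 + complex.Im c ^+ 2.
    by rewrite ltr_wpDl ?sqr_ge0 // exprn_gt0.
  have Rz : complex.Im c * complex.Re (c * z) =
      - (complex.Re c ^+ 2 + complex.Im c ^+ 2) * complex.Im z.
    have E : complex.Im c * complex.Re z = - (complex.Re c * complex.Im z).
      by apply/eqP; rewrite -addr_eq0 addrC -IE.
    by rewrite RE mulrBr mulrCA E; ring.
  rewrite -leNgt /upper -[in RHS](pmulr_rle0 _ c0) Rz mulNr oppr_le0.
  by rewrite pmulr_rge0.
rewrite ucz andbT uzE negbK /cross; case: ifP => _ /=; rewrite ?subrr ?oppr0 //.
by rewrite ucz mulr1n opprB opprK addrC.
Unshelve. all: by end_near. Qed.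
End Crossing.

Section Monodromy.
Variables (R : realType) (r : nat) (M : zmodType).
Local Notation C := R[i].
Local Notation V := 'rV[C]_r.
Local Open Scope complex_scope.
Variables (I : finType) (a : I -> 'cV[C]_r).
Implicit Types (e : V -> V -> M) (x y v q : V) (z c : C) (s t d : R) (K : set V).
Implicit Types (b : 'cV[C]_r) (m n : M).

Lemma mulmx_continuous (g : 'M[C]_r) : continuous (fun x : V => x *m g).
Proof.
have -> : (fun x : V => x *m g) = fun x => \sum_i x 0 i *: row i g.
  by apply/funext => x; rewrite mulmx_sum_row.
apply: continuous_big => [|i _ x]; first exact: add_continuous.
apply: (@continuousZr_tmp _ _ _ (fun x : V => x 0 i)).
exact: (@coord_continuous C 1 r 0 i).
Qed.

Lemma near_mulmx (g : 'M[C]_r) q (P : V -> Prop) :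
  (\forall y \near q *m g, P y) -> \forall x \near q, P (x *m g).
Proof. exact: mulmx_continuous. Qed.

Lemma near_frm b q (P : C -> Prop) :
  (\forall y \near frm b q, P y) -> \forall x \near q, P (frm b x).
Proof. exact: frm_continuous. Qed.

Lemma near_ballx q d : 0 < d -> \forall y \near q, ball q d%:C y.
Proof. by move=> d0; apply: nbhsx_ballx; rewrite ltcR. Qed.

Lemma has_prim_coboundary e e' (G : V -> M) K :
  (forall x, K x -> reg a x -> \forall y \near x, e' x y = e x y + (G y - G x)) ->
  has_prim a e K -> has_prim a e' K.
Proof.
move=> eG [F pF]; exists (fun x => F x + G x) => x [Kx ax].
have pN := pF x (conj Kx ax); have eN := eG x Kx ax; near=> y.
have -> : e' x y = e x y + (G y - G x) by near: y.
have -> : e x y = F y - F x by near: y.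
by rewrite opprD addrACA.
Unshelve. all: by end_near. Qed.

Lemma has_prim_eq e e' K : (forall x y, e x y = e' x y) ->
  has_prim a e K -> has_prim a e' K.
Proof.
move=> ee'; apply: (@has_prim_coboundary _ _ (fun=> 0)) => x _ _.
by near=> y; rewrite subrr addr0 ee'.
Unshelve. all: by end_near. Qed.

Lemma has_primB e e' K : has_prim a e K -> has_prim a e' K ->
  has_prim a (fun x y => e x y - e' x y) K.
Proof.
move=> [F pF] [G pG]; exists (fun x => F x - G x) => x Kx.
have pN := pF x Kx; have qN := pG x Kx; near=> y.
have -> : e x y = F y - F x by near: y.
have -> : e' x y = G y - G x by near: y.
by rewrite !opprD addrACA.
Unshelve. all: by end_near. Qed.

(** [m] is the monodromy of [e] around [frm b = 0] near [q], measured by comparison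
    with [cross] rather than along a loop. *)
Definition mon e q b m : Prop :=
  exists2 d, 0 < d &
    has_prim a (fun x y => e x y - cross m (frm b x) (frm b y)) (ball q d%:C).

Lemma near_ball q (P : V -> Prop) : (\forall x \near q, P x) ->
  exists2 d, 0 < d & forall x, ball q d%:C x -> P x.
Proof.
by move=> /nbhs_ballP[d /complex_gt0[d0 ->] dP]; exists (complex.Re d).
Qed.

Lemma mon_near e q b m : mon e q b m -> \forall p \near q, mon e p b m.
Proof.
move=> [d d0 pd]; apply/nbhs_ballP; exists (d / 2)%:C; first by rewrite /= ltcR; lra.
move=> p qp; exists (d / 2); first lra.
apply: has_prim_sub pd => x px.
have -> : d%:C = (d / 2)%:C + (d / 2)%:C :> C by rewrite -rmorphD; congr (_%:C); lra.
exact: ball_triangle px.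
Qed.

Lemma ball_inter q d d' : 0 < d -> 0 < d' -> exists2 k, 0 < k &
  forall x, ball q k%:C x -> ball q d%:C x /\ ball q d'%:C x.
Proof.
move=> d0 d'0; exists (Num.min d d'); first by rewrite lt_min d0.
move=> x xd; split; apply: (le_ball _ xd); rewrite lecR ge_min lexx ?orbT //.
Qed.

Lemma monB e e' q b m n : mon e q b m -> mon e' q b n ->
  mon (fun x y => e x y - e' x y) q b (m - n).
Proof.
move=> [d d0 pd] [d' d'0 pd']; have [k k0 kd] := ball_inter q d0 d'0.
have {}pd := has_prim_sub (fun x xk => proj1 (kd x xk)) pd.
have {}pd' := has_prim_sub (fun x xk => proj2 (kd x xk)) pd'.
exists k; first exact: k0.
refine (@has_prim_eq _ _ _ _ (has_primB pd pd')) => x y.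
by rewrite crossD crossN !opprD !opprK addrACA.
Qed.

Lemma mon_eq e e' q b m : (forall x y, e x y = e' x y) -> mon e q b m -> mon e' q b m.
Proof.
by move=> ee' [d d0 pd]; exists d => //; apply: has_prim_eq pd => x y; rewrite ee'.
Qed.

Lemma mon_zero q b : mon (fun _ _ => 0) q b 0.
Proof.
exists 1 => //; exists (fun=> 0) => x _; near=> y.
by rewrite cross0 subrr.
Unshelve. all: by end_near. Qed.

Lemma monD e e' q b m n : mon e q b m -> mon e' q b n ->
  mon (fun x y => e x y + e' x y) q b (m + n).
Proof.
move=> em en; have := monB em (monB (mon_zero q b) en); rewrite sub0r opprK.
by apply: mon_eq => x y; rewrite sub0r opprK.
Qed.

Lemma mon_sum (J : Type) (s : seq J) (e : J -> V -> V -> M) q b (m : J -> M) :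
  (forall j, mon (e j) q b (m j)) ->
  mon (fun x y => \sum_(j <- s) e j x y) q b (\sum_(j <- s) m j).
Proof.
move=> em; elim: s => [|j s IH].
  by rewrite big_nil; apply: mon_eq (mon_zero q b) => x y; rewrite big_nil.
by rewrite big_cons; apply: mon_eq (monD (em j) IH) => x y; rewrite big_cons.
Qed.

Lemma mon_coboundary e e' (G : V -> M) q b m :
  (forall x, reg a x -> \forall y \near x, e' x y = e x y + (G y - G x)) ->
  mon e q b m -> mon e' q b m.
Proof.
move=> eG [d d0 pd]; exists d => //; apply: (has_prim_coboundary _ pd) => x _ ax.
by near=> y; rewrite addrAC; congr (_ - _); near: y; exact: eG.
Unshelve. all: by end_near. Qed.

Lemma mon0_has_prim e q b : mon e q b 0 -> exists2 d, 0 < d & has_prim a e (ball q d%:C).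
Proof.
move=> [d d0 pd]; exists d => //; apply: has_prim_eq pd => x y.
by rewrite cross0 subr0.
Qed.

Lemma mon_comp (g : 'M[C]_r) e q b m : (forall x, reg a x -> reg a (x *m g)) ->
  mon e (q *m g) b m -> mon (fun x y => e (x *m g) (y *m g)) q (g *m b) m.
Proof.
move=> ag [d d0 [F pF]].
have [k k0 kP] := near_ball (near_mulmx (near_ballx (q *m g) d0)).
exists k => //; exists (fun x => F (x *m g)) => x [xk ax].
have E v : frm (g *m b) v = frm b (v *m g) by rewrite /frm mulmxA.
have := near_mulmx (pF (x *m g) (conj (kP x xk) (ag x ax))).
by apply: filterS => y /=; rewrite !E.
Qed.

Lemma mon_rotate c e q b m : 0 < complex.Im c -> (forall x, reg a x -> frm b x != 0) ->
  mon e q b m <-> mon e q (c *: b) m.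
Proof.
move=> c0 b0; pose F w := - (m *+ (~~ upper w && upper (c * w))).
have near_frm x : reg a x -> \forall y \near x,
    cross m (frm b x) (frm b y) - cross m (c * frm b x) (c * frm b y) =
    F (frm b y) - F (frm b x).
  by move=> ax; exact: (near_frm (cross_rotate m c0 (b0 x ax))).
split=> -[d d0 pd]; exists d => //.
  apply: (@has_prim_coboundary _ _ (fun x => F (frm b x)) _ _ pd) => x _ ax.
  have N := near_frm x ax; near=> y.
  have <- : cross m (frm b x) (frm b y) - cross m (c * frm b x) (c * frm b y) =
    F (frm b y) - F (frm b x) by near: y.
  by rewrite !frmZl addrA subrK.
apply: (@has_prim_coboundary _ _ (fun x => - F (frm b x)) _ _ pd) => x _ ax.
have N := near_frm x ax; near=> y.
rewrite -opprD.
have <- : cross m (frm b x) (frm b y) - cross m (c * frm b x) (c * frm b y) =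
  F (frm b y) - F (frm b x) by near: y.
by rewrite !frmZl opprB addrA subrK.
Unshelve. all: by end_near. Qed.

(** The monodromy belongs to the hyperplane and not to the chosen form. Rotation settles [Im c > 0];
    for [Im c < 0] it is applied to the inverse, and a real [c] is ['i] times the non-real
    [c * - 'i]. *)
Lemma mon_scale c e q b m : c != 0 -> (forall x, reg a x -> frm b x != 0) ->
  mon e q b m -> mon e q (c *: b) m.
Proof.
move=> c0 b0 em.
have ImN0 k : complex.Im k != 0 -> mon e q (k *: b) m.
  move=> k0; have k_neq0 : k != 0 by apply: contraNneq k0 => ->.
  move: k0; rewrite neq_lt => /orP[k0|k0]; last first.
    by have [H _] := @mon_rotate k e q b m k0 b0; exact: H.
  have k'0 : 0 < complex.Im k^-1.
    case: (k) k0 => x y /= y0; rewrite oppr_gt0 pmulr_llt0 // invr_gt0.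
    by rewrite ltr_wpDl ?sqr_ge0 // exprn_even_gt0 //= lt_eqF.
  have [|_ H] := @mon_rotate k^-1 e q (k *: b) m k'0.
    by move=> x ax; rewrite frmZl mulf_neq0 ?b0.
  by apply: H; rewrite scalerA mulVf // scale1r.
have [Ic|/ImN0//] := eqVneq (complex.Im c) 0.
have -> : c *: b = 'i *: ((c * - 'i) *: b).
  by rewrite scalerA mulrCA mulrN -expr2 sqr_i opprK mulr1.
have i1 : 0 < complex.Im ('i : C) by rewrite /=.
have ci : complex.Im (c * - 'i) != 0.
  case: (c) c0 Ic => x y + /= y0; rewrite y0 eq_complex /= eqxx andbT => x0.
  by rewrite mul0r addr0 mulrN1 oppr_eq0.
have [|H _] := @mon_rotate 'i e q ((c * - 'i) *: b) m i1; last exact/H/ImN0.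
move=> x ax; rewrite frmZl mulf_neq0 ?b0 //.
by apply: contraNneq ci => ->.
Qed.

Lemma mon_cross q b n : mon (fun x y => cross n (frm b x) (frm b y)) q b n.
Proof.
exists 1 => //; exists (fun=> 0) => x _.
by near=> y; rewrite !subrr.
Unshelve. all: by end_near. Qed.

(** Near [q] the values of [b'] stay in the upper, lower, left or right half-plane. On the first
    three [cross] is locally zero, and on the last it is the coboundary of [upper]. *)
Lemma mon_cross_other q b b' n : frm b' q != 0 ->
  mon (fun x y => cross n (frm b' x) (frm b' y)) q b 0.
Proof.
move=> q0.
suff [d d0 [F pF]] : exists2 d, 0 < d &
    has_prim a (fun x y => cross n (frm b' x) (frm b' y)) (ball q d%:C).
  exists d => //; exists F => x /pF; apply: filterS => y.
  by rewrite cross0 subr0.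
have [Iq|Iq] := eqVneq (complex.Im (frm b' q)) 0; last first.
  have [d d0 dP] := near_ball (near_frm (near_upper Iq)).
  exists d => //; exists (fun=> 0) => x [qx _]; near=> y.
  have xy : ball q d%:C y by near: y; exact: opn_ball.
  by rewrite subrr cross_upper // dP // dP.
have : complex.Re (frm b' q) != 0.
  by apply: contraNneq q0; move: Iq; case: (frm b' q) => ? ? /= -> ->.
rewrite neq_lt => /orP[Rq|Rq].
  have Rq' : 0 < complex.Re (- frm b' q) by rewrite raddfN oppr_gt0.
  have E x : - frm b' x = frm (- b') x by rewrite -[- b' in RHS]scaleN1r frmZl mulN1r.
  rewrite E in Rq'; have [d d0 dP] := near_ball (near_frm (near_Re_gt0 Rq')).
  exists d => //; exists (fun=> 0) => x [qx _]; near=> y.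
  rewrite subrr cross_Re_le0 //; move: (dP x qx) => /=.
  by rewrite -E raddfN oppr_gt0; exact: ltW.
have [d d0 dP] := near_ball (near_frm (near_Re_gt0 Rq)).
exists d => //; exists (fun x => n *+ upper (frm b' x)) => x [qx _]; near=> y.
by rewrite cross_Re_gt0 //; exact: dP.
Unshelve. all: by end_near. Qed.
End Monodromy.

(** * Existence, uniqueness and constancy of the monodromy *)

Section MonodromyTheory.
Variables (R : realType) (r : nat) (M : zmodType).
Local Notation C := R[i].
Local Notation V := 'rV[C]_r.
Local Open Scope complex_scope.
Variables (I : finType) (a : I -> 'cV[C]_r).
Implicit Types (e : V -> V -> M) (x y v q : V) (z c : C) (s t d : R) (K : set V).
Implicit Types (b : 'cV[C]_r) (m n : M).
Hypothesis a_neq0 : forall i, a i != 0.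
Hypothesis a_indep : forall i j c, i != j -> a i != c *: a j.

Definition simple_point i q : Prop :=
  frm (a i) q = 0 /\ forall j, j != i -> frm (a j) q != 0.

(** For [c] equal to [1], [- 'i], [-1] and ['i], the values of [b] lie in the right, upper, left and
    lower half-plane. *)
Definition halfspace b c : set V := fun x => 0 < complex.Re (c * frm b x).

Lemma cvx_halfspace b c : cvx (halfspace b c).
Proof.
move=> x y s; rewrite /halfspace => x0 y0 /andP[s0 s1].
have -> : complex.Re (c * frm b (x + s%:C *: (y - x))) =
    (1 - s) * complex.Re (c * frm b x) + s * complex.Re (c * frm b y).
  rewrite frm_line frmB; case: (c) (frm b x) (frm b y) => c1 c2 [x1 x2] [y1 y2].
  by rewrite /=; ring.
have [->|s1'] := eqVneq s 1; first by rewrite subrr mul0r add0r mul1r.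
have : s < 1 by rewrite lt_neqAle s1'.
nra.
Qed.

Lemma opn_halfspace b c : opn (halfspace b c).
Proof.
move=> x; rewrite /halfspace -frmZl => x0.
have := near_frm (near_Re_gt0 x0); apply: filterS => y; by rewrite frmZl.
Qed.

Lemma simple_ball i q : simple_point i q -> exists2 d, 0 < d &
  forall x, ball q d%:C x -> forall j, j != i -> frm (a j) x != 0.
Proof.
move=> [_ q0]; apply: near_ball.
pose J := {j | j != i}.
have : reg (fun j : J => a (val j)) q by move=> j; apply: q0; exact: (valP j).
by move/near_reg; apply: filterS => x ax j ji; exact: (ax (exist _ j ji)).
Qed.

Definition loc_prim e : Prop :=
  forall x, reg a x -> exists2 d, 0 < d & has_prim a e (ball x d%:C).

Lemma near_line x v z (P : V -> Prop) :
  nbhs (x + z *: v) P -> \forall w \near z, P (x + w *: v).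
Proof. exact: line_continuous. Qed.

Lemma subr_swap (a1 a2 b1 b2 : M) : a1 - a2 = b1 - b2 -> b1 - a1 = b2 - a2.
Proof.
move=> E; have -> : b1 = a1 - a2 + b2 by rewrite E subrK.
by rewrite addrAC [a1 - a2]addrC addrK addrC.
Qed.

Lemma norm_le2 (x y : R) : `|x| <= 1 -> `|y| <= 1 -> `|x +i* y| <= 2 :> C.
Proof.
move=> x1 y1; rewrite [x +i* y]complexE (le_trans (ler_normD _ _)) // normrM.
have -> : `|'i%C| = 1 :> C by rewrite normc_def /= expr0n add0r expr1n sqrtr1.
by rewrite mul1r !normC_real (_ : 2 = 1 + 1) // lerD // lecR.
Qed.

Lemma near_corners i q d : simple_point i q -> 0 < d -> exists p : C -> V,
  forall c, `|c| <= 2 ->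
    ball q d%:C (p c) /\ exists2 t, 0 < t & frm (a i) (p c) = t%:C * c.
Proof.
move=> [q0 _] d0; have [u0 u00] := form_neq0 (a_neq0 i).
pose u := (frm (a i) u0)^-1 *: u0.
have u1 : frm (a i) u = 1 by rewrite frmZ mulVf.
have N : nbhs (q + 0 *: u) (fun x => ball q d%:C x).
  by rewrite scale0r addr0; exact: near_ballx.
have /nbhs_ballP[k /complex_gt0[k0 ->] kP] := near_line N.
(* The factor 1/3 leaves room for [|c| <= 2], a bound satisfied by the corners [1 + i], [-1 + i],
   [-1 - i] and [1 - i]. *)
exists (fun c => q + ((complex.Re k / 3)%:C * c) *: u) => c c2; split; last first.
  by exists (complex.Re k / 3); [lra | rewrite frm_line u1 q0 add0r mulr1].
apply: kP; rewrite /ball /= sub0r normrN normrM normC_real (@ger0_norm R); last by lra.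
apply: (@le_lt_trans _ _ ((complex.Re k / 3)%:C * 2)).
  by rewrite ler_wpM2l // ler0c; lra.
by rewrite -(rmorph_nat (real_complex R)) -rmorphM ltcR; lra.
Qed.

(** The two comparisons give a primitive [G] of [cross (m - n)] near [q]. In a turn around the
    hyperplane through four corners, [G] is constant over the upper, left and lower halves and
    changes by [m - n] over the right one, so [m - n] is zero. *)
Lemma mon_unique e i q m n : simple_point i q ->
  mon a e q (a i) m -> mon a e q (a i) n -> m = n.
Proof.
move=> qi [d d0 pd] [d' d'0 pd'].
have [k k0 kP] := simple_ball qi.
have [l l0 lP] := ball_inter q d0 d'0; have [h h0 hP] := ball_inter q k0 l0.
have {lP}hd x (xh : ball q h%:C x) := lP x (hP x xh).2.
have {kP}hk x (xh : ball q h%:C x) := kP x (hP x xh).1.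
have {}pd := has_prim_sub (fun x xh => (hd x xh).1) pd.
have {}pd' := has_prim_sub (fun x xh => (hd x xh).2) pd'.
have [G pG] : has_prim a (fun x y => cross (m - n) (frm (a i) x) (frm (a i) y)) (ball q h%:C).
  refine (@has_prim_eq _ _ _ _ _ _ _ _ _ (has_primB pd' pd)) => x y.
  by rewrite crossD crossN opprB addrC addrA subrK.
have [p pP] := near_corners qi h0.
have hreg x : ball q h%:C x -> frm (a i) x != 0 -> reg a x.
  by move=> xh x0 j; have [->|] := eqVneq j i => // /(hk x xh).
have half c x y : c \in [:: - 'i; -1; 'i] ->
    ball q h%:C x -> ball q h%:C y -> halfspace (a i) c x -> halfspace (a i) c y ->
    G x = G y.
  move=> cs xh yh xc yc.
  have hc v : halfspace (a i) c v -> frm (a i) v != 0.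
    by rewrite /halfspace; apply: contraTneq => ->; rewrite mulr0 ltxx.
  apply: (@reg_constant R r I a (fun v => ball q h%:C v /\ halfspace (a i) c v) M G x y).
  - by apply: cvxI; [exact: cvx_ball | exact: cvx_halfspace].
  - by apply: opnI; [exact: opn_ball | exact: opn_halfspace].
  - move=> v [vh vc] av; have pN := pG v (conj vh av).
    have /near_frm cN : \forall w \near frm (a i) v, cross (m - n) (frm (a i) v) w = 0.
      move: cs vc; rewrite /halfspace; case: (frm (a i) v) => v1 v2.
      rewrite !inE => /or3P[]/eqP ->; rewrite /= => vc.
      - by apply: near_cross0; rewrite /= gt_eqF //; move: vc; lra.
      - by near=> w; apply: cross_Re_le0 => /=; move: vc; lra.
      - by apply: near_cross0; rewrite /= lt_eqF //; move: vc; lra.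
    near=> w; apply/eqP; rewrite -subr_eq0; apply/eqP.
    have <- : cross (m - n) (frm (a i) v) (frm (a i) w) = G w - G v by near: w.
    by near: w.
  - by [].
  - by [].
  - exact/hreg/hc.
  - exact/hreg/hc.
have right x y : ball q h%:C x -> ball q h%:C y ->
    halfspace (a i) 1 x -> halfspace (a i) 1 y ->
    G x - (m - n) *+ upper (frm (a i) x) = G y - (m - n) *+ upper (frm (a i) y).
  move=> xh yh xc yc.
  have hc v : halfspace (a i) 1 v -> frm (a i) v != 0.
    by rewrite /halfspace; apply: contraTneq => ->; rewrite mulr0 ltxx.
  apply: (@reg_constant R r I a (fun v => ball q h%:C v /\ halfspace (a i) 1 v) M
    (fun v => G v - (m - n) *+ upper (frm (a i) v)) x y).
  - by apply: cvxI; [exact: cvx_ball | exact: cvx_halfspace].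
  - by apply: opnI; [exact: opn_ball | exact: opn_halfspace].
  - move=> v [vh vc] av; have pN := pG v (conj vh av).
    near=> w.
    have : cross (m - n) (frm (a i) v) (frm (a i) w) = G w - G v by near: w.
    by move: vc; rewrite /halfspace mul1r => /cross_Re_gt0 ->; exact: subr_swap.
  - by [].
  - by [].
  - exact/hreg/hc.
  - exact/hreg/hc.
have n1 : `|1| <= 1 :> R by rewrite normr1.
have n2 : `|-1| <= 1 :> R by rewrite normrN1.
have [h1 [t1 t10 f1]] := pP _ (norm_le2 n1 n1).
have [h2 [t2 t20 f2]] := pP _ (norm_le2 n2 n1).
have [h3 [t3 t30 f3]] := pP _ (norm_le2 n2 n2).
have [h4 [t4 t40 f4]] := pP _ (norm_le2 n1 n2).
have := right _ _ h1 h4; rewrite (half (- 'i) _ _ _ h1 h2) ?inE ?eqxx //; last 2 first.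
- by rewrite /halfspace f1 /=; lra.
- by rewrite /halfspace f2 /=; lra.
rewrite (half (-1) _ _ _ h2 h3) ?inE ?eqxx ?orbT //; last 2 first.
- by rewrite /halfspace f2 /=; lra.
- by rewrite /halfspace f3 /=; lra.
rewrite (half 'i _ _ _ h3 h4) ?inE ?eqxx ?orbT //; last 2 first.
- by rewrite /halfspace f3 /=; lra.
- by rewrite /halfspace f4 /=; lra.
have -> : upper (frm (a i) (p (1 +i* 1))) by rewrite f1 /upper /=; lra.
have -> : upper (frm (a i) (p (1 +i* (-1)))) = false.
  by rewrite f4 /upper /=; apply/negbTE; rewrite -ltNge; lra.
rewrite mulr1n mulr0n subr0 /halfspace f1 f4 => H; apply/eqP.
rewrite -subr_eq0 -oppr_eq0 -(inj_eq (addrI (G (p (1 +i* (-1)))))) addr0.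
by apply/eqP/H; rewrite /=; lra.
Unshelve. all: by end_near. Qed.

(** Over each of four half-planes [e] has a primitive. The left one is shifted to match the upper,
    the lower to match the left and the right to match the upper; the gap left between the lower and
    the right one is [m]. *)
Lemma mon_exists e i q : loc_prim e -> simple_point i q -> exists m, mon a e q (a i) m.
Proof.
move=> le qi; have [d d0 dP] := simple_ball qi.
pose K c : set V := fun x => ball q d%:C x /\ halfspace (a i) c x.
have cK c : cvx (K c) by apply: cvxI; [exact: cvx_ball | exact: cvx_halfspace].
have oK c : opn (K c) by apply: opnI; [exact: opn_ball | exact: opn_halfspace].
have pK c : has_prim a e (K c).
  apply: global_prim => // x [xq xc] _; apply: le => j.
  have [->|ji] := eqVneq j i; last exact: dP ji.
  by move: xc; rewrite /halfspace; apply: contraTneq => ->; rewrite mulr0 ltxx.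
have KI c c' x : K c x -> K c' x -> K c x /\ K c' x by [].
have cKI c c' : cvx (fun x => K c x /\ K c' x) by exact: cvxI.
have oKI c c' : opn (fun x => K c x /\ K c' x) by exact: opnI.
have [Fu pu] := pK (- 'i); have [Fl0 pl0] := pK (-1).
have [Fd0 pd0] := pK 'i; have [Fr0 pr0] := pK 1.
have p1 c c' F : is_prim e (fun x => K c x /\ reg a x) F ->
    is_prim e (fun x => (K c x /\ K c' x) /\ reg a x) F.
  by move=> pF; apply: prim_sub pF => x [[]].
have p2 c c' F : is_prim e (fun x => K c x /\ reg a x) F ->
    is_prim e (fun x => (K c' x /\ K c x) /\ reg a x) F.
  by move=> pF; apply: prim_sub pF => x [[]].
have [c1 ul] := prim_match (cKI _ _) (oKI _ _) (p1 _ (-1) _ pu) (p2 _ (- 'i) _ pl0).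
have pl := prim_shift c1 pl0.
have [c2 ld] := prim_match (cKI _ _) (oKI _ _) (p1 _ 'i _ pl) (p2 _ (-1) _ pd0).
have pd := prim_shift c2 pd0.
have [c3 ur] := prim_match (cKI _ _) (oKI _ _) (p1 _ 1 _ pu) (p2 _ (- 'i) _ pr0).
have pr := prim_shift c3 pr0.
have [m dr] := prim_match (cKI _ _) (oKI _ _) (p1 _ 1 _ pd) (p2 _ 'i _ pr).
move: pl pd pr ul ld ur dr {p1 p2 pl0 pd0 pr0}.
set Fl := fun x => Fl0 x + c1; set Fd := fun x => Fd0 x + c2.
set Fr := fun x => Fr0 x + c3 => pl pd pr ul ld ur dr.
have Ku x : ball q d%:C x -> 0 < complex.Im (frm (a i) x) -> K (- 'i) x.
  by move=> xq x0; split=> //; move: x0; rewrite /halfspace; case: (frm _ _) => ? ? /=; lra.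
have Kd x : ball q d%:C x -> complex.Im (frm (a i) x) < 0 -> K 'i x.
  by move=> xq x0; split=> //; move: x0; rewrite /halfspace; case: (frm _ _) => ? ? /=; lra.
have Kl x : ball q d%:C x -> complex.Re (frm (a i) x) < 0 -> K (-1) x.
  by move=> xq x0; split=> //; move: x0; rewrite /halfspace; case: (frm _ _) => ? ? /=; lra.
have Kr x : ball q d%:C x -> 0 < complex.Re (frm (a i) x) -> K 1 x.
  by move=> xq x0; split=> //; rewrite /halfspace mul1r.
(* On the positive real axis the value is [Fr], which agrees with the upper half, in accordance with
   the convention of [upper]. *)
pose F x := if 0 < complex.Im (frm (a i) x) then Fu x
  else if complex.Im (frm (a i) x) < 0 then Fd x
  else if complex.Re (frm (a i) x) < 0 then Fl x else Fr x.
have FFu x : 0 < complex.Im (frm (a i) x) -> F x = Fu x by rewrite /F => ->.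
have FFd x : complex.Im (frm (a i) x) < 0 -> F x = Fd x.
  by move=> x0; rewrite /F ltNge (ltW x0) /= x0.
have FFl x : ball q d%:C x -> reg a x -> complex.Re (frm (a i) x) < 0 -> F x = Fl x.
  move=> xq ax x0; rewrite /F x0; case: ifP => [x1|_].
    by apply: ul => //; split; [exact: Ku | exact: Kl].
  by case: ifP => [x1|//]; apply/esym/ld => //; split; [exact: Kl | exact: Kd].
have FFr x : ball q d%:C x -> reg a x -> 0 < complex.Re (frm (a i) x) ->
    F x = Fr x + m - m *+ upper (frm (a i) x).
  move=> xq ax x0; rewrite /F /upper [complex.Re _ < 0]ltNge (ltW x0) /=.
  case: ltgtP => x1; rewrite ?mulr1n ?mulr0n ?subr0 ?addrK //.
    by apply: ur => //; split; [exact: Ku | exact: Kr].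
  by apply: dr => //; split; [exact: Kd | exact: Kr].
exists m, d => //; exists F => x [xq ax].
have qN := opn_ball xq; have aN := near_reg ax.
have swapN (N : \forall y \near x, e x y = F y - F x) :
    (\forall y \near x, cross m (frm (a i) x) (frm (a i) y) = 0) ->
    \forall y \near x, e x y - cross m (frm (a i) x) (frm (a i) y) = F y - F x.
  move=> cN; near=> y.
  have -> : cross m (frm (a i) x) (frm (a i) y) = 0 by near: y.
  by rewrite subr0; near: y.
have [x1|x1|x1] := ltgtP (complex.Im (frm (a i) x)) 0.
- apply: swapN; last by apply: (near_frm (near_cross0 m _)); rewrite lt_eqF.
  have pN := pd x (conj (Kd x xq x1) ax).
  have x1' : halfspace (a i) 'i x by case: (Kd x xq x1).
  have hN := opn_halfspace x1'.
  near=> y; have -> : e x y = Fd y - Fd x by near: y.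
  rewrite !FFd //; have : halfspace (a i) 'i y by near: y.
  by rewrite /halfspace; case: (frm _ _) => ? ? /=; lra.
- apply: swapN; last by apply: (near_frm (near_cross0 m _)); rewrite gt_eqF.
  have pN := pu x (conj (Ku x xq x1) ax).
  have x1' : halfspace (a i) (- 'i) x by case: (Ku x xq x1).
  have hN := opn_halfspace x1'.
  near=> y; have -> : e x y = Fu y - Fu x by near: y.
  rewrite !FFu //; have : halfspace (a i) (- 'i) y by near: y.
  by rewrite /halfspace; case: (frm _ _) => ? ? /=; lra.
have : complex.Re (frm (a i) x) != 0.
  by have := ax i; apply: contraNneq; move: x1; case: (frm _ _) => ? ? /= -> ->.
rewrite neq_lt => /orP[x2|x2].
  apply: swapN; last by near=> y; rewrite cross_Re_le0 // ltW.
  have pN := pl x (conj (Kl x xq x2) ax).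
  have x1' : halfspace (a i) (-1) x by case: (Kl x xq x2).
  have hN := opn_halfspace x1'.
  near=> y; have -> : e x y = Fl y - Fl x by near: y.
  have yq : ball q d%:C y by near: y.
  have ay : reg a y by near: y.
  rewrite !FFl //; have : halfspace (a i) (-1) y by near: y.
  by rewrite /halfspace; case: (frm _ _) => ? ? /=; lra.
have pN := pr x (conj (Kr x xq x2) ax).
have x1' : halfspace (a i) 1 x by case: (Kr x xq x2).
have hN := opn_halfspace x1'.
near=> y; have -> : e x y = Fr y - Fr x by near: y.
have yq : ball q d%:C y by near: y.
have ay : reg a y by near: y.
have y1 : halfspace (a i) 1 y by near: y.
rewrite !FFr //; last by move: y1; rewrite /halfspace mul1r.
rewrite cross_Re_gt0 //; set my := m *+ _; set mx := m *+ _.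
rewrite [Fr y + m - _]addrAC [Fr x + m - _]addrAC (opprD _ m) addrACA subrr addr0.
by rewrite !opprB addrACA [RHS]addrACA [- Fr x - my]addrC.
Unshelve. all: by end_near. Qed.

(** The complex line through [q] and [q'] lies in the hyperplane [i] and meets the others in
    finitely many points. Elsewhere on it, a monodromy at one point is one at all nearby points, and
    uniqueness makes the statement locally constant. *)
Lemma mon_constant e i q q' m : loc_prim e -> simple_point i q -> simple_point i q' ->
  mon a e q (a i) m -> mon a e q' (a i) m.
Proof.
move=> le [q0 qj] [q'0 q'j].
pose J := {j | j != i}; pose b (j : J) := a (val j).
have bq : reg b q by move=> j; apply: qj; exact: (valP j).
have bq' : reg b q' by move=> j; apply: q'j; exact: (valP j).
suff -> : mon a e q (a i) m = mon a e q' (a i) m by [].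
apply: (@line_constant R r J b (fun=> True) Prop (fun x => mon a e x (a i) m)) => //.
- by move=> x _; exact: filterE.
move=> z _ bz.
have sz w : reg b (q + w *: (q' - q)) -> simple_point i (q + w *: (q' - q)).
  move=> bw; split; first by rewrite frm_line frmB q0 q'0 subrr mulr0 addr0.
  by move=> j ji; exact: (bw (exist _ j ji)).
have [n en] := mon_exists le (sz z bz).
have eN := near_line (mon_near en); have bN := near_line (near_reg bz).
near=> w.
have bw : reg b (q + w *: (q' - q)) by near: w.
have ew : mon a e (q + w *: (q' - q)) (a i) n by near: w.
apply/propext; split=> H.
- by rewrite (mon_unique (sz w bw) H ew).
- by rewrite (mon_unique (sz z bz) H en).
Unshelve. all: by end_near. Qed.
End MonodromyTheory.

(** * The covering of the orbit space *)

Section FreeQuotient.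
Variables (R : realType) (E Q : topologicalType) (gT : finGroupType).
Variables (act : gT -> E -> E) (q : E -> Q).
Hypothesis act1 : forall x, act 1%g x = x.
Hypothesis actM : forall v w x, act (v * w)%g x = act v (act w x).
Hypothesis act_continuous : forall w, continuous (act w).
Hypothesis act_free : forall w x, act w x = x -> w = 1%g.
Hypothesis E_hausdorff : hausdorff_space E.
Hypothesis q_continuous : continuous q.
Hypothesis qP : forall x y, q x = q y <-> exists w, y = act w x.
Hypothesis q_surj : forall z, exists x, q x = z.

Lemma q_act w x : q (act w x) = q x.
Proof. by apply/esym/qP; exists w. Qed.

Lemma near_disjoint (x y : E) : x <> y ->
  exists A B : set E, [/\ nbhs x A, nbhs y B & forall z, A z -> B z -> False].
Proof.
move=> xy; apply: contrapT => N; apply: xy; apply: E_hausdorff => A B xA yB.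
apply: contrapT => AB; apply: N; exists A, B; split=> // z Az Bz.
by apply: AB; exists z.
Qed.

(** An evenly covered neighbourhood. Each [w != 1] moves [x], hence some neighbourhood of [x] off
    itself, and the group is finite. *)
Lemma near_sheet (x : E) : exists2 B : set E, nbhs x B &
  (forall y, B y -> nbhs y B) /\ forall y w, B y -> B (act w y) -> w = 1%g.
Proof.
have /choice[A AE] : forall w, exists A : set E * set E, w != 1%g ->
    [/\ nbhs x A.1, nbhs (act w x) A.2 & forall z, A.1 z -> A.2 z -> False].
  move=> w; have [->|/eqP w1] := eqVneq w 1%g; first by exists (setT, setT).
  have [|A [B [xA xB AB]]] := @near_disjoint x (act w x).
    by move=> /esym/act_free.
  by exists (A, B).
pose N : set E := fun y => forall w, w != 1%g -> (A w).1 y /\ (A w).2 (act w y).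
have xN : nbhs x N.
  apply: (@filter_forall _ _ (fun w y => w != 1%g -> (A w).1 y /\ (A w).2 (act w y)) (nbhs x)).
  move=> w; have [w1|w1] := boolP (w == 1%g); first by near=> y.
  have [xA /(act_continuous (w := w)) xB _] := AE w w1.
  by near=> y => _; split; near: y.
exists (interior N); first exact: nbhs_interior.
split=> [y /= Ny|y w /= /nbhs_singleton Ny /nbhs_singleton Nwy].
  exact: nbhs_interior.
apply/eqP; apply: contrapT => /negP w1; have [_ _] := AE w w1.
by move/(_ (act w y)); apply; [case: (Nwy w w1) | case: (Ny w w1)].
Unshelve. all: by end_near. Qed.

Hypothesis q_open : forall (x : E) (O : set E), nbhs x O ->
  \forall z \near q x, exists2 y, O y & q y = z.

(** Agreement is open because a sheet contains one lift, disagreement because [E] is separated. As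
    an equality of propositions, this says that agreement is locally constant, so that
    [locally_constant01] applies with values in [Prop]. *)
Lemma lifts_agree (T : topologicalType) (g g' : T -> E) (t : T) :
  {for t, continuous g} -> {for t, continuous g'} ->
  (\forall s \near t, q (g s) = q (g' s)) ->
  \forall s \near t, (g s = g' s) = (g t = g' t).
Proof.
move=> cg cg' qg; have [e|ne] := pselect (g t = g' t).
  have [B xB [_ Binj]] := near_sheet (g t).
  have gN := cg _ xB; have gN' : \forall s \near t, B (g' s).
    by apply: (cg' B); rewrite -e.
  near=> s; apply/propext; split=> // _.
  have : q (g s) = q (g' s) by near: s.
  move=> /qP[w E']; rewrite E'; suff -> : w = 1%g by rewrite act1.
  by apply: (Binj (g s)); rewrite -?E'; near: s.
have [A [B [xA xB AB]]] := near_disjoint ne.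
have gN := cg _ xA; have gN' := cg' _ xB.
near=> s; apply/propext; split=> // es; exfalso; apply: (AB (g s)).
  by near: s.
by rewrite es; near: s.
Unshelve. all: by end_near. Qed.

Lemma lift_unique (u v : R -> E) : continuous u -> continuous v ->
  (forall s, q (u s) = q (v s)) -> u 0 = v 0 -> u 1 = v 1.
Proof.
move=> cu cv quv; suff -> : (u 0 = v 0) = (u 1 = v 1) by [].
apply: (@locally_constant01 R Prop (fun s => u s = v s)) => s _.
by apply: (@lifts_agree R u v s (cu s) (cv s)); near=> t; exact: quv.
Unshelve. all: by end_near. Qed.

Section Square.
Variable h : R * R -> Q.
Hypothesis h_continuous : continuous h.

Definition lift_on (S : set (R * R)) (g : R * R -> E) : Prop :=
  forall p, S p -> q (g p) = h p /\ {for p, continuous g}.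

Definition rect (a b c d : R) : set (R * R) :=
  fun p => (a < p.1 < b) /\ (c < p.2 < d).

Lemma near_rect a b c d p : rect a b c d p -> \forall s \near p, rect a b c d s.
Proof.
move=> [/andP[ap pb] /andP[cp pd]].
have c1 : {for p, continuous (fst : R * R -> R)} by exact: cvg_fst.
have c2 : {for p, continuous (snd : R * R -> R)} by exact: cvg_snd.
have n1 := c1 _ (lt_nbhsr ap); have n2 := c1 _ (lt_nbhsl pb).
have n3 := c2 _ (lt_nbhsr cp); have n4 := c2 _ (lt_nbhsl pd).
by near=> s; split; apply/andP; split; near: s.
Unshelve. all: by end_near. Qed.

Lemma rect_unique a b c d g g' p p' : lift_on (rect a b c d) g ->
  lift_on (rect a b c d) g' -> rect a b c d p -> rect a b c d p' ->
  g p = g' p -> g p' = g' p'.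
Proof.
move=> lg lg' [/andP[ap1 pb1] /andP[cp2 pd2]] [/andP[ap1' pb1'] /andP[cp2' pd2']].
pose f (s : R) : R * R := (p.1 + s * (p'.1 - p.1), p.2 + s * (p'.2 - p.2)).
have f0 : f 0 = p by rewrite /f !mul0r !addr0; case: (p).
have f1 : f 1 = p' by rewrite /f !mul1r !subrKC; case: (p').
suff -> : (g p = g' p) = (g p' = g' p') by [].
rewrite -f0 -f1; apply: (@locally_constant01 R Prop (fun s => g (f s) = g' (f s))) => s s01.
have fs : rect a b c d (f s).
  have between (k l x y : R) : k < x -> x < l -> k < y -> y < l ->
      k < x + s * (y - x) < l.
    move=> kx xl ky yl; case/andP: s01 => s0 s1.
    have : 0 <= s * `|y - x| <= `|y - x|.
      by rewrite mulr_ge0 //= ler_piMl.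
    by case: (lerP x y) => xy; lra.
  by split; apply: between.
have cf : {for s, continuous f}.
  have cl (x y : R) : {for s, continuous (fun s : R => x + s * y)}.
    apply: (@continuousD _ _ _ (fun=> x) (fun s : R => s * y)); first exact: cst_continuous.
    by apply: (@continuousM _ _ id (fun=> y)); [exact: cvg_id | exact: cst_continuous].
  exact: (cvg_pair (cl _ _) (cl _ _)).
have [_ cg] := lg _ fs; have [_ cg'] := lg' _ fs.
have N : \forall t \near s, q (g (f t)) = q (g' (f t)).
  have fN := cf _ (near_rect fs); near=> t.
  have ft : rect a b c d (f t) by near: t.
  by have [-> _] := lg _ ft; have [-> _] := lg' _ ft.
apply: (@lifts_agree R (g \o f) (g' \o f) s _ _ N).
  exact: continuous_comp.
exact: continuous_comp.
Unshelve. all: by end_near. Qed.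

Lemma lift_local (p : R * R) : exists g, \forall s \near p, q (g s) = h s /\ {for s, continuous g}.
Proof.
have [x xp] := q_surj (h p).
have [B xB [oB Binj]] := near_sheet x.
have hB : \forall s \near p, exists2 y, B y & q y = h s.
  have N : \forall z \near h p, exists2 y, B y & q y = z.
    by rewrite -xp; exact: (q_open xB).
  exact: (h_continuous N).
have /choice[g gE] : forall s, exists y, (exists2 y, B y & q y = h s) ->
    B y /\ q y = h s.
  move=> s; have [[y By qy]|n] := pselect (exists2 y, B y & q y = h s).
    by exists y.
  by exists x.
exists g; have hBi := nbhs_interior hB; near=> s.
have sB : nbhs s (fun s => exists2 y, B y & q y = h s) by near: s; exact: hBi.
have [Bs qs] := gE s (nbhs_singleton sB); split=> // O gO.
have OB : nbhs (g s) (fun y => O y /\ B y) by apply: filterI => //; exact: oB.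
have N : \forall z \near h s, exists2 y, O y /\ B y & q y = z.
  by rewrite -qs; exact: (q_open OB).
have hN : \forall t \near s, exists2 y, O y /\ B y & q y = h t.
  exact: (h_continuous N).
suff : \forall t \near s, O (g t) by [].
near=> t; have [y [Oy By] qy] : exists2 y, O y /\ B y & q y = h t by near: t; exact: hN.
have [|Bt qt] := gE t; first by exists y.
suff -> : g t = y by [].
move: qt; rewrite -qy => /qP[w yw].
have w1 : w = 1%g by apply: (Binj (g t)); rewrite -?yw.
by rewrite yw w1 act1.
Unshelve. all: by end_near. Qed.

Lemma lift_act S g w : lift_on S g -> lift_on S (fun p => act w (g p)).
Proof.
move=> lg p /lg[qp cp]; rewrite q_act; split=> //.
apply: (@continuous_comp _ _ _ g (act w)); [exact: cp | exact: act_continuous].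
Qed.

Lemma lift_sub S S' g : (forall p, S p -> S' p) -> lift_on S' g -> lift_on S g.
Proof. by move=> SS' lg p /SS'/lg. Qed.

(** A translate of the second lift agrees with the first at [p0], hence on the whole overlap, which
    is a rectangle. *)
Lemma lift_union (K L : set (R * R)) a b c d g g' p0 :
  (forall p : R * R, K p -> nbhs p K) -> (forall p : R * R, L p -> nbhs p L) ->
  (forall p, rect a b c d p <-> K p /\ L p) -> rect a b c d p0 ->
  lift_on K g -> lift_on L g' -> exists k, lift_on (fun p => K p \/ L p) k.
Proof.
move=> oK oL KL p0r lg lg'.
have [Kp0 Lp0] := (KL p0).1 p0r.
have [w gw] : exists w, g p0 = act w (g' p0).
  by apply/qP; have [-> _] := lg p0 Kp0; have [-> _] := lg' p0 Lp0.
have lw := lift_act w lg'.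
have agree p : K p -> L p -> g p = act w (g' p).
  move=> Kp Lp; apply: (@rect_unique a b c d g (fun p => act w (g' p)) p0 p) => //.
  - by apply: (lift_sub _ lg) => s /KL[].
  - by apply: (lift_sub _ lw) => s /KL[].
  - exact/KL.
pose f p := if pselect (K p) then g p else act w (g' p).
have fK p : K p -> f p = g p by rewrite /f; case: pselect.
have fL p : L p -> f p = act w (g' p).
  by rewrite /f; case: pselect => // Kp Lp; exact: agree.
exists f => p [Kp|Lp].
  have [qp cp] := lg p Kp; rewrite fK //; split=> // O; rewrite fK // => gO.
  have gN : \forall s \near p, O (g s) by exact: (cp O gO).
  have KN := oK p Kp; suff : \forall s \near p, O (f s) by [].
  near=> s; have Ks : K s by near: s; exact: KN.
  by rewrite fK //; near: s.
have [qp cp] := lw p Lp; rewrite fL //; split=> // O; rewrite fL // => gO.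
have gN : \forall s \near p, O (act w (g' s)) by exact: (cp O gO).
have LN := oL p Lp; suff : \forall s \near p, O (f s) by [].
near=> s; have Ls : L s by near: s; exact: LN.
by rewrite fL //; near: s.
Unshelve. all: by end_near. Qed.

(** The margin [k] gives a lift over an open neighbourhood of the closed rectangle, so that two
    rectangles with a common edge overlap in an open rectangle. Rectangles of width zero make
    sense. *)
Definition rect_lift a b c d : Prop := exists2 k, 0 < k &
  exists g, lift_on (rect (a - k) (b + k) (c - k) (d + k)) g.

Lemma rect_lift_glue1 a b e c d : a <= b -> b <= e -> c <= d ->
  rect_lift a b c d -> rect_lift b e c d -> rect_lift a e c d.
Proof.
move=> ab be cd [k k0 [g lg]] [l l0 [g' lg']].
pose m := Num.min k l.
have m0 : 0 < m by rewrite lt_min k0.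
have mk : m <= k by rewrite ge_min lexx.
have ml : m <= l by rewrite ge_min lexx orbT.
have [||||||f lf] := @lift_union (rect (a - m) (b + m) (c - m) (d + m))
  (rect (b - m) (e + m) (c - m) (d + m)) (b - m) (b + m) (c - m) (d + m) g g' (b, c).
- by move=> p; exact: near_rect.
- by move=> p; exact: near_rect.
- move=> p; split=> [[/andP[? ?] /andP[? ?]]|[[/andP[? ?] /andP[? ?]] [/andP[? ?] /andP[? ?]]]].
    by split; split; apply/andP; split; lra.
  by split; apply/andP; split; lra.
- by split; apply/andP; split=> /=; lra.
- apply: (lift_sub _ lg) => p [/andP[? ?] /andP[? ?]].
  by split; apply/andP; split; lra.
- apply: (lift_sub _ lg') => p [/andP[? ?] /andP[? ?]].
  by split; apply/andP; split; lra.
exists m => //; exists f; apply: (lift_sub _ lf) => p [/andP[p1 p2] /andP[p3 p4]].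
have [pb|bp] := ltP p.1 b; [left|right]; split; apply/andP; split; lra.
Qed.

Lemma rect_lift_glue2 a b c d e : a <= b -> c <= d -> d <= e ->
  rect_lift a b c d -> rect_lift a b d e -> rect_lift a b c e.
Proof.
move=> ab cd de [k k0 [g lg]] [l l0 [g' lg']].
pose m := Num.min k l.
have m0 : 0 < m by rewrite lt_min k0.
have mk : m <= k by rewrite ge_min lexx.
have ml : m <= l by rewrite ge_min lexx orbT.
have [||||||f lf] := @lift_union (rect (a - m) (b + m) (c - m) (d + m))
  (rect (a - m) (b + m) (d - m) (e + m)) (a - m) (b + m) (d - m) (d + m) g g' (a, d).
- by move=> p; exact: near_rect.
- by move=> p; exact: near_rect.
- move=> p; split=> [[/andP[? ?] /andP[? ?]]|[[/andP[? ?] /andP[? ?]] [/andP[? ?] /andP[? ?]]]].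
    by split; split; apply/andP; split; lra.
  by split; apply/andP; split; lra.
- by split; apply/andP; split=> /=; lra.
- apply: (lift_sub _ lg) => p [/andP[? ?] /andP[? ?]].
  by split; apply/andP; split; lra.
- apply: (lift_sub _ lg') => p [/andP[? ?] /andP[? ?]].
  by split; apply/andP; split; lra.
exists m => //; exists f; apply: (lift_sub _ lf) => p [/andP[p1 p2] /andP[p3 p4]].
have [pb|bp] := ltP p.2 d; [left|right]; split; apply/andP; split; lra.
Qed.

Lemma square_lift : rect_lift 0 1 0 1.
Proof.
apply: (@interval_ind R (fun a b => rect_lift a b 0 1)) => [a b c ab bc|x x01].
  exact: rect_lift_glue1.
(* Subdivision in the second variable over a rectangle of width zero. Its margin gives the strips
   that are then glued along the first variable. *)
have [k k0 [g lg]] : rect_lift x x 0 1.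
  apply: (@interval_ind R (fun c d => rect_lift x x c d)) => [a b c ab bc|y y01].
    exact: rect_lift_glue2.
  have [g gN] := lift_local (x, y).
  have /= [[A B] [/= /nearR[k k0 kA] /nearR[l l0 lB]] AB] := gN.
  pose m := Num.min k l / 2.
  have m0 : 0 < m by rewrite divr_gt0 // lt_min k0.
  have mk : 2 * m <= k by rewrite /m mulrC divfK // ge_min lexx.
  have ml : 2 * m <= l by rewrite /m mulrC divfK // ge_min lexx orbT.
  exists m => // c d _ cd _ yc dy; exists m => //.
  exists g => -[s t] [/andP[/= s1 s2] /andP[/= t1 t2]]; apply: (AB (s, t)).
  by split=> /=; [apply: kA | apply: lB]; lra.
exists (k / 2); first lra.
move=> a b _ ab _ xa bx; exists (k / 2); first lra.
exists g; apply: (lift_sub _ lg) => p [/andP[? ?] /andP[? ?]].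
by split; apply/andP; split; lra.
Qed.
End Square.

Local Notation J := (unit_interval R).

Lemma homotopy_lift (h : J * J -> Q) : continuous h ->
  exists2 g : J * J -> E, continuous g & forall p, q (g p) = h p.
Proof.
(* Extension to the whole plane, since lifts are built over open rectangles of the plane. *)
move=> ch; pose h' (p : R * R) := h (clamp p.1, clamp p.2).
have ch' : continuous h'.
  move=> p; apply: (@continuous_comp _ _ _ (fun p : R * R => (clamp p.1, clamp p.2)) h).
    have c1 : {for p, continuous (fun p : R * R => clamp p.1 : J)}.
      apply: (@continuous_comp _ _ _ fst (@clamp R)); first exact: cvg_fst.
      exact: clamp_continuous.
    have c2 : {for p, continuous (fun p : R * R => clamp p.2 : J)}.
      apply: (@continuous_comp _ _ _ snd (@clamp R)); first exact: cvg_snd.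
      exact: clamp_continuous.
    exact: (cvg_pair c1 c2).
  exact: ch.
have [k k0 [g lg]] := square_lift ch'.
have in_rect (p : J * J) : rect (0 - k) (1 + k) (0 - k) (1 + k) (ival p.1, ival p.2).
  have := (ival_ge0 p.1, ival_le1 p.1, ival_ge0 p.2, ival_le1 p.2).
  by case=> -[[? ?] ?] ?; split; apply/andP; split=> /=; lra.
exists (fun p => g (ival p.1, ival p.2)) => p; last first.
  by have [-> _] := lg _ (in_rect p); rewrite /h' /= !ivalK; case: (p).
have c1 : {for p, continuous (fun p : J * J => ival p.1)}.
  apply: (@continuous_comp _ _ _ fst (@ival R)); first exact: cvg_fst.
  exact: ival_continuous.
have c2 : {for p, continuous (fun p : J * J => ival p.2)}.
  apply: (@continuous_comp _ _ _ snd (@ival R)); first exact: cvg_snd.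
  exact: ival_continuous.
apply: (@continuous_comp _ _ _ (fun p : J * J => (ival p.1, ival p.2)) g).
  exact: (cvg_pair c1 c2).
by have [_] := lg _ (in_rect p).
Qed.

Lemma path_lift_unique (u v : J -> E) : continuous u -> continuous v ->
  (forall s, q (u s) = q (v s)) -> u zero = v zero -> u one = v one.
Proof.
move=> cu cv quv; apply: (@lift_unique (u \o @clamp R) (v \o @clamp R)) => [s|s|s].
- by apply: continuous_comp; [exact: clamp_continuous | exact: cu].
- by apply: continuous_comp; [exact: clamp_continuous | exact: cv].
- exact: quv.
Qed.
End FreeQuotient.

Section PathOf.
Variables (R : realType) (T : topologicalType) (f : unit_interval R -> T) (x y : T).
Hypotheses (f_continuous : continuous f) (f0 : f zero = x) (f1 : f one = y).

(** The proofs are arguments for the sake of the path structure below. *)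
Definition path_of : unit_interval R -> T :=
  let: (_, _, _) := (f_continuous, f0, f1) in f.

HB.instance Definition _ :=
  @isContinuous.Build (unit_interval R) T path_of f_continuous.
HB.instance Definition _ := @isPath.Build (unit_interval R) T x y path_of f0 f1.
End PathOf.

Lemma mkpath (R : realType) (T : topologicalType) (f : unit_interval R -> T) (x y : T) :
  continuous f -> f zero = x -> f one = y ->
  exists g : {path (unit_interval R) from x to y}, forall t, g t = f t.
Proof. by move=> cf f0 f1; exists (path_of cf f0 f1). Qed.

Lemma slice1_continuous (R : realType) (T : topologicalType)
    (G : unit_interval R * unit_interval R -> T) s :
  continuous G -> continuous (fun t => G (t, s)).
Proof.
move=> cG t; apply: (@continuous_comp _ _ _ (fun t => (t, s)) G); last exact: cG.
have c1 : {for t, continuous (@id (unit_interval R))} by exact: cvg_id.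
have c2 : {for t, continuous (fun=> s : unit_interval R)} by exact: cst_continuous.
exact: (cvg_pair c1 c2).
Qed.

Lemma slice2_continuous (R : realType) (T : topologicalType)
    (G : unit_interval R * unit_interval R -> T) t :
  continuous G -> continuous (fun s => G (t, s)).
Proof.
move=> cG s; apply: (@continuous_comp _ _ _ (fun s => (t, s)) G); last exact: cG.
have c1 : {for s, continuous (@id (unit_interval R))} by exact: cvg_id.
have c2 : {for s, continuous (fun=> t : unit_interval R)} by exact: cst_continuous.
exact: (cvg_pair c2 c1).
Qed.

(** * The orbit map as a covering, and the projection from the braid group *)

Section Covering.
Variables (R : realType) (gT : finGroupType) (r : nat).
Variable rG : mx_representation R[i] [set: gT]%G r.
Local Notation V := 'rV[R[i]]_r.
Local Notation X := (reg_space rG).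
Local Notation I := (unit_interval R).
Hypothesis W_reflection : complex_reflection_group rG.
Implicit Types (w : gT) (x y : X).

Lemma is_reflectionE s : is_reflection rG s = (\rank (rG s - 1%:M) == 1%N).
Proof.
rewrite /is_reflection; set A := rG s - 1%:M.
have rs : rG s = 1%:M + A by rewrite /A addrC subrK.
have -> : \rank (rfix_mx rG [set s]%SET) = (r - \rank A)%N.
  rewrite -mxrank_ker; apply/eqP; rewrite eqn_leq; apply/andP; split; apply: mxrankS; last first.
    apply/rfix_mxP => v; rewrite finset.in_set1 => /eqP ->.
    by rewrite rs mulmxDr mulmx1 mulmx_ker addr0.
  apply/sub_kermxP; rewrite /A mulmxBr mulmx1.
  by rewrite rfix_mx_id ?subrr // finset.set11.
by have := rank_leq_row A; lia.
Qed.

Lemma reflection_generated :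
  <<[set s | \rank (rG s - 1%:M) == 1%N]%SET>>%g = [set: gT]%SET.
Proof.
case: W_reflection => _ <-; congr <<_>>%g.
by apply/finset.setP => s; rewrite !finset.in_set is_reflectionE.
Qed.

Lemma reg_act_free w x : reg_act w x = x -> w = 1%g.
Proof.
move=> wx; apply/eqP; rewrite -invg_eq1; apply/negP => /negP w1.
have /complementP cx := set_valP x.
have := @steinberg _ _ _ rG reflection_generated (proj1 W_reflection) (val x).
case/(_ _ w^-1%g w1)/negP => [s rs|]; first by apply: cx; rewrite is_reflectionE rs.
by apply/eqP; move: (congr1 val wx).
Qed.

Lemma val_continuous : continuous (val : X -> V).
Proof. exact: initial_continuous. Qed.

Lemma reg_space_continuous (T : topologicalType) (f : T -> X) :
  continuous (fun t => val (f t)) -> continuous f.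
Proof. exact: continuous_comp_initial. Qed.

Lemma reg_act_continuous w : continuous (reg_act w : X -> X).
Proof.
apply: reg_space_continuous => x.
apply: (@continuous_comp _ _ _ (val : X -> V) (fun v => v *m rG w^-1%g)).
  exact: val_continuous.
exact: mulmx_continuous.
Qed.

Lemma reg_space_hausdorff : hausdorff_space X.
Proof.
move=> x y xy; apply: val_inj; apply: (@norm_hausdorff _ V) => A B xA yB.
have [z [Az Bz]] := xy _ _ (val_continuous xA) (val_continuous yB).
by exists (val z).
Qed.

Lemma orbit_class_continuous : continuous (@orbit_class R gT r rG).
Proof. exact: pi_continuous. Qed.

Lemma orbit_classP x y : orbit_class x = orbit_class y <-> exists w, y = reg_act w x.
Proof.
split=> [/eqmodP/existsP[w /eqP ->]|[w ->]]; first by exists w.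
by apply/eqmodP/existsP; exists w.
Qed.

Lemma orbit_class_act w x : orbit_class (reg_act w x) = orbit_class x.
Proof. by apply/esym/orbit_classP; exists w. Qed.

Lemma orbit_class_surj z : exists x, @orbit_class R gT r rG x = z.
Proof. by exists (repr z); rewrite /orbit_class reprK. Qed.

Lemma orbit_class_open x (O : set X) : nbhs x O ->
  \forall z \near orbit_class x, exists2 y, O y & orbit_class y = z.
Proof.
move=> xO; have xOi := nbhs_interior xO.
pose U : set (orbit_space rG) := fun z => exists2 y, (interior O) y & orbit_class y = z.
have oU : open U.
  rewrite /open /= /quotient_open.
  have -> : (\pi_(orbit_space rG) @^-1` U = \bigcup_w (reg_act w @^-1` (interior O)))%classic.
    apply/seteqP; split=> [y [z Oz zy]|y [w _ Owy]].
      have /orbit_classP[w zE] : orbit_class y = orbit_class z by rewrite zy.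
      by exists w => //; rewrite /= -zE.
    by exists (reg_act w y) => //; exact: orbit_class_act.
  apply: bigcup_open => w _; apply: open_comp; last exact: open_interior.
  by move=> y _; exact: reg_act_continuous.
have xU : U (orbit_class x) by exists x => //; exact: nbhs_singleton.
have : nbhs (orbit_class x) U by apply: open_nbhs_nbhs.
by apply: filterS => z [y Oy yz]; exists y => //; exact: interior_subset.
Qed.

Lemma orbit_homotopy_lift (h : I * I -> orbit_space rG) : continuous h ->
  exists2 g : I * I -> X, continuous g & forall p, orbit_class (g p) = h p.
Proof.
exact: (homotopy_lift (@reg_act1 _ _ _ rG) reg_act_continuous reg_act_free
  reg_space_hausdorff orbit_classP orbit_class_surj orbit_class_open).
Qed.

Lemma orbit_path_unique (u v : I -> X) : continuous u -> continuous v ->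
  (forall s, orbit_class (u s) = orbit_class (v s)) ->
  u zero = v zero -> u one = v one.
Proof.
exact: (path_lift_unique (@reg_act1 _ _ _ rG) reg_act_continuous reg_act_free
  reg_space_hausdorff orbit_classP).
Qed.

Variable x0 : X.
Local Notation B := (braid_group x0).

Definition covers (b : B) w : Prop :=
  exists (g : {path I from x0 to (reg_act w x0)})
         (l : {path I from (orbit_class x0) to (orbit_class x0)}),
    (forall t, l t = orbit_class (g t)) /\ loop_class l = b.

(** The loop is lifted as a homotopy that is constant in the second variable, then translated so as
    to start at [x0]. *)
Lemma covers_ex b : exists w, covers b w.
Proof.
pose l := repr b; have lb : loop_class l = b by exact: loop_classK.
have [|G cG GE] := @orbit_homotopy_lift (fun p => l p.1).
  move=> p; apply: (@continuous_comp _ _ _ fst l); first exact: cvg_fst.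
  exact: paths_continuous.
have [w wE] : exists w, x0 = reg_act w (G (zero, zero)).
  by apply/orbit_classP; rewrite GE path_zero.
pose f t := reg_act w (G (t, zero)).
have cf : continuous f.
  move=> t; apply: (@continuous_comp _ _ _ (fun t => G (t, zero)) (reg_act w)).
    exact: slice1_continuous.
  exact: reg_act_continuous.
have fl t : orbit_class (f t) = l t by rewrite orbit_class_act GE.
have [v vE] : exists v, f one = reg_act v x0.
  by apply/orbit_classP; rewrite fl path_one.
have [g gE] := mkpath cf (esym wE) vE.
by exists v, g, l; split=> // t; rewrite gE fl.
Qed.

(** A homotopy of the two loops lifts to a square whose edges are known by uniqueness of lifts: [g],
    [g'] and two constant paths. So [g] and [g'] end at the same point, and the action is free. *)
Lemma covers_unique b v w : covers b v -> covers b w -> v = w.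
Proof.
move=> [g [l [lE lb]]] [g' [l' [lE' lb']]].
have [H [cH H0 H1 Hx Hy]] : homotopic l l' by apply/loop_classP; rewrite lb lb'.
have [G0 cG0 G0E] := orbit_homotopy_lift cH.
have [u uE] : exists u, x0 = reg_act u (G0 (zero, zero)).
  by apply/orbit_classP; rewrite G0E H0 path_zero.
pose G p := reg_act u (G0 p).
have cG : continuous G.
  by move=> p; apply: (@continuous_comp _ _ _ G0 (reg_act u)); [exact: cG0 | exact: reg_act_continuous].
have GE p : orbit_class (G p) = H p by rewrite orbit_class_act.
have c1 s := @slice1_continuous _ _ G s cG; have c2 t := @slice2_continuous _ _ G t cG.
have e1 : G (one, zero) = reg_act v x0.
  have <- : g one = reg_act v x0 by exact: path_one.
  apply: (orbit_path_unique (c1 zero) (@paths_continuous _ _ _ _ g)).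
    by move=> t; rewrite GE H0 lE.
  by rewrite path_zero /G -uE.
have e2 : G (zero, one) = x0.
  apply: (@orbit_path_unique _ (cst x0) (c2 zero)); first exact: cst_continuous.
    by move=> s; rewrite GE Hx.
  by rewrite /G -uE.
have e3 : G (one, one) = reg_act w x0.
  have <- : g' one = reg_act w x0 by exact: path_one.
  apply: (orbit_path_unique (c1 one) (@paths_continuous _ _ _ _ g')).
    by move=> t; rewrite GE H1 lE'.
  by rewrite path_zero.
have e4 : G (one, one) = reg_act v x0.
  apply: (@orbit_path_unique _ (cst (reg_act v x0)) (c2 one)); first exact: cst_continuous.
    by move=> s; rewrite GE Hy /cst orbit_class_act.
  exact: e1.
have : reg_act (v^-1 * w)%g x0 = x0.
  by rewrite reg_actM -e3 e4 -reg_actM mulVg reg_act1.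
by move/reg_act_free/eqP; rewrite -eq_mulVg1 => /eqP.
Qed.

Lemma act_path w y z (g : {path I from y to z}) :
  exists h : {path I from (reg_act w y) to (reg_act w z)},
    forall t, h t = reg_act w (g t).
Proof.
apply: mkpath; last 2 first.
- by rewrite path_zero.
- by rewrite path_one.
move=> t; apply: (@continuous_comp _ _ _ g (reg_act w)).
  exact: paths_continuous.
exact: reg_act_continuous.
Qed.

Lemma covers_mul b c v w (g : {path I from x0 to (reg_act v x0)})
    (h : {path I from (reg_act v x0) to (reg_act v (reg_act w x0))})
    (g' : {path I from x0 to (reg_act w x0)})
    (l l' : {path I from (orbit_class x0) to (orbit_class x0)}) :
  (forall t, l t = orbit_class (g t)) -> loop_class l = b ->
  (forall t, l' t = orbit_class (g' t)) -> loop_class l' = c ->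
  (forall t, h t = reg_act v (g' t)) ->
  exists k : {path I from x0 to (reg_act (v * w) x0)},
    (forall t, k t = path_concat g h t) /\
    (forall t, path_concat l l' t = orbit_class (k t)) /\
    loop_class (path_concat l l') = (b * c)%g.
Proof.
move=> lE lb lE' lc hE.
have [|||k kE] := @mkpath R _ (path_concat g h) x0 (reg_act (v * w) x0).
- exact: path_concat_continuous.
- exact: path_concat0.
- by rewrite path_concat1 reg_actM.
exists k; split=> //; split; last by rewrite -lb -lc -pi1_mulE.
move=> t; rewrite kE !path_concatE; case: ifP => _; first by rewrite lE.
by rewrite lE' hE orbit_class_act.
Qed.

Lemma braid_projection_exists :
  exists p : {multiplicative B -> gT}, is_braid_projection p.
Proof.
have /choice[p pE] := covers_ex.
have pP b w : p b = w <-> covers b w.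
  by split=> [<-//|bw]; exact: covers_unique (pE b) bw.
have pM : {morph p : x y / (x * y)%g >-> (x * y)%g}.
  move=> b c; apply/pP; have [g [l [lE lb]]] := pE b; have [g' [l' [lE' lc]]] := pE c.
  have [h hE] := act_path (p b) g'.
  have [k [_ [kE kbc]]] := covers_mul lE lb lE' lc hE.
  by exists k, (path_concat l l').
pose m := @isMultiplicative.Build B gT p pM.
pose P : {multiplicative B -> gT} := HB.pack p m.
by exists P.
Qed.
End Covering.

(** * Splitting the cocycle *)

Section Forms.
Variables (R : realType) (gT : finGroupType) (r : nat).
Variable rG : mx_representation R[i] [set: gT]%G r.
Local Notation C := R[i].
Local Notation V := 'rV[C]_r.
Implicit Types (v : V) (w s : gT).

Lemma reflection_form s : is_reflection rG s ->
  exists2 b : 'cV[C]_r, b != 0 & forall v, (v *m rG s == v) = (frm b v == 0).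
Proof.
rewrite is_reflectionE => /eqP rs; have [b [c [E b0]]] := rank1_mul rs.
have c0 : c != 0 by apply/eqP => c0; move: rs; rewrite E c0 mulmx0 mxrank0.
exists b => // v; rewrite -subr_eq0 -{2}[v]mulmx1 -mulmxBr E mulmxA.
by rewrite [v *m b]mx11_scalar mul_scalar_mx scaler_eq0 (negPf c0) orbF.
Qed.

Lemma proportional_forms (b c : 'cV[C]_r) : b != 0 ->
  (forall v, frm b v = 0 -> frm c v = 0) -> exists k, c = k *: b.
Proof.
move=> b0 bc; have [u0 u00] := form_neq0 b0.
have [u bu] : exists u, frm b u = 1.
  by exists ((frm b u0)^-1 *: u0); rewrite frmZ mulVf.
exists (frm c u); apply/colP => j.
have frmE (d : 'cV[C]_r) : frm d (delta_mx 0 j) = d j 0 by rewrite /frm -rowE mxE.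
have := bc (delta_mx 0 j - frm b (delta_mx 0 j) *: u).
rewrite !frmB !frmZ bu mulr1 subrr => /(_ erefl)/eqP.
by rewrite subr_eq0 !frmE mxE mulrC => /eqP.
Qed.

(** Several reflections may share a hyperplane, so one form per class of proportional forms is kept.
    The group permutes the forms up to scalars because it permutes the reflections by
    conjugation. *)
Lemma arrangement_forms :
  exists (I : finType) (a : I -> 'cV[C]_r),
    [/\ forall i, a i != 0, forall i j c, i != j -> a i != c *: a j,
        forall v, complement rG v <-> reg a v &
        forall w i, exists j c, c != 0 /\ rG w *m a i = c *: a j].
Proof.
have /choice[b bE] : forall s, exists b : 'cV[C]_r, is_reflection rG s ->
    b != 0 /\ forall v, (v *m rG s == v) = (frm b v == 0).
  move=> s; have [/reflection_form[b b0 bE]|_] := boolP (is_reflection rG s).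
    by exists b.
  by exists 0.
pose prop s t := exists c, b s = c *: b t.
have propC s t : is_reflection rG s -> prop s t -> prop t s.
  move=> rs [c E]; have c0 : c != 0.
    by case: (bE s rs) => + _; rewrite E; apply: contraNneq => ->; rewrite scale0r.
  by exists c^-1; rewrite E scalerA mulVf // scale1r.
have propT s t u : prop s t -> prop t u -> prop s u.
  by move=> [c E] [d E']; exists (c * d); rewrite E E' scalerA.
(* The representative of a hyperplane is its reflection of least [enum_rank]. *)
pose P s := is_reflection rG s &&
  `[< forall t, is_reflection rG t -> prop t s -> (enum_rank s <= enum_rank t)%N >].
have Prefl s : P s -> is_reflection rG s by case/andP.
have rep s : is_reflection rG s -> exists t, P t /\ prop s t.
  move=> rs; pose Q t := is_reflection rG t && `[< prop s t >].
  have Qs : Q s by rewrite /Q rs; apply/asboolP; exists 1; rewrite scale1r.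
  have [t /andP[rt /asboolP st] tmin] := arg_minnP (fun t => enum_rank t : nat) Qs.
  exists t; split=> //; rewrite /P rt; apply/asboolP => u ru ut; apply: tmin.
  by rewrite /Q ru; apply/asboolP/(propT _ _ _ st); exact: propC ut.
pose I := {s | P s}; pose a (i : I) := b (val i).
have a0 i : a i != 0 by case: (bE _ (Prefl _ (valP i))).
exists I, a; split=> //.
- move=> i j c ij; apply/negP => /eqP E; case/negP: ij; apply/eqP/val_inj.
  have pij : prop (val i) (val j) by exists c.
  have pji := propC _ _ (Prefl _ (valP i)) pij.
  apply/enum_rank_inj/val_inj/eqP; rewrite eqn_leq.
  have /andP[_ /asboolP mi] := valP i; have /andP[_ /asboolP mj] := valP j.
  by rewrite mi ?mj ?(Prefl _ (valP _)).
- move=> v; split=> [/complementP cv i|av].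
    have ri := Prefl _ (valP i); have [_ E] := bE _ ri.
    by rewrite -E; exact: cv.
  apply/complementP => s rs; have [_ E] := bE s rs; rewrite E.
  have [t [Pt [c sc]]] := rep s rs; rewrite sc frmZl mulf_neq0 //.
    by case: (bE s rs) => + _; rewrite sc; apply: contraNneq => ->; rewrite scale0r.
  exact: (av (exist _ t Pt)).
- move=> w i; have ri := Prefl _ (valP i).
  (* The form [rG w *m a i] is [v |-> a i (v w)], and it vanishes on the vectors fixed by this
     conjugate. *)
  pose s := (val i ^ w^-1)%g.
  have rs : is_reflection rG s by rewrite is_reflectionJ.
  have [t [Pt [c sc]]] := rep s rs.
  have [_ Ei] := bE _ ri; have [s0 Es] := bE _ rs.
  have [k kE] : exists k, rG w *m a i = k *: b s.
    apply: proportional_forms => // v /eqP; rewrite -Es => /eqP vs; apply/eqP.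
    have -> : frm (rG w *m a i) v = frm (a i) (v *m rG w) by rewrite /frm mulmxA.
    rewrite -Ei -{2}vs -!mulmxA -!repr_mxM ?inE //.
    by rewrite /s conjgE invgK !mulgA mulgVK.
  exists (exist _ t Pt), (k * c); split; last by rewrite kE sc scalerA.
  apply/eqP => kc0; have : rG w *m a i = 0 by rewrite kE sc scalerA kc0 scale0r.
  move/(congr1 (mulmx (rG w^-1%g))); rewrite mulmx0 mulmxA -repr_mxM ?inE //.
  by rewrite mulVg repr_mx1 mul1mx => /eqP; rewrite (negPf (a0 i)).
Qed.
End Forms.

Lemma path_ext (R : realType) (T : topologicalType) (x y : T)
    (f g : {path (unit_interval R) from x to y}) : (forall t, f t = g t) -> f = g.
Proof. by move=> fg; apply/path_eqP => t; exact: fg. Qed.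

Lemma homotopic_ext (R : realType) (T : topologicalType) (x y : T)
    (f g : {path (unit_interval R) from x to y}) :
  (forall t, f t = g t) -> homotopic f g.
Proof. by move/path_ext ->; exact: homotopic_refl. Qed.

Lemma homotopic_mulVl (R : realType) (T : topologicalType) (x y : T)
    (f : {path (unit_interval R) from x to y}) :
  homotopic (path_concat (path_rev f) f) (cst y : {path (unit_interval R) from y to y}).
Proof.
apply: (homotopic_trans _ (homotopic_mulV (path_rev f))).
apply: homotopic_ext => t; rewrite /= !path_concatE.
by case: ifP => // _; exact: esym (congr1 (fun h => h (half2 t)) (path_revK f)).
Qed.

(** [path_rev p] cancels against [p] in the middle. With base paths for [a], [p] and the reverse of
    [e], this is the additivity of [transport]. *)
Lemma homotopic_conj (R : realType) (T : topologicalType) (x0 x y z : T)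
    (a : {path (unit_interval R) from x0 to x}) (b : {path (unit_interval R) from x to y})
    (p : {path (unit_interval R) from x0 to y}) (d : {path (unit_interval R) from y to z})
    (e : {path (unit_interval R) from z to x0}) :
  homotopic (path_concat (path_concat (path_concat a b) (path_rev p))
                         (path_concat (path_concat p d) e))
            (path_concat (path_concat a (path_concat b d)) e).
Proof.
have h1 := homotopic_sym (homotopic_mulA (path_concat a b)
   (path_rev p) (path_concat (path_concat p d) e)).
apply: (homotopic_trans h1).
have k1 : homotopic (path_concat (path_rev p) (path_concat (path_concat p d) e)) (path_concat d e).
  apply: (homotopic_trans (homotopic_mulA _ _ _)).
  apply: homotopic_concat; last exact: homotopic_refl.
  apply: (homotopic_trans (homotopic_mulA _ _ _)).
  apply: (homotopic_trans _ (homotopic_mul1 d)).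
  by apply: homotopic_concat; [exact: homotopic_mulVl | exact: homotopic_refl].
apply: (homotopic_trans (homotopic_concat (homotopic_refl _) k1)).
apply: (homotopic_trans (homotopic_mulA _ _ _)).
apply: homotopic_concat; last exact: homotopic_refl.
exact/homotopic_sym/homotopic_mulA.
Qed.

Section PathMap.
Variables (R : realType) (T T' : topologicalType) (f : T -> T').
Hypothesis f_continuous : continuous f.
Local Notation I := (unit_interval R).
Variables x y : T.

Fact path_map_continuous (g : {path I from x to y}) : continuous (fun t => f (g t)).
Proof.
move=> t; apply: (@continuous_comp _ _ _ g f); last exact: f_continuous.
exact: paths_continuous.
Qed.

Fact path_map0 (g : {path I from x to y}) : f (g zero) = f x.
Proof. by rewrite path_zero. Qed.

Fact path_map1 (g : {path I from x to y}) : f (g one) = f y.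
Proof. by rewrite path_one. Qed.

Definition path_map (g : {path I from x to y}) : {path I from (f x) to (f y)} :=
  path_of (@path_map_continuous g) (path_map0 g) (path_map1 g).

Lemma homotopic_map (g h : {path I from x to y}) :
  homotopic g h -> homotopic (path_map g) (path_map h).
Proof.
case=> H [cH H0 H1 Hx Hy]; exists (fun p => f (H p)); split.
- by move=> p; apply: (@continuous_comp _ _ _ H f); [exact: cH | exact: f_continuous].
- by move=> t; rewrite H0.
- by move=> t; rewrite H1.
- by move=> s; rewrite Hx.
- by move=> s; rewrite Hy.
Qed.
End PathMap.

(** * Extending the values on [P] to the paths of the complement *)

Section Transport.
Variables (R : realType) (gT : finGroupType) (r : nat).
Variable rG : mx_representation R[i] [set: gT]%G r.
Local Notation C := R[i].
Local Notation V := 'rV[C]_r.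
Local Notation X := (reg_space rG).
Local Notation I := (unit_interval R).
Local Open Scope complex_scope.
Implicit Types (w : gT) (x y z : X) (v : V).

Lemma segment_path x y :
  (forall s : R, 0 <= s <= 1 -> complement rG (val x + s%:C *: (val y - val x))) ->
  exists g : {path I from x to y},
    forall t, val (g t) = val x + (ival t)%:C *: (val y - val x).
Proof.
move=> xy.
have ct (t : I) : complement rG (val x + (ival t)%:C *: (val y - val x)).
  by apply: xy; rewrite ival_ge0 ival_le1.
pose f (t : I) : X := exist (fun v => v \in complement rG) _ (mem_set (ct t)).
have [|||g gE] := @mkpath R _ f x y.
- apply: reg_space_continuous => t.
  apply: (@continuous_comp _ _ _ (@ival R) (fun s : R => val x + s%:C *: (val y - val x))).
    exact: ival_continuous.
  move=> P; exact: near_real_line.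
- by apply: val_inj; rewrite /= ival0 scale0r addr0.
- by apply: val_inj; rewrite /= ival1 scale1r subrKC.
- by exists g => t; rewrite gE.
Qed.

Lemma convex_homotopy x y (g h : {path I from x to y}) :
  (forall t (s : R), 0 <= s <= 1 ->
     complement rG (val (g t) + s%:C *: (val (h t) - val (g t)))) ->
  homotopic g h.
Proof.
move=> gh.
have cp (p : I * I) :
    complement rG (val (g p.1) + (ival p.2)%:C *: (val (h p.1) - val (g p.1))).
  by apply: gh; rewrite ival_ge0 ival_le1.
exists (fun p => exist (fun v => v \in complement rG) _ (mem_set (cp p))); split.
- apply: reg_space_continuous => p.
  have cpath (k : {path I from x to y}) : {for p, continuous (fun p : I * I => val (k p.1) : V)}.
    apply: (@continuous_comp _ _ _ (fun p : I * I => k p.1) (val : X -> V)).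
      apply: (@continuous_comp _ _ _ fst k); first exact: cvg_fst.
      exact: paths_continuous.
    exact: val_continuous.
  have cs : {for p, continuous (fun p : I * I => (ival p.2)%:C : C)}.
    apply: (@continuous_comp _ _ _ (fun p : I * I => ival p.2) (fun s : R => s%:C : C)).
      apply: (@continuous_comp _ _ _ snd (@ival R)); first exact: cvg_snd.
      exact: ival_continuous.
    exact: real_complex_continuous.
  apply: (@continuousD _ _ _ (fun p : I * I => val (g p.1))
    (fun p : I * I => (ival p.2)%:C *: (val (h p.1) - val (g p.1)))).
    exact: cpath.
  apply: continuousZ; first exact: cs.
  by apply: (@continuousB _ _ _ (fun p : I * I => val (h p.1)) (fun p : I * I => val (g p.1)));
    exact: cpath.
- by move=> t; apply: val_inj; rewrite /= ival0 scale0r addr0.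
- by move=> t; apply: val_inj; rewrite /= ival1 scale1r subrKC.
- by move=> s; apply: val_inj; rewrite /= !path_zero subrr scaler0 addr0.
- by move=> s; apply: val_inj; rewrite /= !path_one subrr scaler0 addr0.
Qed.

Lemma near_segment v : complement rG v -> exists2 d : R, 0 < d &
  forall u u', ball v d%:C u -> ball v d%:C u' ->
    forall s : R, 0 <= s <= 1 -> complement rG (u + s%:C *: (u' - u)).
Proof.
have [J [a [_ _ aE _]]] := arrangement_forms rG.
move=> /aE/near_reg/near_ball[d d0 dP]; exists d => // u u' vu vu' s s01.
by apply/aE/dP; exact: cvx_ball.
Qed.

(** Being reachable from [x] is locally constant off the hyperplanes, since nearby points are joined
    by segments. *)
Lemma path_connected x y : exists g : {path I from x to y}, True.
Proof.
have [J [a [_ _ aE _]]] := arrangement_forms rG.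
pose G (v : V) := exists z (g : {path I from x to z}), val z = v.
have step (u u' : V) : (forall s : R, 0 <= s <= 1 -> complement rG (u + s%:C *: (u' - u))) ->
    G u -> G u'.
  move=> uu' [z [g zu]].
  have cu' : complement rG u'.
    by have := uu' 1; rewrite scale1r subrKC; apply; rewrite lexx ler01.
  pose z' : X := exist (fun v => v \in complement rG) _ (mem_set cu').
  have [|h _] := @segment_path z z'; first by rewrite zu.
  by exists z', (path_concat g h).
suff [z [g zy]] : G (val y) by move: g; rewrite (val_inj zy) => g; exists g.
have <- : G (val x) = G (val y).
  apply: (@reg_constant R r J a (fun=> True) Prop G) => //.
  - by move=> v _; exact: filterE.
  - move=> v _ /aE cv; have [d d0 dP] := near_segment cv.
    have dN := @near_ballx R r v d d0.
    have vv : ball v d%:C v by apply: ballxx; rewrite ltcR.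
    near=> u; have vu : ball v d%:C u by near: u; exact: dN.
    by apply/propext; split; apply: step; exact: dP.
  - exact/aE/set_valP.
  - exact/aE/set_valP.
by exists x, (cst x).
Unshelve. all: by end_near. Qed.

Variable x0 : X.
Local Notation B := (braid_group x0).
Variable p : {multiplicative B -> gT}.
Hypothesis pP : is_braid_projection p.
Variables (M : zmodType) (F : gT * gT -> M) (c : B -> M).
Hypothesis cF : forall b b', F (p b, p b') = c b' - c (b * b')%g + c b.
Hypothesis F1l : forall w, F (1%g, w) = 0.
Hypothesis F1r : forall w, F (w, 1%g) = 0.

Lemma loop_classM (f g : {path I from (orbit_class x0) to (orbit_class x0)}) :
  ((loop_class f : B) * (loop_class g : B))%g = loop_class (path_concat f g) :> B.
Proof. exact: pi1_mulE. Qed.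

Lemma loop_classV (f : {path I from (orbit_class x0) to (orbit_class x0)}) :
  ((loop_class f : B)^-1)%g = loop_class (path_rev f) :> B.
Proof. exact: pi1_invE. Qed.

Lemma p_one : p 1%g = 1%g.
Proof. by apply: (@mulgI _ (p 1%g)); rewrite -gmulfM !mulg1. Qed.

Lemma c_mull b b' : p b = 1%g -> c (b * b')%g = c b + c b'.
Proof.
move=> pb; have := cF b b'; rewrite pb F1l addrAC => /esym/eqP.
by rewrite subr_eq0 addrC => /eqP.
Qed.

Lemma c_mulr b b' : p b = 1%g -> c (b' * b)%g = c b' + c b.
Proof.
move=> pb; have := cF b' b; rewrite pb F1r addrAC => /esym/eqP.
by rewrite subr_eq0 addrC => /eqP.
Qed.

Lemma c_conj b b' : p b = 1%g -> c (b' * b * b'^-1)%g = c b.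
Proof.
move=> pb; apply: (@addIr _ (c b')); rewrite -c_mull ?mulgVK.
  by rewrite c_mulr // addrC.
by rewrite !gmulfM pb mulg1 -gmulfM mulgV p_one.
Qed.

Definition down x y (g : {path I from x to y}) :=
  path_map (@orbit_class_continuous R gT r rG) g.

Lemma p_cover w (g : {path I from x0 to (reg_act w x0)})
    (l : {path I from (orbit_class x0) to (orbit_class x0)}) :
  (forall t, l t = orbit_class (g t)) -> p (loop_class l) = w.
Proof. by move=> lg; apply/pP; exists g, l. Qed.

Lemma p_down (g : {path I from x0 to x0}) : p (loop_class (down g)) = 1%g.
Proof.
have [|||h hg] := @mkpath R _ g x0 (reg_act 1%g x0).
- exact: paths_continuous.
- exact: path_zero.
- by rewrite path_one reg_act1.
by apply: (@p_cover _ h) => t; rewrite hg.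
Qed.

Definition loop_value (g : {path I from x0 to x0}) : M := c (loop_class (down g)).

Lemma loop_value_homotopic g h : homotopic g h -> loop_value g = loop_value h.
Proof.
move=> gh; congr c; apply/loop_classP.
exact: (homotopic_map (@orbit_class_continuous R gT r rG) gh).
Qed.

Lemma loop_value_concat (g h : {path I from x0 to x0}) :
  loop_value (path_concat g h) = loop_value g + loop_value h.
Proof.
rewrite /loop_value -c_mull ?p_down //; congr c.
rewrite loop_classM; apply/loop_classP/homotopic_ext => t.
change (orbit_class (path_concat g h t) = path_concat (down g) (down h) t).
by rewrite !path_concatE; case: ifP.
Qed.

Definition base_path x : {path I from x0 to x} := projT1 (cid (path_connected x0 x)).

Definition transport x y (g : {path I from x to y}) : M :=
  loop_value (path_concat (path_concat (base_path x) g) (path_rev (base_path y))).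

Lemma transport_homotopic x y (g h : {path I from x to y}) :
  homotopic g h -> transport g = transport h.
Proof.
move=> gh; apply: loop_value_homotopic.
apply: homotopic_concat; last exact: homotopic_refl.
by apply: homotopic_concat; first exact: homotopic_refl.
Qed.

Lemma transport_concat x y z (g : {path I from x to y}) (h : {path I from y to z}) :
  transport (path_concat g h) = transport g + transport h.
Proof.
rewrite /transport -loop_value_concat; apply: loop_value_homotopic.
exact/homotopic_sym/homotopic_conj.
Qed.

Lemma transport_cst x : transport (cst x : {path I from x to x}) = 0.
Proof.
apply: (@addrI _ (transport (cst x : {path I from x to x}))).
rewrite addr0 -transport_concat; apply: transport_homotopic.
exact: homotopic_mul1.
Qed.

Lemma transport_rev x y (g : {path I from x to y}) :
  transport (path_rev g) = - transport g.
Proof.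
apply/eqP; rewrite -addr_eq0 -transport_concat -(transport_cst y).
by apply/eqP/transport_homotopic/homotopic_mulVl.
Qed.

(** The base path from [x0] to itself need not be constant, but it is a loop and its two occurrences
    cancel in the abelian group [M]. *)
Lemma transport_loop (g : {path I from x0 to x0}) : transport g = loop_value g.
Proof.
rewrite /transport !loop_value_concat addrAC -loop_value_concat.
have -> : loop_value (path_concat (base_path x0) (path_rev (base_path x0))) = 0.
  have -> := loop_value_homotopic (homotopic_mulV (base_path x0)).
  apply: (@addrI _ (loop_value (cst x0))).
  rewrite addr0 -loop_value_concat; apply: loop_value_homotopic.
  exact: homotopic_mul1.
by rewrite add0r.
Qed.

Definition translate w x y (g : {path I from x to y}) :=
  path_map (@reg_act_continuous R gT r rG w) g.

(** The base path to [reg_act w x0] becomes a loop in the orbit space, and the closed translate of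
    [g] becomes the conjugate of the image of [g] by this loop. [c] takes the same value on both. *)
Lemma transport_move_loop w (g : {path I from x0 to x0}) :
  transport (translate w g) = loop_value g.
Proof.
set b := base_path (reg_act w x0).
have [|||l lE] := @mkpath R (orbit_space rG) (down b) (orbit_class x0) (orbit_class x0).
- exact: paths_continuous.
- exact: path_zero.
- by rewrite path_one orbit_class_act.
rewrite /transport /loop_value -[RHS](@c_conj _ (loop_class l)) ?p_down //.
congr c; rewrite loop_classV (loop_classM l (down g)) loop_classM.
apply/loop_classP/homotopic_ext => t.
change (orbit_class (path_concat (path_concat b (translate w g)) (path_rev b) t) =
  path_concat (path_concat l (down g)) (path_rev l) t).
rewrite !path_concatE; case: ifP => _.
  change (orbit_class (path_concat b (translate w g) (half1 t)) =
    path_concat l (down g) (half1 t)).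
  rewrite !path_concatE; case: ifP => _; first by rewrite lE.
  exact: orbit_class_act.
change (orbit_class (path_rev b (half2 t)) = path_rev l (half2 t)).
by rewrite /path_rev lE.
Qed.

Definition twist w x : M := transport (translate w (base_path x)).

(** The chosen base paths are not translates of one another; [twist w] measures the defect at each
    end of the path. *)
Lemma transport_move w x y (g : {path I from x to y}) :
  transport (translate w g) = transport g + (twist w y - twist w x).
Proof.
pose k := path_concat (path_concat (base_path x) g) (path_rev (base_path y)).
have := transport_move_loop w k; rewrite -/(transport g) => <-.
have -> : transport (translate w k) = transport (path_concat (path_concat (translate w (base_path x))
    (translate w g)) (path_rev (translate w (base_path y)))).
  apply/transport_homotopic/homotopic_ext => t.
  change (reg_act w (path_concat (path_concat (base_path x) g) (path_rev (base_path y)) t) =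
    path_concat (path_concat (translate w (base_path x)) (translate w g))
      (path_rev (translate w (base_path y))) t).
  rewrite !path_concatE; case: ifP => // _.
  change (reg_act w (path_concat (base_path x) g (half1 t)) =
    path_concat (translate w (base_path x)) (translate w g) (half1 t)).
  by rewrite !path_concatE; case: ifP.
rewrite !transport_concat transport_rev -/(twist w x) -/(twist w y).
by rewrite addrA subrK addrAC subrr add0r.
Qed.

Lemma transport_exists :
  exists (T : forall x y, {path I from x to y} -> M) (tw : gT -> X -> M),
    [/\ forall x y z (g : {path I from x to y}) (h : {path I from y to z}),
          T _ _ (path_concat g h) = T _ _ g + T _ _ h,
        forall x y (g h : {path I from x to y}), homotopic g h -> T _ _ g = T _ _ h,
        forall w x y (g : {path I from x to y}),
          T _ _ (translate w g) = T _ _ g + (tw w y - tw w x) &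
        forall g : {path I from x0 to x0}, T _ _ g = c (loop_class (down g))].
Proof.
exists transport, twist; split.
- exact: transport_concat.
- exact: transport_homotopic.
- exact: transport_move.
- exact: transport_loop.
Qed.
End Transport.

(** * Making the transport invariant under the group *)

Section Coboundary.
Variables (R : realType) (gT : finGroupType) (r : nat).
Variable rG : mx_representation R[i] [set: gT]%G r.
Local Notation C := R[i].
Local Notation V := 'rV[C]_r.
Local Notation X := (reg_space rG).
Local Notation I := (unit_interval R).
Local Open Scope complex_scope.
Implicit Types (w : gT) (x y z : X) (u v q : V).
Variables (J : finType) (a : J -> 'cV[C]_r).
Hypothesis a_neq0 : forall i, a i != 0.
Hypothesis a_indep : forall i j c, i != j -> a i != c *: a j.
Hypothesis aE : forall v, complement rG v <-> reg a v.
Hypothesis a_move : forall w i, exists j c, c != 0 /\ rG w *m a i = c *: a j.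
Variables (M : zmodType).
Hypothesis M_divisible : forall n (m : M), (0 < n)%N -> exists m', m' *+ n = m.
Variables (T : forall x y, {path I from x to y} -> M) (tw : gT -> X -> M).
Hypothesis T_concat : forall x y z (g : {path I from x to y}) (h : {path I from y to z}),
  T (path_concat g h) = T g + T h.
Hypothesis T_homotopic : forall x y (g h : {path I from x to y}),
  homotopic g h -> T g = T h.
Hypothesis T_move : forall w x y (g : {path I from x to y}),
  T (translate w g) = T g + (tw w y - tw w x).

Definition straight x y (g : {path I from x to y}) : Prop :=
  forall t, val (g t) = val x + (ival t)%:C *: (val y - val x).

Lemma cochain_exists : exists e : V -> V -> M,
  forall x y (g : {path I from x to y}), straight g -> e (val x) (val y) = T g.
Proof.
have /choice[e eE] : forall uv : V * V, exists m : M,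
    forall x y (g : {path I from x to y}), val x = uv.1 -> val y = uv.2 ->
      straight g -> m = T g.
  move=> [u v]; have [[x [y [g [xu yv sg]]]]|n] := pselect (exists x y
      (g : {path I from x to y}), [/\ val x = u, val y = v & straight g]); last first.
    (* A default value for pairs whose segment leaves the complement; only pairs of nearby points
       matter. *)
    by exists 0 => x y g xu yv sg; case: n; exists x, y, g.
  exists (T g) => x' y' g' /= x'u y'v sg'.
  have xx : x = x' by apply: val_inj; exact: (etrans xu (esym x'u)).
  have yy : y = y' by apply: val_inj; exact: (etrans yv (esym y'v)).
  subst x' y'; congr T; apply: path_ext => t; apply: val_inj.
  by rewrite sg sg'.
by exists (fun u v => e (u, v)) => x y g sg; exact: eE.
Qed.

Variable e : V -> V -> M.
Hypothesis eT : forall x y (g : {path I from x to y}), straight g -> e (val x) (val y) = T g.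

Definition reg_point v (cv : complement rG v) : X :=
  exist (fun v => v \in complement rG) v (mem_set cv).

(** In a ball contained in the complement, two sides of a triangle are homotopic to the third along
    straight lines. This makes [e v] a primitive of [e] near [v]. *)
Lemma near_triangle v : complement rG v -> exists2 d : R, 0 < d &
  forall u1 u2 u3, ball v d%:C u1 -> ball v d%:C u2 -> ball v d%:C u3 ->
    e u1 u2 + e u2 u3 = e u1 u3.
Proof.
move=> cv; have [d d0 dP] := near_segment cv; exists d => // u1 u2 u3 b1 b2 b3.
have cb u : ball v d%:C u -> complement rG u.
  move=> bu; have := dP u u bu bu 0; rewrite scale0r addr0; apply.
  by rewrite lexx ler01.
have [g12 s12] := segment_path (x := reg_point (cb _ b1)) (y := reg_point (cb _ b2)) (dP _ _ b1 b2).
have [g23 s23] := segment_path (x := reg_point (cb _ b2)) (y := reg_point (cb _ b3)) (dP _ _ b2 b3).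
have [g13 s13] := segment_path (x := reg_point (cb _ b1)) (y := reg_point (cb _ b3)) (dP _ _ b1 b3).
have := eT s12; rewrite /= => ->; have := eT s23; rewrite /= => ->.
have := eT s13; rewrite /= => ->; rewrite -T_concat; apply: T_homotopic.
have bseg u u' (t : I) : ball v d%:C u -> ball v d%:C u' ->
    ball v d%:C (u + (ival t)%:C *: (u' - u)).
  by move=> bu bu'; apply: cvx_ball => //; rewrite ival_ge0 ival_le1.
apply: convex_homotopy => t s s01; apply: dP => //.
  change (ball v d%:C (val (path_concat g12 g23 t))).
  by rewrite path_concatE; case: ifP => _; rewrite ?s12 ?s23; apply: bseg.
by rewrite s13; apply: bseg.
Qed.

Lemma cochain_loc_prim : loc_prim a e.
Proof.
move=> v /aE cv; have [d d0 dP] := near_triangle cv; exists d => //.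
have vv : ball v d%:C v by apply: ballxx; rewrite ltcR.
exists (e v) => u [vu _]; have uN := opn_ball vu; near=> u'.
have vu' : ball v d%:C u' by near: u'.
by rewrite -(dP v u u') // addrAC subrr add0r.
Unshelve. all: by end_near. Qed.

Lemma cochain_move w :
  exists tw' : V -> M, (forall x, tw' (val x) = tw w x) /\
  forall v, complement rG v ->
    \forall u \near v, e (lact rG w v) (lact rG w u) = e v u + (tw' u - tw' v).
Proof.
have /choice[tw' twE] : forall u, exists m, forall x, val x = u -> m = tw w x.
  move=> u; have [[x xu]|n] := pselect (exists x, val x = u).
    by exists (tw w x) => y yu; congr tw; apply: val_inj; exact: (etrans xu (esym yu)).
  by exists 0 => y yu; case: n; exists y.
have {}twE x : tw' (val x) = tw w x by exact: twE.
exists tw'; split=> // v cv; have [d d0 dP] := near_segment cv.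
have vv : ball v d%:C v by apply: ballxx; rewrite ltcR.
have dN := @near_ballx R r v d d0; near=> u.
have vu : ball v d%:C u by near: u; exact: dN.
have cu : complement rG u.
  have := dP u u vu vu 0; rewrite scale0r addr0; apply.
  by rewrite lexx ler01.
have [g sg] := segment_path (x := reg_point cv) (y := reg_point cu) (dP _ _ vv vu).
have sm : straight (translate w g).
  move=> t; change (val (g t) *m rG w^-1%g = lact rG w v + (ival t)%:C *: (lact rG w u - lact rG w v)).
  by rewrite sg /lact /= -mulmxBl scalemxAl -mulmxDl.
have := eT sm; rewrite T_move -(eT sg) /= => ->.
by rewrite -(twE (reg_point cu)) -(twE (reg_point cv)).
Unshelve. all: by end_near. Qed.

Lemma lactV w v : lact rG w^-1%g v = v *m rG w.
Proof. by rewrite /lact invgK. Qed.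

Lemma reg_move w v : reg a v -> reg a (v *m rG w).
Proof. by rewrite -lactV => /aE cv; apply/aE; exact: complement_lact. Qed.

Lemma form_cancel w i j l c c' : c != 0 ->
  rG w *m a j = c *: a i -> rG w *m a l = c' *: a i -> j = l.
Proof.
move=> c0 Ej El; apply/eqP/negbNE/negP => jl; rewrite eq_sym in jl.
have /negP := a_indep (c' / c) jl; apply; apply/eqP.
have inj (b b' : 'cV[C]_r) : rG w *m b = rG w *m b' -> b = b'.
  move/(congr1 (mulmx (rG w^-1%g))); rewrite !mulmxA -!repr_mxM ?inE //.
  by rewrite mulVg repr_mx1 !mul1mx.
by apply: inj; rewrite -scalemxAr Ej El scalerA divfK.
Qed.

Lemma form_preimage w i : exists j c, c != 0 /\ rG w *m a j = c *: a i.
Proof.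
have [j [c [c0 E]]] := a_move w^-1%g i; exists j, c^-1; split; first by rewrite invr_eq0.
have : a i = c *: (rG w *m a j).
  by rewrite scalemxAr -E mulmxA -repr_mxM ?inE // mulgV repr_mx1 mul1mx.
by move=> ->; rewrite scalerA mulVf // scale1r.
Qed.

Lemma simple_move w i j c q : c != 0 -> rG w *m a j = c *: a i ->
  simple_point a i q -> simple_point a j (q *m rG w) /\
  forall l, l != j -> frm (rG w *m a l) q != 0.
Proof.
move=> c0 Ej [q0 qk].
have fE l : frm (a l) (q *m rG w) = frm (rG w *m a l) q by rewrite /frm mulmxA.
have qN l : l != j -> frm (rG w *m a l) q != 0.
  move=> lj; have [k [c' [c'0 El]]] := a_move w l.
  rewrite El frmZl mulf_neq0 //; apply: qk; apply: contraNneq lj => ki.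
  by rewrite ki in El; rewrite (form_cancel c0 Ej El).
split=> //; split=> [|l lj]; first by rewrite fE Ej frmZl q0 mulr0.
by rewrite fE; exact: qN.
Qed.

(** Translation by [w] changes [e] by a coboundary and the form by a scalar, and neither affects the
    monodromy. Hence monodromies are constant on orbits of hyperplanes. *)
Lemma mon_move w i j c q m : c != 0 -> rG w *m a j = c *: a i ->
  mon a e (q *m rG w) (a j) m -> mon a e q (a i) m.
Proof.
move=> c0 Ej em.
have := mon_comp (@reg_move w) em; rewrite Ej => em'.
have bN (x : V) : reg a x -> frm (c *: a i) x != 0.
  by move=> ax; rewrite frmZl mulf_neq0 //; exact: ax.
have {em em'} em1 := mon_scale (invr_neq0 c0) bN em'.
rewrite scalerA mulVf // scale1r in em1.
have [tw' [_ twP]] := cochain_move w^-1%g.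
apply: (mon_coboundary (G := fun u => - tw' u) _ em1).
move=> u au; have cu : complement rG u by apply/aE.
have N := twP u cu; near=> v.
rewrite -!lactV; have -> : e (lact rG w^-1%g u) (lact rG w^-1%g v) = e u v + (tw' v - tw' u).
  by near: v.
by rewrite -addrA opprK [- tw' v + _]addrC subrKA subrr addr0.
Unshelve. all: by end_near. Qed.

Definition averaged_cross (nu : J -> M) u v : M :=
  \sum_(w : gT) \sum_l cross (nu l) (frm (a l) (u *m rG w)) (frm (a l) (v *m rG w)).

Lemma averaged_cross_move nu w u v :
  averaged_cross nu (lact rG w u) (lact rG w v) = averaged_cross nu u v.
Proof.
rewrite /averaged_cross [RHS](reindex_inj (mulgI w^-1%g)).
apply: eq_bigr => k _; apply: eq_bigr => l _.
by rewrite /lact -!mulmxA -!repr_mxM ?inE.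
Qed.

(** For each [w] exactly one form is carried by [w] to a multiple of [a i], and its cut contributes
    [n]. The other cuts have trivial monodromy at the simple point [q]. *)
Lemma averaged_cross_mon nu n i q : simple_point a i q ->
  (forall w j c, c != 0 -> rG w *m a j = c *: a i -> nu j = n) ->
  mon a (averaged_cross nu) q (a i) (n *+ #|gT|).
Proof.
move=> qi nuE.
have -> : n *+ #|gT| = \sum_(w : gT) n by rewrite -sumr_const; apply: eq_bigl.
apply: mon_sum => w; have [j [c [c0 Ej]]] := form_preimage w i.
have [_ qN] := simple_move c0 Ej qi.
have -> : n = \sum_l (if l == j then n else 0) by rewrite -big_mkcond big_pred1_eq.
apply: mon_sum => l.
have fE (u : V) : frm (a l) (u *m rG w) = frm (rG w *m a l) u by rewrite /frm mulmxA.
apply: (@mon_eq _ _ _ _ _ (fun u v => cross (nu l) (frm (rG w *m a l) u) (frm (rG w *m a l) v))).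
  by move=> u v; rewrite !fE.
case: eqVneq => [->|lj]; last by apply: mon_cross_other; exact: qN.
rewrite (nuE w j c c0 Ej) Ej.
have := mon_scale (invr_neq0 c0) _ (mon_cross a q (c *: a i) n).
rewrite scalerA mulVf // scale1r; apply=> x ax; rewrite frmZl mulf_neq0 //.
Qed.

Lemma averaged_cross_reg nu q b : reg a q -> mon a (averaged_cross nu) q b 0.
Proof.
move=> aq.
have -> : 0 = \sum_(w : gT) \sum_(l : J) (0 : M).
  by rewrite big1 // => w _; rewrite big1.
apply: mon_sum => w; apply: mon_sum => l.
have fE (u : V) : frm (a l) (u *m rG w) = frm (rG w *m a l) u by rewrite /frm mulmxA.
apply: (@mon_eq _ _ _ _ _ (fun u v => cross (nu l) (frm (rG w *m a l) u) (frm (rG w *m a l) v))).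
  by move=> u v; rewrite !fE.
by apply: mon_cross_other; rewrite -fE; exact: reg_move.
Qed.

Lemma cochain_prim : exists nu : J -> M,
  has_prim a (fun u v => e u v - averaged_cross nu u v) (fun=> True).
Proof.
have le := cochain_loc_prim.
have gT0 : (0 < #|gT|)%N by apply/card_gt0P; exists 1%g.
(* A single choice function: equal monodromies get equal roots, so the weights are again constant on
   orbits of hyperplanes. *)
have /choice[root rootE] : forall m : M, exists m', m' *+ #|gT| = m.
  by move=> m; exact: M_divisible.
have /choice[mu muE] : forall i, exists m, forall q, simple_point a i q -> mon a e q (a i) m.
  move=> i; have [[q qi]|n] := pselect (exists q, simple_point a i q); last first.
    by exists 0 => q qi; case: n; exists q.
  have [m em] := mon_exists a_neq0 a_indep le qi.
  by exists m => q' q'i; exact: (mon_constant a_neq0 a_indep le qi q'i em).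
exists (fun i => root (mu i)).
apply: (global_prim a_neq0 a_indep) => //; first by move=> ? _; exact: filterE.
move=> q _ simple; apply: (@mon0_has_prim _ _ _ _ _ _ _ 0).
have [[i qi]|n] := pselect (exists i, frm (a i) q = 0); last first.
  have aq : reg a q by move=> i; apply/eqP => qi; apply: n; exists i.
  rewrite -[0 in X in mon _ _ _ _ X](subrr 0); apply: monB; last exact: averaged_cross_reg.
  have [d d0 pd] := le q aq; exists d => //.
  by apply: has_prim_eq pd => u v; rewrite cross0 subr0.
have qs : simple_point a i q.
  by split=> // j ji; apply/eqP => qj; case/eqP: ji; exact: simple.
have : mon a (fun u v => e u v - averaged_cross (fun i => root (mu i)) u v) q (a i) 0.
  rewrite -(subrr (mu i)); apply: monB; first exact: muE.
  rewrite -[X in mon _ _ _ _ X](rootE (mu i)); apply: averaged_cross_mon => // w j c c0 Ej.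
  congr root; have [qj _] := simple_move c0 Ej qs.
  by apply: (mon_unique a_neq0 qs _ (muE i q qs)); exact: (mon_move c0 Ej (muE j _ qj)).
move=> [d d0 pd]; exists d => //; apply: has_prim_eq pd => u v.
by rewrite !cross0.
Qed.

(** Take for [F] a primitive of [e] minus the averaged cuts. As these are strictly invariant, [tw w]
    and [F (w x) - F x] have the same local differences, so they differ by a constant on the
    connected complement. *)
Lemma twist_coboundary : exists F : X -> M, forall w x y,
  tw w y - tw w x = (F (reg_act w y) - F y) - (F (reg_act w x) - F x).
Proof.
have [nu [F pF]] := cochain_prim.
exists (fun x => F (val x)) => w x y.
have [tw' [twE twP]] := cochain_move w.
pose K u := tw' u - (F (lact rG w u) - F u).
suff : K (val x) = K (val y).
  by rewrite /K !twE => /subr_swap.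
apply: (@reg_constant R r J a (fun=> True) M K) => //; last 2 first.
- exact/aE/set_valP.
- exact/aE/set_valP.
- by move=> v _; exact: filterE.
move=> u _ au; have cu : complement rG u by apply/aE.
have N := twP u cu.
have alu : reg a (lact rG w u) by apply/aE; exact: complement_lact.
have N1 := pF u (conj Logic.I au).
have N2 := near_mulmx (pF (lact rG w u) (conj Logic.I alu)).
have aN := near_reg au; near=> v.
have av : reg a v by near: v.
have cv : complement rG v by apply/aE.
have E1 : e (lact rG w u) (lact rG w v) = e u v + (tw' v - tw' u) by near: v.
have E2 : e u v - averaged_cross nu u v = F v - F u by near: v.
have E3 : e (lact rG w u) (lact rG w v) - averaged_cross nu (lact rG w u) (lact rG w v) =
  F (lact rG w v) - F (lact rG w u) by near: v.
move: E3; rewrite averaged_cross_move E1 addrAC E2 => E3.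
apply: subr_swap; rewrite opprB [F u - _]addrC addrACA [- F v + F u]addrC -[F u - F v]opprB -E3.
by rewrite [_ + (tw' v - _)]addrC addrK.
Unshelve. all: by end_near. Qed.
End Coboundary.

Lemma subrBB (M : zmodType) (a b c d : M) : (a - b) - (c - d) = (a - c) - (b - d).
Proof. by rewrite !opprB [d - c]addrC addrACA [- b + d]addrC. Qed.

(** * Descent of the splitting to the reflection group *)

Section Splitting.
Variables (R : realType) (gT : finGroupType) (r : nat).
Variable rG : mx_representation R[i] [set: gT]%G r.
Local Notation X := (reg_space rG).
Local Notation I := (unit_interval R).
Variable x0 : X.
Local Notation B := (braid_group x0).
Variables (p : {multiplicative (braid_group x0) -> gT}).
Hypothesis pP : is_braid_projection p.
Variables (M : zmodType) (F : gT * gT -> M) (c : braid_group x0 -> M).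
Hypothesis M_divisible : forall n (m : M), (0 < n)%N -> exists m', m' *+ n = m.
Hypothesis cF : forall b b', F (p b, p b') = c b' - c (b * b')%g + c b.
Hypothesis F1l : forall w, F (1%g, w) = 0.
Hypothesis F1r : forall w, F (w, 1%g) = 0.

Lemma invariant_transport :
  exists S : forall x y : X, {path I from x to y} -> M,
    [/\ forall x y z (g : {path I from x to y}) (h : {path I from y to z}),
          S _ _ (path_concat g h) = S _ _ g + S _ _ h,
        forall x y (g h : {path I from x to y}), homotopic g h -> S _ _ g = S _ _ h,
        forall w x y (g : {path I from x to y}), S _ _ (translate w g) = S _ _ g &
        forall g : {path I from x0 to x0}, S _ _ g = c (loop_class (down g))].
Proof.
have [J [a [a0 ai aE am]]] := arrangement_forms rG.
have [T [tw [TC TH TM TL]]] := transport_exists pP cF F1l F1r.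
have [e eT] := cochain_exists T.
have [G GP] := twist_coboundary a0 ai aE am M_divisible TC TH TM eT.
exists (fun x y g => T x y g - (G y - G x)); split.
- move=> x y z g h; rewrite TC [RHS]addrACA; congr (_ + _).
  by rewrite -opprD [G y - G x + _]addrC subrKA.
- by move=> x y g h gh; rewrite (TH _ _ _ _ gh).
- by move=> w x y g; rewrite TM GP subrBB addrC addrCA addKr.
- by move=> g; rewrite TL !subrr subr0.
Qed.

Lemma pullback_split : exists d : gT -> M, forall v w, F (v, w) = d w - d (v * w)%g + d v.
Proof.
have [S [SC SH SM SL]] := invariant_transport.
have Scst x : S x x (cst x : {path I from x to x}) = 0.
  apply: (@addrI _ (S x x (cst x : {path I from x to x}))).
  by rewrite addr0 -SC; apply: SH; exact: homotopic_mul1.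
have Srev x y (g : {path I from x to y}) : S _ _ (path_rev g) = - S _ _ g.
  apply/eqP; rewrite -addr_eq0 -SC -(Scst y).
  by apply/eqP/SH/homotopic_mulVl.
have Seq x y z (g : {path I from x to y}) (h : {path I from x to z}) :
    y = z -> (forall t, g t = h t) -> S _ _ g = S _ _ h.
  by move=> yz; subst z => /path_ext ->.
pose over w (l : {path I from (orbit_class x0) to (orbit_class x0)})
    (g : {path I from x0 to (reg_act w x0)}) :=
  forall t, l t = orbit_class (g t).
(* Two lifts ending at [reg_act w x0] differ by the loop [g] followed by the reverse of [g']. Its
   image lies in [P], where [S] coincides with [c]. *)
have uniq w l g l' g' : over w l g -> over w l' g' ->
    c (loop_class l) - S _ _ g = c (loop_class l') - S _ _ g'.
  move=> lg lg'; apply: subr_swap; rewrite -Srev -SC SL.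
  have -> : loop_class (down (path_concat g (path_rev g'))) =
      ((loop_class l : B) * (loop_class l')^-1)%g.
    rewrite loop_classV (loop_classM l); apply/loop_classP/homotopic_ext => t.
    change (orbit_class (path_concat g (path_rev g') t) = path_concat l (path_rev l') t).
    rewrite !path_concatE; case: ifP => _; first by rewrite lg.
    exact: esym (lg' (flip (half2 t))).
  have pV : p ((loop_class l : B) * (loop_class l')^-1)%g = 1%g.
    apply: (@mulIg _ (p (loop_class l'))); rewrite mul1g -gmulfM mulgVK.
    by rewrite (p_cover pP lg) (p_cover pP lg').
  by have := c_mull cF F1l (loop_class l') pV; rewrite mulgVK => ->; rewrite addrK.
have ex w : exists lg : {path I from (orbit_class x0) to (orbit_class x0)} *
    {path I from x0 to (reg_act w x0)}, over w lg.1 lg.2.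
  have [g _] := path_connected x0 (reg_act w x0).
  have [|||l lE] := @mkpath R (orbit_space rG) (down g) (orbit_class x0) (orbit_class x0).
  - exact: paths_continuous.
  - exact: path_zero.
  - by rewrite path_one orbit_class_act.
  by exists (l, g).
have /boolp.choice[lg lgP] : forall w, exists m : M, exists l g, over w l g /\
  m = c (loop_class l) - S _ _ g.
  by move=> w; have [[l g] lg] := ex w; exists (c (loop_class l) - S _ _ g), l, g.
exists lg => v w.
have [l [g [lE ->]]] := lgP v; have [l' [g' [lE' ->]]] := lgP w.
have [k [kE [lk kb]]] := covers_mul lE erefl lE' erefl (fun t => erefl : translate v g' t = _).
have [l2 [g2 [lE2 ->]]] := lgP (v * w)%g.
rewrite (uniq _ _ _ _ _ lE2 lk).
(* [k] is [g] followed by the translate of [g'] by [v]: the invariance of [S] is used here. *)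
have Sk : S _ _ k = S _ _ g + S _ _ g'.
  by rewrite -(SM v _ _ g') -SC; apply: Seq kE; rewrite reg_actM.
have := cF (loop_class l) (loop_class l').
rewrite !(p_cover pP lE) !(p_cover pP lE') kb => ->.
have kg : S _ _ g' - S _ _ k = - S _ _ g by rewrite Sk opprD addrCA subrr addr0.
by rewrite subrBB kg opprK -[RHS]addrA subrKC.
Qed.
End Splitting.

Lemma mult_group_divisible (R : realType) n (m : mult_group R[i]) :
  (0 < n)%N -> exists m', m' *+ n = m.
Proof.
move=> n0; have E k (x : mult_group R[i]) : mult_val (x *+ k) = mult_val x ^+ k.
  by elim: k => [|k IH]; rewrite ?mulrS ?exprS //= IH.
have r0 : n.-root (mult_val m) != 0 by rewrite rootC_eq0 // mult_val_neq0.
by exists (MultGroup r0); apply: val_inj; rewrite /= E /= rootCK.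
Qed.

Theorem lemma7p1 (R : realType) (gT : finGroupType) (r : nat)
    (rG : mx_representation R[i] [set: gT]%G r)
    (W_irreducible : mx_irreducible rG)
    (W_two_reflection : two_reflection_group rG)
    (x0 : reg_space rG) :
  exists p : {multiplicative braid_group x0 -> gT},
    is_braid_projection p
    /\ injective (inflation p : H2 gT (mult_group R[i]) ->
                                H2 (braid_group x0) (mult_group R[i])).
Proof.
have [p pP] := braid_projection_exists W_two_reflection.1 x0; exists p; split=> //.
apply: raddf_inj => k; change (inflation p k = 0 -> k = 0).
rewrite -(cohomology_classK k); set f := repr k.
rewrite inflationE -[RHS](raddf0 (@cohomology_class _ _)) => /cohomology_classP[c cE].
rewrite -[RHS](raddf0 (@cohomology_class _ _)); apply/cohomology_classP.
have {}cE b b' : val f (p b, p b') = c b' - c (b * b')%g + c b.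
  by have := congr1 (@^~ (b, b')) cE; rewrite subr0 /coboundary1 /= => <-.
have fc := cocycle2P f.
(* A cocycle takes the value [m] on every pair containing the unit. The constant [m] is the
   coboundary of the constant cochain [m], so subtracting it normalises [f] within its class. *)
pose m := val f (1%g, 1%g).
have f1l w : val f (1%g, w) = m.
  by have := fc 1%g 1%g w; rewrite !mul1g subrr add0r => /eqP; rewrite subr_eq0 => /eqP.
have f1r w : val f (w, 1%g) = m.
  by have := fc w 1%g 1%g; rewrite !mulg1 subrK => /eqP; rewrite subr_eq0 => /eqP.
have [||||d dE] := @pullback_split R gT r rG x0 p pP _ (fun u => val f u - m) (fun b => c b - m).
- by move=> n x; exact: mult_group_divisible.
- by move=> b b'; rewrite cE subrBB subrr subr0 addrA.
- by move=> w; rewrite f1l subrr.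
- by move=> w; rewrite f1r subrr.
exists (fun w => d w + m); apply/funext => -[v w]; rewrite subr0 /coboundary1 /=.
by rewrite -[LHS](subrK m) dE [d (v * w)%g + m]addrC addrKA addrA.
Qed.
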